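(* Let $k\in\mathbb{N}$, $A=\ell^1(\mathbb{Z}_+)$, $\mathfrak{A}_k=\ell^1(\mathbb{Z}_+^k)$, and let $Q=\ell^1(\mathbb{Z})/\ell^1(\mathbb{Z}_+)$, regarded as a symmetric Banach $A$-bimodule. There are isomorphisms of seminormed spaces $$H^2(\mathfrak{A}_k,\mathfrak{A}_k)\cong\mathrm{Har}H^2(\mathfrak{A}_k,\mathfrak{A}_k)\cong\left(Z^1(A,Q\widehat{\otimes}\ell^1(\mathbb{Z}_+^{k-1}))\right)^{\oplus k}.$$ In particular, $H^2(\mathfrak{A}_k,\mathfrak{A}_k)$ is an infinite-dimensional Banach space.
   Context: All algebras are over $\mathbb{C}$; $\mathbb{Z}_+=\{0,1,2,\dots\}$; $\ell^1(\mathbb{Z}_+^k)$ and $\ell^1(\mathbb{Z})$ carry convolution multiplication; $\widehat{\otimes}$ is the projective tensor product of Banach spaces. $\ell^1(\mathbb{Z})$ is a symmetric Banach $A$-bimodule via the inclusion $A\hookrightarrow\ell^1(\mathbb{Z})$, $A$ is a closed submodule, and $Q$ is the quotient bimodule. For a Banach space $E$, $Q\widehat{\otimes}E$ is an $A$-bimodule with $A$ acting on the first factor. Hochschild cohomology: for a Banach algebra $B$ and Banach $B$-bimodule $M$, $C^n(B,M)$ is the Banach space of bounded $n$-linear maps $B^n\to M$, with coboundary map $\delta^n:C^n(B,M)\to C^{n+1}(B,M)$, $$\delta^n\psi(a_1,\dots,a_{n+1})=a_1\psi(a_2,\dots,a_{n+1})+\sum_{j=1}^n(-1)^j\psi(a_1,\dots,a_ja_{j+1},\dots,a_{n+1})+(-1)^{n+1}\psi(a_1,\dots,a_n)a_{n+1}.$$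 $Z^n(B,M)=\ker\delta^n$ and $H^n(B,M)=Z^n(B,M)/\operatorname{im}\delta^{n-1}$ with the quotient seminorm. Thus $Z^1(B,M)$ is the Banach space of bounded derivations $B\to M$. An isomorphism of seminormed spaces is a bounded linear map with a bounded linear two-sided inverse. Harrison cohomology: for a commutative Banach algebra $B$ and a symmetric Banach $B$-bimodule $M$, let $\mathrm{Har}C^n(B,M)=\{\psi\circ e_n(1):\psi\in C^n(B,M)\}$ (viewing $\psi$ as a linear map on $B^{\widehat{\otimes}n}$). Here $e_n(1)=\prod_{2\le j\le n}\frac{s_n-\mu_j}{\mu_1-\mu_j}$, $\mu_j=2^j-2$, and $s_n(a_1\otimes\cdots\otimes a_n)=\sum_{p=1}^{n-1}\sum_\sigma\operatorname{sgn}(\sigma)\,a_{\sigma^{-1}(1)}\otimes\cdots\otimes a_{\sigma^{-1}(n)}$, the inner sum over permutations with $\sigma(1)<\cdots<\sigma(p)$ and $\sigma(p+1)<\cdots<\sigma(n)$. These form a subcomplex of the Hochschild cochain complex ($n\ge1$) with cohomology $\mathrm{Har}H^n(B,M)$; in degree $2$ the Harrison cochains are exactly the symmetric bilinear ones. *)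

(* Defs.v *)
From HB Require Import structures.
From mathcomp Require Import all_boot all_order all_algebra.
From mathcomp Require Import fingroup perm generic_quotient ring_quotient complex.
From mathcomp Require Import all_classical all_reals.

(* Everything is over the complex numbers R[i], for an arbitrary model R of the
   real numbers; norms take their values in R. *)

Set Implicit Arguments.
Unset Strict Implicit.
Unset Printing Implicit Defensive.
Import Order.TTheory GRing.Theory Num.Theory.
Import ComplexField.Normc.
Local Open Scope ring_scope.
Local Open Scope quotient_scope.

HB.mixin Record isSemiNormedCMod (R : realType) V
    of GRing.Lmodule R[i] V & Num.SemiNormedZmodule R V := {
  snormZ : forall (c : R[i]) (x : V), `|c *: x| = normc c * `|x| }.

#[short(type="snModType")]
HB.structure Definition SNMod (R : realType) :=
  {V of GRing.Lmodule R[i] V & Num.SemiNormedZmodule R V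
   & isSemiNormedCMod R V}.

Lemma normc_ge0 (R : realType) (x : R[i]) : 0 <= normc x.
Proof. by case: x => a b; exact: sqrtr_ge0. Qed.

HB.factory Record Lmodule_isSNMod (R : realType) V of GRing.Lmodule R[i] V := {
  snorm : V -> R;
  snormD : forall x y, snorm (x + y) <= snorm x + snorm y;
  snormZ_le : forall c x, snorm (c *: x) <= normc c * snorm x }.

HB.builders Context (R : realType) V of Lmodule_isSNMod R V.

Let snormZ c x : snorm (c *: x) = normc c * snorm x.
Proof.
have [->|c0] := eqVneq c 0.
  rewrite normc0 mul0r scale0r; apply/eqP; rewrite eq_le; apply/andP; split.
    by have := snormZ_le 0 0; rewrite scale0r normc0 mul0r.
  by have := snormD 0 0; rewrite addr0 -subr_ge0 addrK.
have nc : 0 < normc c.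
  by rewrite lt_def normc_ge0 andbT; apply: contra c0 => /eqP/eq0_normc ->.
apply/eqP; rewrite eq_le snormZ_le/= -ler_pdivlMl// -normcV -{1}[x](scalerK c0).
exact: snormZ_le.
Qed.

Let snormMn x n : snorm (x *+ n) = snorm x *+ n.
Proof.
rewrite -scaler_nat snormZ -[normc _]/(normc (1 *+ n : Rcomplex R)).
by rewrite normcMn normc1 mulr_natl.
Qed.

Let snormN x : snorm (- x) = snorm x.
Proof.
rewrite -scaleN1r snormZ -[normc _]/(normc (- 1 : Rcomplex R)).
by rewrite normcN normc1 mul1r.
Qed.

HB.instance Definition _ :=
  Num.Zmodule_isSemiNormed.Build R V snormD snormMn snormN.
HB.instance Definition _ := isSemiNormedCMod.Build R V snormZ.
HB.end.

(* Imported only now: Hierarchy Builder rejects the declaration of [SNMod] once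
   [normedModType] is in scope, which it does not inherit from. *)
From mathcomp Require Import ereal esum topology normedtype sequences.
Import numFieldNormedType.Exports.
Local Open Scope classical_set_scope.

Section ComplexNorm.
Variable R : realType.
Implicit Types x y : R[i].

Lemma normcD x y : normc (x + y) <= normc x + normc y.
Proof. exact: le_normcD. Qed.

Lemma normcN1 : normc (- 1 : R[i]) = 1.
Proof. by rewrite -[LHS]/(normc (- 1 : Rcomplex R)) normcN normc1. Qed.

Let snormcM (c : R[i]) (x : R[i]^o) : normc (c *: x) <= normc c * normc x.
Proof. by rewrite normcM. Qed.

HB.instance Definition _ := Lmodule_isSNMod.Build R R[i]^o normcD snormcM.
End ComplexNorm.

(* A linear subspace of [L] with a seminorm that need only be meaningful on
   that subspace. *)
Record snData (R : realType) (L : lmodType R[i]) := SnData {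
  sn_pred : {pred L};
  sn_norm : L -> R;
  sn_closed : subsemimod_closed sn_pred;
  sn_normD : {in sn_pred &, forall x y, sn_norm (x + y) <= sn_norm x + sn_norm y};
  sn_normZ : forall c, {in sn_pred, forall x, sn_norm (c *: x) <= normc c * sn_norm x} }.

Section SnSpace.
Variables (R : realType) (L : lmodType R[i]) (d : snData L).

HB.instance Definition _ := GRing.isSubmodClosed.Build R[i] L (sn_pred d) (sn_closed d).

Definition snspace := {x : L | x \in sn_pred d}.
HB.instance Definition _ := SubChoice.on snspace.
HB.instance Definition _ := [SubChoice_isSubLmodule of snspace by <:].

Let snormD (x y : snspace) : sn_norm d (\val (x + y)) <= sn_norm d (\val x) + sn_norm d (\val y).
Proof. by rewrite raddfD sn_normD ?(valP x) ?(valP y). Qed.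

Let snormZ c (x : snspace) : sn_norm d (\val (c *: x)) <= normc c * sn_norm d (\val x).
Proof. by rewrite linearZ sn_normZ // (valP x). Qed.

HB.instance Definition _ := Lmodule_isSNMod.Build R snspace snormD snormZ.

Lemma snspace_normE (x : snspace) : `|x| = sn_norm d (\val x).
Proof. by []. Qed.

End SnSpace.

Record lsubspace (R : realType) (V : lmodType R[i]) := LSubspace {
  ssp_pred :> V -> Prop;
  ssp_closed : subsemimod_closed (fun x => `[< ssp_pred x >]) }.

Section SubQuotient.
Variables (R : realType) (V : snModType R) (W : lsubspace V).

Definition ssp_bool : {pred V} := fun x => `[< W x >].
HB.instance Definition _ := GRing.isSubmodClosed.Build R[i] V ssp_bool (ssp_closed W).

Let subD : {in ssp_bool &, forall x y : V, `|x + y| <= `|x| + `|y|}.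
Proof. by move=> x y _ _; exact: ler_normD. Qed.
Let subZ c : {in ssp_bool, forall x : V, `|c *: x| <= normc c * `|x|}.
Proof. by move=> x _; rewrite snormZ. Qed.

Definition subsp : snModType R := snspace (SnData (ssp_closed W) subD subZ).

Definition subsp_val (x : subsp) : V := \val x.

Lemma subsp_valP x : W (subsp_val x).
Proof. exact/asboolP/(valP x). Qed.
Lemma subsp_val0 : subsp_val 0 = 0. Proof. by []. Qed.
Lemma subsp_valD x y : subsp_val (x + y) = subsp_val x + subsp_val y.
Proof. by []. Qed.
Lemma subsp_valZ c x : subsp_val (c *: x) = c *: subsp_val x. Proof. by []. Qed.

Definition qsp := Quotient.quot ssp_bool.
HB.instance Definition _ := GRing.Zmodule.on qsp.

Definition qproj (x : V) : qsp := \pi_(Quotient.quot ssp_bool) x.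

Definition qrepr (q : qsp) : V := repr (q : Quotient.quot ssp_bool).

Lemma qreprK q : qproj (qrepr q) = q.
Proof. by rewrite /qproj /qrepr reprK. Qed.

Lemma qprojP (x y : V) : qproj x = qproj y <-> W (x - y).
Proof.
split=> [/eqP|Wxy]; first by rewrite -Quotient.idealrBE => /asboolP.
by apply/eqP; rewrite -Quotient.idealrBE; apply/asboolP.
Qed.

Lemma qproj_surj (q : qsp) : exists x, qproj x = q.
Proof. by exists (qrepr q); exact: qreprK. Qed.

Lemma qprojD x y : qproj (x + y) = qproj x + qproj y.
Proof. exact: (raddfD \pi_(Quotient.quot ssp_bool)). Qed.

Lemma lsubspace0 : W 0.
Proof. by apply/asboolP; exact: (rpred0 (ssp_bool : submodClosed V)). Qed.

Lemma lsubspaceD x y : W x -> W y -> W (x + y).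
Proof.
by move=> /asboolP Wx /asboolP Wy; apply/asboolP; exact: (rpredD (S := ssp_bool)).
Qed.

Lemma lsubspaceZ c x : W x -> W (c *: x).
Proof. by move=> /asboolP Wx; apply/asboolP; exact: (rpredZ (s := ssp_bool)). Qed.

Definition qscale (c : R[i]) (q : qsp) : qsp :=
  qproj (c *: qrepr q).

Lemma qscaleE c x : qscale c (qproj x) = qproj (c *: x).
Proof.
apply/qprojP; rewrite -scalerBr; apply: lsubspaceZ.
by apply/qprojP; rewrite qreprK.
Qed.

Let qscalerA a b q : qscale a (qscale b q) = qscale (a * b) q.
Proof. by have [x <-] := qproj_surj q; rewrite !qscaleE scalerA. Qed.
Let qscale1r : left_id 1 qscale.
Proof. by move=> q; have [x <-] := qproj_surj q; rewrite qscaleE scale1r. Qed.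
Let qscalerDr : right_distributive qscale +%R.
Proof.
move=> c q r; have [x <-] := qproj_surj q; have [y <-] := qproj_surj r.
by rewrite -qprojD !qscaleE scalerDr qprojD.
Qed.
Let qscalerDl q : {morph qscale^~ q : a b / a + b}.
Proof. by move=> a b; have [x <-] := qproj_surj q; rewrite !qscaleE scalerDl qprojD. Qed.

HB.instance Definition _ := GRing.Zmodule_isLmodule.Build R[i] qsp
  qscalerA qscale1r qscalerDr qscalerDl.

Lemma qprojZ c x : qproj (c *: x) = c *: qproj x.
Proof. by rewrite -qscaleE. Qed.

Definition qnorm (q : qsp) : R := inf [set `|x| | x in [set x : V | qproj x = q]].

Lemma qnorm_has_inf q : has_inf [set `|x| | x in [set x : V | qproj x = q]].
Proof.
split; first by have [x xq] := qproj_surj q; exists `|x|, x.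
by exists 0 => _ [x _ <-]; exact: normr_ge0.
Qed.

Lemma qnorm_le x : qnorm (qproj x) <= `|x|.
Proof. by apply: ge_inf; [have [] := qnorm_has_inf (qproj x)|exists x]. Qed.

Lemma qnorm_lt q e : 0 < e -> exists2 x, qproj x = q & `|x| < qnorm q + e.
Proof.
move=> e0; have [_ [x xq <-] xe] := inf_adherent e0 (qnorm_has_inf q).
by exists x.
Qed.

Lemma qnorm_lip q (n K : R) : 0 <= K ->
  (forall x, qproj x = q -> n <= K * `|x|) -> n <= K * qnorm q.
Proof.
move=> K0 nK; apply/ler_addgt0Pr => e e0.
have K1 : 0 < K + 1 by rewrite ltr_pwDr.
have [x xq xe] := qnorm_lt q (divr_gt0 e0 K1).
rewrite (le_trans (nK x xq))// (le_trans (ler_wpM2l K0 (ltW xe)))// mulrDr lerD2l.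
by rewrite mulrCA ger_pMr// ler_pdivrMr// mul1r lerDl.
Qed.

Let qnormD q r : qnorm (q + r) <= qnorm q + qnorm r.
Proof.
apply/ler_addgt0Pr => e e0.
have e20 : 0 < e / 2 by rewrite divr_gt0.
have [x <- xe] := qnorm_lt q e20; have [y <- ye] := qnorm_lt r e20.
rewrite -qprojD (le_trans (qnorm_le _))// (le_trans (ler_normD _ _))//.
by rewrite (splitr e) addrACA lerD// ltW.
Qed.

Let qnormZ_le c q : qnorm (c *: q) <= normc c * qnorm q.
Proof.
apply: qnorm_lip => [|x <-]; first exact: normc_ge0.
by rewrite -qprojZ (le_trans (qnorm_le _))// snormZ.
Qed.

HB.instance Definition _ := Lmodule_isSNMod.Build R qsp qnormD qnormZ_le.

End SubQuotient.

Section FctModule.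
Variables (R : realType) (T : Type) (V : lmodType R[i]).

Lemma fctDE (f g : T -> V) t : (f + g) t = f t + g t. Proof. by []. Qed.
Lemma fctZE c (f : T -> V) t : (c *: f) t = c *: f t. Proof. by []. Qed.
End FctModule.

Definition bounded_bilinear (R : realType) (E F G : snModType R)
    (f : E -> F -> G) : Prop :=
  [/\ forall y, linear (fun x => f x y),
      forall x, linear (f x)
    & exists c, forall x y, `|f x y| <= c * `|x| * `|y| ].

(* Completeness plays no role in the definition of the complexes below, so it
   is not part of the structures [normedAlg] and [bimod]. *)
Record normedAlg (R : realType) := NormedAlg {
  na_car :> snModType R;
  na_mul : na_car -> na_car -> na_car;
  na_mulA : associative na_mul;
  na_mul_bilinear : bounded_bilinear na_mul;
  na_mul_norm : forall x y, `|na_mul x y| <= `|x| * `|y| }.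

Record bimod (R : realType) (B : normedAlg R) := Bimod {
  bm_car :> snModType R;
  lact : B -> bm_car -> bm_car;
  ract : bm_car -> B -> bm_car;
  lact_bilinear : bounded_bilinear lact;
  ract_bilinear : bounded_bilinear ract;
  lactA : forall a b x, lact (na_mul a b) x = lact a (lact b x);
  ractA : forall a b x, ract x (na_mul a b) = ract (ract x a) b;
  lractA : forall a b x, ract (lact a x) b = lact a (ract x b) }.

Definition regular_bimod (R : realType) (B : normedAlg R) : bimod B :=
  Bimod (@na_mul_bilinear R B) (@na_mul_bilinear R B)
    (fun a b x => esym (na_mulA a b x)) (fun a b x => na_mulA x a b)
    (fun a b x => esym (na_mulA a x b)).

Section Cochains.
Variables (R : realType) (B M : snModType R) (n : nat).
Implicit Types psi : ('I_n -> B) -> M.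

Definition multilinear psi : Prop :=
  forall a i, linear (fun x => psi (fun j => if j == i then x else a j)).

Definition mbound psi : set R :=
  [set c | 0 <= c /\ forall a, `|psi a| <= c * \prod_i `|a i| ].

Definition mnorm psi : R := inf (mbound psi).

Definition bounded_multilinear : {pred ('I_n -> B) -> M} :=
  fun psi => `[< multilinear psi /\ exists c, mbound psi c >].

Lemma mboundD psi phi c d : mbound psi c -> mbound phi d -> mbound (psi + phi) (c + d).
Proof.
move=> [c0 cP] [d0 dP]; split=> [|a]; first exact: addr_ge0.
by rewrite (le_trans (ler_normD _ _))// mulrDl lerD.
Qed.

Lemma mboundZ psi c d : mbound psi c -> mbound (d *: psi) (normc d * c).
Proof.
move=> [c0 cP]; split=> [|a]; first by rewrite mulr_ge0// normc_ge0.
by rewrite -mulrA [leLHS]snormZ ler_wpM2l// normc_ge0.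
Qed.

Lemma mbound0 : mbound 0 0.
Proof. by split=> // a; rewrite [_ a](_ : _ = 0)// normr0 mul0r. Qed.

Lemma mnormP psi : bounded_multilinear psi -> mbound psi (mnorm psi).
Proof.
case/asboolP => _ [c pc].
have hi : has_inf (mbound psi) by split; [exists c|exists 0 => d []].
split=> [|a]; first by apply: lb_le_inf; [exists c|move=> d []].
have P0 : 0 <= \prod_i `|a i| by rewrite prodr_ge0.
apply/ler_addgt0Pr => e e0.
have P1 : 0 < \prod_i `|a i| + 1 by rewrite ltr_pwDr.
have [d [d0 dP] de] := inf_adherent (divr_gt0 e0 P1) hi.
rewrite (le_trans (dP a))// (le_trans (ler_wpM2r P0 (ltW de)))//.
by rewrite mulrDl lerD2l mulrAC ler_pdivrMr// ler_pM2l// lerDl.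
Qed.

Lemma mnorm_le psi c : mbound psi c -> mnorm psi <= c.
Proof. by move=> pc; apply: ge_inf => //; exists 0 => d []. Qed.

Let bounded_multilinear_closed : subsemimod_closed bounded_multilinear.
Proof.
split.
  split.
    apply/asboolP; split; last by exists 0; exact: mbound0.
    by move=> a i k x y; rewrite /= scaler0 addr0.
  move=> psi phi /asboolP[lp [c cP]] /asboolP[lq [d dP]]; apply/asboolP.
  split; last by exists (c + d); exact: mboundD.
  move=> a i k x y.
  by rewrite /= !fctDE (lp a i k x y) (lq a i k x y) scalerDr addrACA.
move=> d psi /asboolP[lp [c cP]]; apply/asboolP.
split; last by exists (normc d * c); exact: mboundZ.
move=> a i k x y.
by rewrite /= !fctZE (lp a i k x y) scalerDr !scalerA mulrC.
Qed.

Let mnormD : {in bounded_multilinear &, forall psi phi,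
  mnorm (psi + phi) <= mnorm psi + mnorm phi}.
Proof.
by move=> psi phi pP qP; apply: mnorm_le; apply: mboundD; exact: mnormP.
Qed.

Let mnormZ c : {in bounded_multilinear, forall psi,
  mnorm (c *: psi) <= normc c * mnorm psi}.
Proof. by move=> psi pP; apply: mnorm_le; apply: mboundZ; exact: mnormP. Qed.

Definition cochain : snModType R :=
  snspace (SnData bounded_multilinear_closed mnormD mnormZ).

Definition cfun (psi : cochain) : ('I_n -> B) -> M := \val psi.

Lemma cfunD (psi phi : cochain) : cfun (psi + phi) = cfun psi + cfun phi. Proof. by []. Qed.
Lemma cfunZ c (psi : cochain) : cfun (c *: psi) = c *: cfun psi. Proof. by []. Qed.

End Cochains.

Section Hochschild.
Variables (R : realType) (B : normedAlg R) (M : bimod B).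

(* Entries are indexed from 0, hence the exponent [j.+1]; [lift ord_max] and
   [lift ord0] are the inclusions [i |-> i] and [i |-> i + 1]. *)
Definition hmerge n (j : 'I_n) (a : 'I_n.+1 -> B) (i : 'I_n) : B :=
  if (i < j)%N then a (lift ord_max i)
  else if i == j then na_mul (a (lift ord_max i)) (a (lift ord0 i))
  else a (lift ord0 i).

Definition hdelta n (psi : ('I_n -> B) -> M) : ('I_n.+1 -> B) -> M := fun a =>
  lact (a ord0) (psi (fun i => a (lift ord0 i)))
  + \sum_(j < n) (-1) ^+ j.+1 *: psi (hmerge j a)
  + (-1) ^+ n.+1 *: ract (psi (fun i => a (lift ord_max i))) (a ord_max).

Lemma hdelta_linear n : linear (@hdelta n).
Proof.
move=> c psi phi; apply/funext => a.
rewrite fctDE fctZE /hdelta.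
have [_ lL _] := @lact_bilinear R B M; have [rL _ _] := @ract_bilinear R B M.
rewrite !fctDE !fctZE lL rL.
under eq_bigr => j _ do rewrite fctDE fctZE scalerDr scalerA mulrC -scalerA.
rewrite big_split -scaler_sumr !scalerDr !scalerA [_ * c]mulrC.
by rewrite [X in X + _]addrACA [LHS]addrACA.
Qed.

Lemma hdelta0 n : @hdelta n 0 = 0.
Proof.
have := hdelta_linear (-1) (0 : ('I_n -> B) -> M) 0.
by rewrite scaler0 addr0 scaleN1r addNr.
Qed.

Lemma hdeltaD n (psi phi : ('I_n -> B) -> M) :
  hdelta (psi + phi) = hdelta psi + hdelta phi.
Proof. by have := hdelta_linear 1 psi phi; rewrite !scale1r. Qed.

Lemma hdeltaZ n c (psi : ('I_n -> B) -> M) : hdelta (c *: psi) = c *: hdelta psi.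
Proof. by have := hdelta_linear c psi 0; rewrite hdelta0 !addr0. Qed.

(* [P] is a graded subspace of the Hochschild complex; it is meant to be a
   subcomplex, in which case the coboundaries [hdelta psi] below are
   automatically cocycles lying in [P]. *)
Variable P : forall n, lsubspace (cochain B M n).

Let cocycle_closed n :
  subsemimod_closed (fun phi : cochain B M n => `[< P n phi /\ hdelta (cfun phi) = 0 >]).
Proof.
split.
  split; first by apply/asboolP; split; [exact: lsubspace0|exact: hdelta0].
  move=> x y /asboolP[Px dx] /asboolP[Py dy]; apply/asboolP.
  by split; [exact: lsubspaceD|rewrite cfunD hdeltaD dx dy addr0].
move=> c x /asboolP[Px dx]; apply/asboolP.
by split; [exact: lsubspaceZ|rewrite cfunZ hdeltaZ dx scaler0].
Qed.

Definition cocycles n : snModType R := subsp (LSubspace (@cocycle_closed n)).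

Definition is_coboundary n : cochain B M n -> Prop :=
  match n with
  | 0 => fun phi => phi = 0
  | m.+1 => fun phi => exists2 psi : cochain B M m, P m psi & cfun phi = hdelta (cfun psi)
  end.

Lemma is_coboundary0 n : @is_coboundary n 0.
Proof. by case: n => [|n] //=; exists 0; [exact: lsubspace0|rewrite hdelta0]. Qed.

Lemma is_coboundaryD n x y :
  @is_coboundary n x -> is_coboundary y -> is_coboundary (x + y).
Proof.
case: n x y => [|n] x y /=; first by move=> -> ->; rewrite addr0.
move=> [u Pu xu] [v Pv yv].
by exists (u + v); [exact: lsubspaceD|rewrite !cfunD hdeltaD -xu -yv].
Qed.

Lemma is_coboundaryZ n c x : @is_coboundary n x -> is_coboundary (c *: x).
Proof.
case: n x => [|n] x /=; first by move=> ->; rewrite scaler0.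
by move=> [u Pu xu]; exists (c *: u); [exact: lsubspaceZ|rewrite !cfunZ hdeltaZ -xu].
Qed.

Let coboundary_closed n :
  subsemimod_closed (fun z : cocycles n => `[< is_coboundary (subsp_val z) >]).
Proof.
split; first split.
- by apply/asboolP; rewrite subsp_val0; exact: is_coboundary0.
- move=> x y /asboolP cx /asboolP cy; apply/asboolP.
  by rewrite subsp_valD; exact: is_coboundaryD.
- move=> c x /asboolP cx; apply/asboolP.
  by rewrite subsp_valZ; exact: is_coboundaryZ.
Qed.

Definition cohomology n : snModType R := qsp (LSubspace (@coboundary_closed n)).

End Hochschild.

Section HochschildHarrison.
Variables (R : realType) (B : normedAlg R) (M : bimod B).

Let whole_closed n : subsemimod_closed (fun phi : cochain B M n => `[< True >]).
Proof.
have T x : x \in (fun phi : cochain B M n => `[< True >]) by apply/asboolP.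
by split; [split=> [|x y _ _]|move=> c x _]; exact: T.
Qed.

Definition whole_complex n : lsubspace (cochain B M n) := LSubspace (@whole_closed n).

Definition hochZ n : snModType R := cocycles whole_complex n.
Definition hochH n : snModType R := cohomology whole_complex n.

Definition is_shuffle n (p : nat) (s : 'S_n) : bool :=
  [forall i : 'I_n, forall j : 'I_n,
    [&& (i < j)%N & (j < p)%N || (p <= i)%N] ==> (s i < s j)%N].

(* [shuffle psi] is psi \o s_n. *)
Definition shuffle n (psi : ('I_n -> B) -> M) : ('I_n -> B) -> M := fun a =>
  \sum_(1 <= p < n) \sum_(s : 'S_n | is_shuffle p s)
    (-1) ^+ s *: psi (fun i => a ((s^-1)%g i)).

Definition harr_mu (j : nat) : R[i] := 2 ^+ j - 2.

(* [harrison_proj psi] is psi \o e_n(1); the factors, for j = 2, .., n, are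
   polynomials in s_n and hence commute. *)
Definition harrison_proj n (psi : ('I_n -> B) -> M) : ('I_n -> B) -> M :=
  foldr (fun j phi => (harr_mu 1 - harr_mu j)^-1 *: (shuffle phi - harr_mu j *: phi))
    psi (iota 2 n.-1).

Lemma shuffle_linear n : linear (@shuffle n).
Proof.
move=> c psi phi; apply/funext => a.
rewrite fctDE fctZE /shuffle scaler_sumr -big_split.
apply: eq_bigr => p _; rewrite scaler_sumr -big_split; apply: eq_bigr => s _.
by rewrite fctDE fctZE scalerDr !scalerA [c * _]mulrC.
Qed.

Lemma harrison_proj_linear n : linear (@harrison_proj n).
Proof.
rewrite /harrison_proj => c psi phi; elim: (iota 2 n.-1) => //= j s ->.
set u := foldr _ psi s; set v := foldr _ phi s.
rewrite shuffle_linear; move: ((harr_mu 1 - harr_mu j)^-1) (harr_mu j) => k m.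
rewrite [m *: (_ + _)]scalerDr opprD addrACA scalerDr; congr (_ + _).
by rewrite [m *: _]scalerA [m * c]mulrC -[(c * m) *: _]scalerA -scalerBr !scalerA mulrC.
Qed.

(* The Harrison complex starts in degree 1. *)
Definition is_harrison n : cochain B M n -> Prop :=
  match n with
  | 0 => fun phi => phi = 0
  | m.+1 => fun phi => exists psi : cochain B M m.+1, cfun phi = harrison_proj (cfun psi)
  end.

Let harrison_closed n : subsemimod_closed (fun phi : cochain B M n => `[< is_harrison phi >]).
Proof.
case: n => [|n].
  split; first split; first exact/asboolP.
    by move=> x y /asboolP/= -> /asboolP/= ->; apply/asboolP; rewrite /= addr0.
  by move=> c x /asboolP/= ->; apply/asboolP; rewrite /= scaler0.
have h0 : @harrison_proj n.+1 0 = 0.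
  have := @harrison_proj_linear n.+1 (-1) 0 0.
  by rewrite scaler0 addr0 scaleN1r addNr.
split; first split.
- by apply/asboolP; exists 0; rewrite h0.
- move=> x y /asboolP/= [u xu] /asboolP/= [v yv]; apply/asboolP; exists (u + v).
  have := harrison_proj_linear 1 (cfun u) (cfun v).
  by rewrite !scale1r cfunD => ->; rewrite -xu -yv.
- move=> c x /asboolP/= [u xu]; apply/asboolP; exists (c *: u).
  have := harrison_proj_linear c (cfun u) 0.
  by rewrite h0 !addr0 cfunZ => ->; rewrite -xu.
Qed.

Definition harrison_complex n : lsubspace (cochain B M n) :=
  LSubspace (@harrison_closed n).

(* Intended for commutative B and symmetric M. *)
Definition harH n : snModType R := cohomology harrison_complex n.

End HochschildHarrison.

Section BoundedBilinear.
Variable R : realType.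

Lemma bilinear_bound (E F G : snModType R) (f : E -> F -> G) : bounded_bilinear f ->
  exists2 c, 0 <= c & forall x y, `|f x y| <= c * `|x| * `|y|.
Proof.
move=> [_ _ [c fc]]; exists (Num.max c 0); first by rewrite le_max lexx orbT.
by move=> x y; rewrite (le_trans (fc x y))// -!mulrA ler_wpM2r ?mulr_ge0// le_max lexx.
Qed.

Lemma bilinear_flip (E F G : snModType R) (f : E -> F -> G) :
  bounded_bilinear f -> bounded_bilinear (fun y x => f x y).
Proof.
move=> [lf rf [c fc]]; split=> //; exists c => x y.
by rewrite mulrAC; exact: fc.
Qed.

Lemma linear_fun0 (E F : snModType R) (f : E -> F) : linear f -> f 0 = 0.
Proof. by move=> /(_ (-1) 0 0); rewrite scaler0 addr0 scaleN1r addNr. Qed.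

Lemma linear_funD (E F : snModType R) (f : E -> F) x y : linear f -> f (x + y) = f x + f y.
Proof. by move=> /(_ 1 x y); rewrite !scale1r. Qed.

Lemma linear_funZ (E F : snModType R) (f : E -> F) c x : linear f -> f (c *: x) = c *: f x.
Proof. by move=> lf; have := lf c x 0; rewrite (linear_fun0 lf) !addr0. Qed.

Lemma linear_funB (E F : snModType R) (f : E -> F) x y : linear f -> f (x - y) = f x - f y.
Proof. by move=> lf; rewrite (linear_funD _ _ lf) -scaleN1r (linear_funZ _ _ lf) scaleN1r. Qed.
End BoundedBilinear.

Section QuotientAction.
Variables (R : realType) (B M : snModType R) (W : lsubspace M) (f : B -> M -> M).
Hypothesis fb : bounded_bilinear f.
Hypothesis fW : forall b x, W x -> W (f b x).

Definition qop (b : B) (q : qsp W) : qsp W := qproj W (f b (qrepr q)).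

Lemma qopE b x : qop b (qproj W x) = qproj W (f b x).
Proof.
have [_ lf _] := fb; apply/qprojP; rewrite -(linear_funB _ _ (lf b)).
by apply: fW; apply/qprojP; rewrite qreprK.
Qed.

Lemma qop_bilinear : bounded_bilinear qop.
Proof.
have [lf rf _] := fb; split=> [q c a b|b c q r|].
- have [x <-] := qproj_surj q.
  by rewrite !qopE lf qprojD qprojZ.
- have [x <-] := qproj_surj q; have [y <-] := qproj_surj r.
  by rewrite -qprojZ -qprojD !qopE rf qprojD qprojZ.
- have [c c0 fc] := bilinear_bound fb; exists c => b q.
  apply: qnorm_lip => [|x <-]; first by rewrite mulr_ge0.
  by rewrite qopE (le_trans (qnorm_le _ _)).
Qed.
End QuotientAction.

Section QuotientBimod.
Variables (R : realType) (B : normedAlg R) (M : bimod B) (W : lsubspace M).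
Hypothesis lW : forall b x, W x -> W (lact b x).
Hypothesis rW : forall b x, W x -> W (ract x b).

Let ql := qop (W := W) (@lact R B M).
Let qr (q : qsp W) (b : B) := qop (fun b (x : M) => ract x b) b q.
Let rb := bilinear_flip (@ract_bilinear R B M).

Let qlE b x : ql b (qproj W x) = qproj W (lact b x).
Proof. exact: (qopE (@lact_bilinear R B M) lW). Qed.
Let qrE b x : qr (qproj W x) b = qproj W (ract x b).
Proof. exact: (qopE rb rW). Qed.
Let qlA a b q : ql (na_mul a b) q = ql a (ql b q).
Proof. by have [x <-] := qproj_surj q; rewrite !qlE lactA. Qed.
Let qrA a b q : qr q (na_mul a b) = qr (qr q a) b.
Proof. by have [x <-] := qproj_surj q; rewrite !qrE ractA. Qed.
Let qlrA a b q : qr (ql a q) b = ql a (qr q b).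
Proof. by have [x <-] := qproj_surj q; rewrite qlE !qrE qlE lractA. Qed.

Definition quotient_bimod : bimod B :=
  Bimod (qop_bilinear (@lact_bilinear R B M) lW)
    (bilinear_flip (qop_bilinear rb rW)) qlA qrA qlrA.

Lemma quotient_lactE b x :
  lact b (qproj W x : quotient_bimod) = qproj W (lact b x) :> qsp W.
Proof. exact: qlE. Qed.

Lemma quotient_ractE b x :
  ract (qproj W x : quotient_bimod) b = qproj W (ract x b) :> qsp W.
Proof. exact: qrE. Qed.
End QuotientBimod.

Section Cauchy.
Variables (R : realType) (M : snModType R).

Definition is_cauchy (x : nat -> M) : Prop :=
  forall e, 0 < e -> exists N, forall m n, (N <= m)%N -> (N <= n)%N -> `|x m - x n| < e.

Definition cauchy_pred : {pred nat -> M} := fun x => `[< is_cauchy x >].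

Definition cauchy_norm (x : nat -> M) : R := limn (fun n => `|x n|).

Lemma cauchy_norm_cvg x : is_cauchy x ->
  (fun n => `|x n|) @ \oo --> cauchy_norm x.
Proof.
move=> cx; suff : cvgn (fun n => `|x n|) by [].
have FF : ProperFilter ((fun n => `|x n|) @ \oo) by exact: fmap_proper_filter.
apply: R_complete; apply/cauchyP => e e0; have [N xN] := cx _ e0.
exists `|x N|; exists N => // n Nn.
by rewrite /ball/= (le_lt_trans (ler_dist_dist _ _))// xN.
Qed.

Lemma cauchy_norm_le (x : nat -> M) (l : R) : is_cauchy x ->
  (exists N, forall n, (N <= n)%N -> `|x n| <= l) -> cauchy_norm x <= l.
Proof.
move=> cx [N xl]; apply: (ler_cvg_to (cauchy_norm_cvg cx) (cvg_cst l)).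
by exists N => // n /= Nn; exact: xl.
Qed.

Let cauchyD x y : is_cauchy x -> is_cauchy y -> is_cauchy (x + y).
Proof.
move=> cx cy e e0; have e20 : 0 < e / 2 by rewrite divr_gt0.
have [N xN] := cx _ e20; have [P yP] := cy _ e20; exists (maxn N P) => m n.
rewrite !geq_max => /andP[Nm Pm] /andP[Nn Pn]; rewrite !fctDE opprD addrACA.
by rewrite (le_lt_trans (ler_normD _ _))// (splitr e) ltrD ?xN ?yP.
Qed.

Let cauchyZ c x : is_cauchy x -> is_cauchy (c *: x).
Proof.
move=> cx e e0; have c1 : 0 < normc c + 1 by rewrite ltr_pwDr// normc_ge0.
have [N xN] := cx _ (divr_gt0 e0 c1); exists N => m n Nm Nn.
rewrite !fctZE -scalerBr snormZ.
rewrite (@le_lt_trans _ _ ((normc c + 1) * `|x m - x n|))//.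
  by rewrite ler_wpM2r// lerDl.
by rewrite mulrC -ltr_pdivlMr// xN.
Qed.

Let cauchy_closed : subsemimod_closed cauchy_pred.
Proof.
split; first split.
- apply/asboolP => e e0; exists 0%N => m n _ _.
  by rewrite [_ - _](_ : _ = 0) ?normr0//; exact: subrr.
- by move=> x y /asboolP cx /asboolP cy; apply/asboolP; exact: cauchyD.
- by move=> c x /asboolP cx; apply/asboolP; exact: cauchyZ.
Qed.

Let cauchy_normD : {in cauchy_pred &, forall x y,
  cauchy_norm (x + y) <= cauchy_norm x + cauchy_norm y}.
Proof.
move=> x y /asboolP cx /asboolP cy.
apply: (ler_cvg_to (cauchy_norm_cvg (cauchyD cx cy))
  (cvgD (cauchy_norm_cvg cx) (cauchy_norm_cvg cy))).
by exists 0%N => // n _; exact: ler_normD.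
Qed.

Let cauchy_normZ c : {in cauchy_pred, forall x,
  cauchy_norm (c *: x) <= normc c * cauchy_norm x}.
Proof.
move=> x /asboolP cx.
apply: (ler_cvg_to (cauchy_norm_cvg (cauchyZ c cx))
  (cvgM (cvg_cst (normc c)) (cauchy_norm_cvg cx))).
by exists 0%N => // n _; rewrite fctZE snormZ.
Qed.

Definition cauchy_seqs : snModType R :=
  snspace (SnData cauchy_closed cauchy_normD cauchy_normZ).

Lemma cauchy_seqsP (x : cauchy_seqs) : is_cauchy (\val x).
Proof. exact/asboolP/(valP x). Qed.

Definition mk_cauchy (x : nat -> M) (cx : is_cauchy x) : cauchy_seqs :=
  exist _ x (introT (asboolP _) cx).
End Cauchy.

Section Completion.
Variables (R : realType) (M : snModType R).

Let null_closed : subsemimod_closed (fun x : M => `[< `|x| = 0 >]).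
Proof.
split; first split; first by apply/asboolP; rewrite normr0.
- move=> x y /asboolP x0 /asboolP y0; apply/asboolP/eqP.
  by rewrite eq_le normr_ge0 andbT (le_trans (ler_normD _ _))// x0 y0 addr0.
- by move=> c x /asboolP x0; apply/asboolP; rewrite snormZ x0 mulr0.
Qed.

Definition null_subspace : lsubspace M := LSubspace null_closed.
End Completion.

(* The Hausdorff completion: Cauchy sequences modulo null sequences. *)
Definition completion (R : realType) (M : snModType R) : snModType R :=
  qsp (null_subspace (cauchy_seqs M)).

Section CauchyAction.
Variables (R : realType) (B M : snModType R) (f : B -> M -> M).
Hypothesis fb : bounded_bilinear f.

Let cauchy_fun b x : is_cauchy x -> is_cauchy (fun n => f b (x n)).
Proof.
have [_ rf _] := fb; have [c c0 fc] := bilinear_bound fb => cx e e0.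
have K0 : 0 < c * `|b| + 1 by rewrite ltr_pwDr// mulr_ge0.
have [N xN] := cx _ (divr_gt0 e0 K0); exists N => m n Nm Nn.
rewrite -(linear_funB _ _ (rf b)) (le_lt_trans (fc _ _))//.
rewrite (@le_lt_trans _ _ ((c * `|b| + 1) * `|x m - x n|))//.
  by rewrite ler_wpM2r// lerDl.
by rewrite mulrC -ltr_pdivlMr// xN.
Qed.

Definition cauchy_op (b : B) (x : cauchy_seqs M) : cauchy_seqs M :=
  mk_cauchy (cauchy_fun b (cauchy_seqsP x)).

Lemma cauchy_opE b x n : \val (cauchy_op b x) n = f b (\val x n).
Proof. by []. Qed.

Lemma cauchy_op_bilinear : bounded_bilinear cauchy_op.
Proof.
have [lf rf _] := fb; split=> [x c a b|b c x y|].
- by apply/val_inj/funext => n; exact: lf.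
- by apply/val_inj/funext => n; exact: rf.
- have [c c0 fc] := bilinear_bound fb; exists c => b x.
  apply: (ler_cvg_to (cauchy_norm_cvg (cauchy_seqsP (cauchy_op b x)))
    (cvgM (cvg_cst (c * `|b|)) (cauchy_norm_cvg (cauchy_seqsP x)))).
  by exists 0%N => // n _; exact: fc.
Qed.
End CauchyAction.

Section CompletionBimod.
Variables (R : realType) (B : normedAlg R) (M : bimod B).

Let rb := bilinear_flip (@ract_bilinear R B M).
Let cl := cauchy_op (@lact_bilinear R B M).
Let cr (x : cauchy_seqs M) (b : B) := cauchy_op rb b x.

Let clA a b x : cl (na_mul a b) x = cl a (cl b x).
Proof. by apply/val_inj/funext => n; exact: lactA. Qed.
Let crA a b x : cr x (na_mul a b) = cr (cr x a) b.
Proof. by apply/val_inj/funext => n; exact: ractA. Qed.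
Let clrA a b x : cr (cl a x) b = cl a (cr x b).
Proof. by apply/val_inj/funext => n; exact: lractA. Qed.

Definition cauchy_bimod : bimod B :=
  Bimod (cauchy_op_bilinear (@lact_bilinear R B M))
    (bilinear_flip (cauchy_op_bilinear rb)) clA crA clrA.

Lemma bilinear_null (E F : snModType R) (f : E -> F -> F) b x :
  bounded_bilinear f -> null_subspace F x -> null_subspace F (f b x).
Proof.
move=> [_ _ [c fc]] x0; apply/eqP; rewrite eq_le normr_ge0 andbT.
by rewrite (le_trans (fc _ _))// x0 mulr0.
Qed.

Definition completion_bimod : bimod B :=
  @quotient_bimod R B cauchy_bimod (null_subspace (cauchy_seqs M))
    (fun b x => bilinear_null b (@lact_bilinear R B cauchy_bimod))
    (fun b x => bilinear_null b (bilinear_flip (@ract_bilinear R B cauchy_bimod))).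
End CompletionBimod.

Section TensorProduct.
Variables (R : realType) (E F : snModType R).

Record bilform := Bilform {
  bf_fun :> E -> F -> R[i];
  bf_linl : forall y, linear (fun x => bf_fun x y : R[i]^o);
  bf_linr : forall x, linear (bf_fun x : F -> R[i]^o) }.

(* As in Ryan, Introduction to Tensor Products of Banach Spaces, the algebraic
   tensor product consists of the functionals on bilinear forms spanned by the
   evaluations [x (x) y : beta |-> beta x y]; [tens s] is the sum of [x (x) y]
   for [(x, y)] in [s]. *)
Definition tens (s : seq (E * F)) : bilform -> R[i]^o :=
  fun beta => \sum_(p <- s) beta p.1 p.2.

Definition tens_pred : {pred bilform -> R[i]^o} := fun t => `[< exists s, t = tens s >].

Definition tens_norm (t : bilform -> R[i]^o) : R :=
  inf [set \sum_(p <- s) `|p.1| * `|p.2| | s in [set s | t = tens s]].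

Let size_ge0 (s : seq (E * F)) : 0 <= \sum_(p <- s) `|p.1| * `|p.2|.
Proof. by apply: sumr_ge0 => p _; exact: mulr_ge0. Qed.

Lemma tens_norm_le s : tens_norm (tens s) <= \sum_(p <- s) `|p.1| * `|p.2|.
Proof. by apply: ge_inf; [exists 0 => _ [u _ <-]|exists s]. Qed.

Lemma tens_norm_lt t e : tens_pred t -> 0 < e ->
  exists2 s, t = tens s & \sum_(p <- s) `|p.1| * `|p.2| < tens_norm t + e.
Proof.
move=> /asboolP[s ts] e0.
have hi : has_inf [set \sum_(p <- s) `|p.1| * `|p.2| | s in [set s | t = tens s]].
  by split; [exists (\sum_(p <- s) `|p.1| * `|p.2|), s|exists 0 => _ [u _ <-]].
have [_ [u tu <-] ue] := inf_adherent e0 hi.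
by exists u.
Qed.

Lemma tens_norm_lip t (n K : R) : tens_pred t -> 0 <= K ->
  (forall s, t = tens s -> n <= K * \sum_(p <- s) `|p.1| * `|p.2|) ->
  n <= K * tens_norm t.
Proof.
move=> tP K0 nK; apply/ler_addgt0Pr => e e0.
have K1 : 0 < K + 1 by rewrite ltr_pwDr.
have [s ts se] := tens_norm_lt tP (divr_gt0 e0 K1).
rewrite (le_trans (nK s ts))// (le_trans (ler_wpM2l K0 (ltW se)))// mulrDr lerD2l.
by rewrite mulrCA ger_pMr// ler_pdivrMr// mul1r lerDl.
Qed.

Lemma tens_cat s u : tens (s ++ u) = tens s + tens u.
Proof. by apply/funext => beta; rewrite /tens big_cat. Qed.

Lemma tens_scale c s : tens [seq (c *: p.1, p.2) | p <- s] = c *: tens s.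
Proof.
apply/funext => beta; rewrite fctZE /tens big_map scaler_sumr; apply: eq_bigr => p _.
have /(_ c p.1 0) := bf_linl beta p.2 => /=.
have /(_ (-1) 0 0) := bf_linl beta p.2 => /=.
by rewrite scaler0 addr0 scaleN1r addNr => ->; rewrite !addr0.
Qed.

Let tens_closed : subsemimod_closed tens_pred.
Proof.
split; first split.
- by apply/asboolP; exists [::]; apply/funext => beta; rewrite /tens big_nil.
- move=> t u /asboolP[s ->] /asboolP[v ->]; apply/asboolP; exists (s ++ v).
  by rewrite tens_cat.
- move=> c t /asboolP[s ->]; apply/asboolP.
  by exists [seq (c *: p.1, p.2) | p <- s]; rewrite tens_scale.
Qed.

Let tens_normD : {in tens_pred &, forall t u,
  tens_norm (t + u) <= tens_norm t + tens_norm u}.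
Proof.
move=> t u tP uP; apply/ler_addgt0Pr => e e0.
have e20 : 0 < e / 2 by rewrite divr_gt0.
have [s ts se] := tens_norm_lt tP e20; have [v uv ve] := tens_norm_lt uP e20.
have -> : t + u = tens (s ++ v) by rewrite tens_cat -ts -uv.
rewrite (le_trans (tens_norm_le _))// big_cat/= (splitr e) addrACA.
by apply: lerD; exact: ltW.
Qed.

Let tens_normZ c : {in tens_pred, forall t, tens_norm (c *: t) <= normc c * tens_norm t}.
Proof.
move=> t tP; apply: tens_norm_lip => // [|s ->]; first exact: normc_ge0.
rewrite -tens_scale (le_trans (tens_norm_le _))// big_map mulr_sumr.
by apply: ler_sum => p _; rewrite /= snormZ mulrA.
Qed.

Definition alg_tensor : snModType R :=
  snspace (SnData tens_closed tens_normD tens_normZ).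

Lemma alg_tensorP (t : alg_tensor) : exists s, \val t = tens s.
Proof. exact/asboolP/(valP t). Qed.

Definition tensor_eval (t : alg_tensor) (beta : bilform) : R[i] := (\val t) beta.

Lemma tensor_eq t u : (forall beta, tensor_eval t beta = tensor_eval u beta) -> t = u.
Proof. by move=> tu; apply/val_inj/funext. Qed.
Lemma tensor_evalD t u beta :
  tensor_eval (t + u) beta = tensor_eval t beta + tensor_eval u beta.
Proof. by []. Qed.
Lemma tensor_evalZ c t beta : tensor_eval (c *: t) beta = c * tensor_eval t beta.
Proof. by []. Qed.

Lemma mk_tensorP s : tens_pred (tens s).
Proof. by apply/asboolP; exists s. Qed.

Definition mk_tensor s : alg_tensor := exist _ (tens s) (mk_tensorP s).
End TensorProduct.

Section TensorAction.
Variables (R : realType) (B E F : snModType R) (f : B -> E -> E).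
Hypothesis fb : bounded_bilinear f.

Lemma bilform_act_linl b (beta : bilform E F) y :
  linear (fun x => beta (f b x) y : R[i]^o).
Proof. by have [_ rf _] := fb; move=> c u v; rewrite rf bf_linl. Qed.

Definition bilform_act b (beta : bilform E F) : bilform E F :=
  Bilform (bilform_act_linl b beta) (fun x => bf_linr beta (f b x)).

Lemma tens_act b s :
  (fun beta => tens s (bilform_act b beta)) = tens [seq (f b p.1, p.2) | p <- s].
Proof. by apply/funext => beta; rewrite /tens big_map. Qed.

Let tensor_opP b (t : alg_tensor E F) :
  tens_pred (fun beta => \val t (bilform_act b beta)).
Proof. by have [s ->] := alg_tensorP t; rewrite tens_act; exact: mk_tensorP. Qed.

Definition tensor_op b (t : alg_tensor E F) : alg_tensor E F :=
  exist _ (fun beta => \val t (bilform_act b beta)) (tensor_opP b t).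

Lemma tensor_op_eval b t beta :
  tensor_eval (tensor_op b t) beta = tensor_eval t (bilform_act b beta).
Proof. by []. Qed.

Lemma mk_tensor_surj (t : alg_tensor E F) : exists s, t = mk_tensor s.
Proof. by have [s ts] := alg_tensorP t; exists s; exact/val_inj. Qed.

Lemma tensor_opE b s :
  tensor_op b (mk_tensor s) = mk_tensor [seq (f b p.1, p.2) | p <- s].
Proof. by apply/val_inj; exact: tens_act. Qed.

Lemma tensor_op_bilinear : bounded_bilinear tensor_op.
Proof.
have [lf rf _] := fb; split=> [t c a b|b c t u|].
- have [s ->] := mk_tensor_surj t; rewrite !tensor_opE.
  apply/val_inj/funext => beta; rewrite /= !(fctDE, fctZE) /tens !big_map.
  rewrite scaler_sumr -big_split; apply: eq_bigr => p _ /=.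
  by rewrite lf bf_linl.
- apply: tensor_eq => beta.
  by rewrite tensor_evalD tensor_evalZ !tensor_op_eval tensor_evalD tensor_evalZ.
- have [c c0 fc] := bilinear_bound fb; exists c => b t.
  apply: tens_norm_lip => [||s ts]; [exact: (valP t)|by rewrite mulr_ge0|].
  have -> : t = mk_tensor s by exact/val_inj.
  rewrite tensor_opE (le_trans (tens_norm_le _))// big_map mulr_sumr.
  by apply: ler_sum => p _ /=; rewrite mulrA ler_wpM2r.
Qed.
End TensorAction.

Definition ptensor (R : realType) (E F : snModType R) : snModType R :=
  completion (alg_tensor E F).

Section TensorBimod.
Variables (R : realType) (B : normedAlg R) (M : bimod B) (F : snModType R).

Let rb := bilinear_flip (@ract_bilinear R B M).
Let tl := tensor_op (F := F) (@lact_bilinear R B M).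
Let tr (t : alg_tensor M F) (b : B) := tensor_op rb b t.

Let tlA a b t : tl (na_mul a b) t = tl a (tl b t).
Proof.
have [s ->] := mk_tensor_surj t; rewrite /tl !tensor_opE -map_comp.
by congr mk_tensor; apply: eq_map => p /=; rewrite lactA.
Qed.
Let trA a b t : tr t (na_mul a b) = tr (tr t a) b.
Proof.
have [s ->] := mk_tensor_surj t; rewrite /tr !tensor_opE -map_comp.
by congr mk_tensor; apply: eq_map => p /=; rewrite ractA.
Qed.
Let tlrA a b t : tr (tl a t) b = tl a (tr t b).
Proof.
have [s ->] := mk_tensor_surj t; rewrite /tl /tr !tensor_opE -!map_comp.
by congr mk_tensor; apply: eq_map => p /=; rewrite lractA.
Qed.

Definition alg_tensor_bimod : bimod B :=
  Bimod (tensor_op_bilinear F (@lact_bilinear R B M))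
    (bilinear_flip (tensor_op_bilinear F rb)) tlA trA tlrA.

Definition ptensor_bimod : bimod B := completion_bimod alg_tensor_bimod.

Lemma ptensor_bimodE : ptensor_bimod = ptensor M F :> snModType R.
Proof. by []. Qed.
End TensorBimod.

Section PullbackBimod.
Variables (R : realType) (A B : normedAlg R) (h : A -> B).
Hypothesis h_linear : linear h.
Hypothesis h_mul : forall x y, h (na_mul x y) = na_mul (h x) (h y).
Hypothesis h_bounded : exists c, forall x, `|h x| <= c * `|x|.

Let pull_bilinear : bounded_bilinear (fun (a : A) (x : B) => na_mul (h a) x).
Proof.
have [l r [c mc]] := @na_mul_bilinear R B; have [d hd] := h_bounded.
split=> [x k a b|a|]; [by rewrite (h_linear k a b); exact: l|exact: r|].
exists d => a x; rewrite (le_trans (na_mul_norm _ _))//.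
by rewrite ler_wpM2r.
Qed.

Let pull_bilinear_r : bounded_bilinear (fun (x : B) (a : A) => na_mul x (h a)).
Proof.
have [l r [c mc]] := @na_mul_bilinear R B; have [d hd] := h_bounded.
split=> [a|x k a b|]; [exact: l|by rewrite (h_linear k a b); exact: r|].
exists d => x a; rewrite (le_trans (na_mul_norm _ _))//.
by rewrite [_ * `|x|]mulrC -mulrA ler_wpM2l.
Qed.

Definition pullback_bimod : bimod A.
Proof.
refine (Bimod pull_bilinear pull_bilinear_r _ _ _) => a b x.
- by rewrite h_mul na_mulA.
- by rewrite h_mul na_mulA.
- by rewrite na_mulA.
Defined.
End PullbackBimod.

Section NonnegativeSums.
Variable R : realType.
Implicit Types S T : choiceType.

Definition summ S (f : S -> R) : Prop := (\esum_(s in [set: S]) (f s)%:E < +oo)%E.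
Definition psum S (f : S -> R) : R := fine (\esum_(s in [set: S]) (f s)%:E).

Lemma psumE S (f : S -> R) : (forall s, 0 <= f s) -> summ f ->
  (\esum_(s in [set: S]) (f s)%:E = (psum f)%:E)%E.
Proof.
move=> f0 fs; rewrite /psum fineK// ge0_fin_numE//.
by apply: esum_ge0 => s _; rewrite lee_fin.
Qed.

Lemma psum_ge0 S (f : S -> R) : (forall s, 0 <= f s) -> 0 <= psum f.
Proof. by move=> f0; apply: fine_ge0; apply: esum_ge0 => s _; rewrite lee_fin. Qed.

Lemma summ_le S (f g : S -> R) : (forall s, f s <= g s) -> summ g -> summ f.
Proof.
move=> fg; apply: le_lt_trans; apply: le_esum => s _.
by rewrite lee_fin.
Qed.

Lemma psum_le S (f g : S -> R) : (forall s, 0 <= f s) -> (forall s, f s <= g s) ->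
  summ g -> psum f <= psum g.
Proof.
move=> f0 fg gs; have g0 s : 0 <= g s by exact: le_trans (fg s).
rewrite -lee_fin -!psumE//; last exact: summ_le gs.
by apply: le_esum => s _; rewrite lee_fin.
Qed.

Lemma esum_addE S (f g : S -> R) : (forall s, 0 <= f s) -> (forall s, 0 <= g s) ->
  (\esum_(s in [set: S]) (f s + g s)%:E =
   \esum_(s in [set: S]) (f s)%:E + \esum_(s in [set: S]) (g s)%:E)%E.
Proof.
by move=> f0 g0; rewrite -esumD// => s _; rewrite lee_fin.
Qed.

Lemma summD S (f g : S -> R) : (forall s, 0 <= f s) -> (forall s, 0 <= g s) ->
  summ f -> summ g -> summ (fun s => f s + g s).
Proof. by move=> f0 g0 fs gs; rewrite /summ esum_addE// lte_add_pinfty. Qed.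

Lemma psumD S (f g : S -> R) : (forall s, 0 <= f s) -> (forall s, 0 <= g s) ->
  summ f -> summ g -> psum (fun s => f s + g s) = psum f + psum g.
Proof. by move=> f0 g0 fs gs; rewrite {1}/psum esum_addE// !psumE. Qed.

Lemma esum_scale_le S (f : S -> R) c : 0 <= c -> (forall s, 0 <= f s) -> summ f ->
  (\esum_(s in [set: S]) (c * f s)%:E <= (c * psum f)%:E)%E.
Proof.
move=> c0 f0 fs; apply: ge_ereal_sup => _ [A [finA _] <-].
under eq_fsbigr => s _ do rewrite EFinM.
rewrite -ge0_mule_fsumr; last by move=> s; rewrite lee_fin.
rewrite EFinM lee_wpmul2l ?lee_fin// -psumE//.
by apply: esum_ge; exists A.
Qed.

Lemma summZ S (f : S -> R) c : 0 <= c -> (forall s, 0 <= f s) -> summ f ->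
  summ (fun s => c * f s).
Proof. by move=> c0 f0 fs; rewrite /summ (le_lt_trans (esum_scale_le c0 f0 fs))// ltry. Qed.

Lemma psumZ_le S (f : S -> R) c : 0 <= c -> (forall s, 0 <= f s) -> summ f ->
  psum (fun s => c * f s) <= c * psum f.
Proof.
move=> c0 f0 fs; rewrite -lee_fin -psumE//; first exact: esum_scale_le.
  by move=> s; rewrite mulr_ge0.
exact: summZ.
Qed.

Lemma psumZ S (f : S -> R) c : 0 <= c -> (forall s, 0 <= f s) -> summ f ->
  psum (fun s => c * f s) = c * psum f.
Proof.
move=> c0 f0 fs; apply/eqP; rewrite eq_le psumZ_le//=.
have [->|cn0] := eqVneq c 0.
  by rewrite mul0r psum_ge0// => s; rewrite mul0r.
have cgt0 : 0 < c by rewrite lt_def cn0.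
rewrite -ler_pdivlMl//.
have -> : psum f = psum (fun s => c^-1 * (c * f s)).
  by congr psum; apply/funext => s; rewrite mulKf.
by apply: psumZ_le => [|s|]; [rewrite invr_ge0|rewrite mulr_ge0|exact: summZ].
Qed.

Lemma esum_single S (s0 : S) (c : R) : 0 <= c ->
  (\esum_(s in [set: S]) (if s == s0 then c else 0)%:E = c%:E)%E.
Proof.
move=> c0; rewrite -(@esum_set1 _ _ s0 (fun=> c%:E)) ?lee_fin//.
rewrite [RHS]esum_mkcond; apply: eq_esum => s _.
have [->|ss] := eqVneq s s0; first by rewrite mem_set.
by rewrite memNset//= => /eqP; rewrite (negbTE ss).
Qed.

Lemma esum_fiber S T (phi : S -> T) (f : S -> R) : (forall s, 0 <= f s) ->
  (\esum_(t in [set: T]) \esum_(s in [set: S]) (if phi s == t then f s else 0)%:E =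
   \esum_(s in [set: S]) (f s)%:E)%E.
Proof.
move=> f0.
transitivity (\esum_(t in [set: T]) \esum_(s in phi @^-1` [set t]) (f s)%:E)%E.
  apply: eq_esum => t _; rewrite [RHS]esum_mkcond; apply: eq_esum => s _.
  have [st|st] := eqVneq (phi s) t; first by rewrite mem_set.
  by rewrite memNset//= => /eqP; rewrite (negbTE st).
rewrite esum_esum => [|t s _ _]; last by rewrite lee_fin.
rewrite (@reindex_esum R S (T * S)%type setT _ (fun s => (phi s, s)))//.
by split=> [s _|s u _ _ [_]|[t s] [/= _ <-]]//; exists s.
Qed.

Lemma summ_fiber S T (phi : S -> T) (f : S -> R) t : (forall s, 0 <= f s) -> summ f ->
  summ (fun s => if phi s == t then f s else 0).
Proof. by move=> f0; apply: summ_le => s; case: ifP. Qed.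

Lemma esum_psum_fiber S T (phi : S -> T) (f : S -> R) : (forall s, 0 <= f s) -> summ f ->
  (\esum_(t in [set: T]) (psum (fun s => if phi s == t then f s else 0))%:E =
   \esum_(s in [set: S]) (f s)%:E)%E.
Proof.
move=> f0 fs; rewrite -(esum_fiber phi f0); apply: eq_esum => t _.
by rewrite psumE//; [move=> s; case: ifP|exact: summ_fiber].
Qed.

Lemma summ_psum_fiber S T (phi : S -> T) (f : S -> R) : (forall s, 0 <= f s) -> summ f ->
  summ (fun t => psum (fun s => if phi s == t then f s else 0)).
Proof. by move=> f0 fs; rewrite /summ esum_psum_fiber. Qed.

Lemma psum_fiber S T (phi : S -> T) (f : S -> R) : (forall s, 0 <= f s) -> summ f ->
  psum (fun t => psum (fun s => if phi s == t then f s else 0)) = psum f.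
Proof. by move=> f0 fs; rewrite {1}/psum esum_psum_fiber. Qed.

End NonnegativeSums.

Section ComplexSums.
Variable R : realType.
Implicit Types S T : choiceType.

(* Both [rsum] and [csum] are only meaningful for absolutely summable families. *)
Definition rsum S (g : S -> R) : R :=
  psum (fun s => Num.max (g s) 0) - psum (fun s => Num.max (- g s) 0).

Definition csum S (f : S -> R[i]) : R[i] :=
  (rsum (fun s => complex.Re (f s)) +i* rsum (fun s => complex.Im (f s)))%C.

Let pos_ge0 (x : R) : 0 <= Num.max x 0. Proof. by rewrite le_max lexx orbT. Qed.
Let pos_le (x : R) : Num.max x 0 <= `|x|. Proof. by rewrite ge_max ler_norm normr_ge0. Qed.
Let neg_le (x : R) : Num.max (- x) 0 <= `|x|. Proof. by rewrite -normrN pos_le. Qed.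
Let posB (x : R) : Num.max x 0 - Num.max (- x) 0 = x.
Proof.
have /orP[x0|x0] := le_total 0 x.
  by rewrite max_l// max_r ?subr0// oppr_le0.
by rewrite max_r// max_l ?sub0r ?opprK// oppr_ge0.
Qed.

Let abs_summ S (g : S -> R) : summ (fun s => `|g s|) ->
  summ (fun s => Num.max (g s) 0) /\ summ (fun s => Num.max (- g s) 0).
Proof.
by move=> gs; split; apply: summ_le gs => s; [exact: pos_le|exact: neg_le].
Qed.

Lemma rsumB S (p n : S -> R) : (forall s, 0 <= p s) -> (forall s, 0 <= n s) ->
  summ p -> summ n -> rsum (fun s => p s - n s) = psum p - psum n.
Proof.
move=> p0 n0 ps ns.
have gs : summ (fun s => `|p s - n s|).
  apply: summ_le (summD p0 n0 ps ns) => s.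
  by rewrite (le_trans (ler_normB _ _))// !ger0_norm.
have [gp gn] := abs_summ gs.
apply/eqP; rewrite /rsum subr_eq addrAC eq_sym subr_eq -!psumD//.
apply/eqP; congr psum; apply/funext => s; apply/eqP.
have := posB (p s - n s); move: (Num.max _ 0) (Num.max _ 0) => a b ab.
move/eqP: ab; rewrite subr_eq => /eqP ->.
by rewrite [X in _ == X]addrAC subrK.
Qed.

Lemma rsumD S (g h : S -> R) : summ (fun s => `|g s|) -> summ (fun s => `|h s|) ->
  rsum (fun s => g s + h s) = rsum g + rsum h.
Proof.
move=> gs hs; have [gp gn] := abs_summ gs; have [hp hn] := abs_summ hs.
have -> : (fun s => g s + h s) = (fun s => (Num.max (g s) 0 + Num.max (h s) 0) -
    (Num.max (- g s) 0 + Num.max (- h s) 0)).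
  by apply/funext => s; rewrite opprD addrACA !posB.
rewrite rsumB//; try by move=> s; rewrite addr_ge0.
- by rewrite !psumD// /rsum opprD addrACA.
- exact: summD.
- exact: summD.
Qed.

Lemma rsumZ S (g : S -> R) c : summ (fun s => `|g s|) ->
  rsum (fun s => c * g s) = c * rsum g.
Proof.
wlog c0 : c g / 0 <= c.
  move=> H gs; have [|c0] := leP 0 c; first by move=> c0; exact: H.
  have -> : (fun s => c * g s) = (fun s => (- c) * (- g s)).
    by apply/funext => s; rewrite mulrNN.
  rewrite H ?oppr_ge0 ?(ltW c0)//; last first.
    by rewrite (_ : (fun _ => _) = (fun s => `|g s|))//; apply/funext => s; rewrite normrN.
  rewrite mulNr -mulrN /rsum opprB; congr (_ * (_ - _)).
  by congr psum; apply/funext => s; rewrite opprK.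
move=> gs; have [gp gn] := abs_summ gs.
have -> : (fun s => c * g s) = (fun s => c * Num.max (g s) 0 - c * Num.max (- g s) 0).
  by apply/funext => s; rewrite -mulrBr posB.
rewrite rsumB; try by move=> s; rewrite mulr_ge0.
- by rewrite !psumZ// -mulrBr.
- exact: summZ.
- exact: summZ.
Qed.

Lemma rsum_le S (g h : S -> R) : (forall s, `|g s| <= h s) -> summ h -> rsum g <= psum h.
Proof.
move=> gh hs; rewrite /rsum lerBlDr -[leLHS]addr0 lerD// ?psum_ge0//.
by apply: psum_le => // s; exact: le_trans (gh s).
Qed.

Lemma rsum_fiber S T (phi : S -> T) (g : S -> R) : summ (fun s => `|g s|) ->
  rsum (fun t => rsum (fun s => if phi s == t then g s else 0)) = rsum g.
Proof.
move=> gs; have [gp gn] := abs_summ gs.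
pose P t := psum (fun s => if phi s == t then Num.max (g s) 0 else 0).
pose N t := psum (fun s => if phi s == t then Num.max (- g s) 0 else 0).
have -> : (fun t => rsum (fun s => if phi s == t then g s else 0)) = (fun t => P t - N t).
  apply/funext => t; rewrite /rsum /P /N.
  by congr (_ - _); congr psum; apply/funext => s; case: ifP => // _; rewrite ?oppr0 maxxx.
rewrite rsumB.
- by rewrite !psum_fiber.
- by move=> t; apply: psum_ge0 => s; case: ifP.
- by move=> t; apply: psum_ge0 => s; case: ifP.
- exact: summ_psum_fiber.
- exact: summ_psum_fiber.
Qed.

Lemma rsum_single S (s0 : S) (c : R) : rsum (fun s => if s == s0 then c else 0) = c.
Proof.
have ps (x : R) : 0 <= x -> psum (fun s => if s == s0 then x else 0) = x.
  by move=> x0; rewrite /psum esum_single.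
rewrite -[RHS]posB -(ps (Num.max c 0))// -[in RHS](ps (Num.max (- c) 0))//.
rewrite /rsum.
by congr (_ - _); congr psum; apply/funext => s; case: ifP => // _; rewrite ?oppr0 maxxx.
Qed.

Definition csumm S (f : S -> R[i]) := summ (fun s => normc (f s)).

Let Re_le (x : R[i]) : `|complex.Re x| <= normc x.
Proof. by case: x => a b /=; rewrite -sqrtr_sqr ler_wsqrtr// lerDl sqr_ge0. Qed.
Let Im_le (x : R[i]) : `|complex.Im x| <= normc x.
Proof. by case: x => a b /=; rewrite -sqrtr_sqr ler_wsqrtr// lerDr sqr_ge0. Qed.

Lemma csumm_Re S (f : S -> R[i]) : csumm f -> summ (fun s => `|complex.Re (f s)|).
Proof. by apply: summ_le => s; exact: Re_le. Qed.
Lemma csumm_Im S (f : S -> R[i]) : csumm f -> summ (fun s => `|complex.Im (f s)|).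
Proof. by apply: summ_le => s; exact: Im_le. Qed.

Lemma csummD S (f g : S -> R[i]) : csumm f -> csumm g -> csumm (fun s => f s + g s).
Proof.
move=> fs gs; apply: summ_le (summD _ _ fs gs) => s; rewrite ?normc_ge0//.
exact: normcD.
Qed.

Lemma csummZ S (f : S -> R[i]) c : csumm f -> csumm (fun s => c * f s).
Proof.
move=> fs; apply: summ_le (summZ (normc_ge0 c) _ fs) => s; rewrite ?normc_ge0//.
by rewrite normcM.
Qed.

Lemma csumD S (f g : S -> R[i]) : csumm f -> csumm g ->
  csum (fun s => f s + g s) = csum f + csum g.
Proof.
move=> fs gs; rewrite {1}/csum.
have -> : (fun s => complex.Re (f s + g s)) = (fun s => complex.Re (f s) + complex.Re (g s)).
  by apply/funext => s; case: (f s); case: (g s).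
have -> : (fun s => complex.Im (f s + g s)) = (fun s => complex.Im (f s) + complex.Im (g s)).
  by apply/funext => s; case: (f s); case: (g s).
by rewrite !rsumD//; [exact: csumm_Im|exact: csumm_Im|exact: csumm_Re|exact: csumm_Re].
Qed.

Lemma csumZ S (f : S -> R[i]) c : csumm f -> csum (fun s => c * f s) = c * csum f.
Proof.
move=> fs; case: c => a b; rewrite {1}/csum.
have rs := csumm_Re fs; have is_ := csumm_Im fs.
have sZ d (g : S -> R) : summ (fun s => `|g s|) -> summ (fun s => `|d * g s|).
  move=> gs; apply: summ_le (summZ (normr_ge0 d) _ gs) => // s.
  by rewrite normrM.
have -> : (fun s => complex.Re ((a +i* b)%C * f s)) =
    (fun s => a * complex.Re (f s) + (- b) * complex.Im (f s)).
  by apply/funext => s; case: (f s) => x y /=; rewrite mulNr.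
have -> : (fun s => complex.Im ((a +i* b)%C * f s)) =
    (fun s => a * complex.Im (f s) + b * complex.Re (f s)).
  by apply/funext => s; case: (f s) => x y /=.
rewrite !rsumD; try exact: sZ.
by rewrite !rsumZ// mulNr.
Qed.

Lemma csum_le S (f : S -> R[i]) : csumm f -> normc (csum f) <= psum (fun s => normc (f s)).
Proof.
move=> fs; have [->|c0] := eqVneq (csum f) 0.
  by rewrite normc0 psum_ge0// => s; exact: normc_ge0.
set w := csum f in c0 *.
have nw : normc w != 0 by apply: contra c0 => /eqP/eq0_normc ->.
pose u := (normc w)%:C%C / w.
have nu : normc u = 1.
  rewrite /u normcM normcV.
  have -> : normc (normc w)%:C%C = normc w.
    by rewrite /= expr0n addr0 sqrtr_sqr ger0_norm// normc_ge0.
  by rewrite mulfV.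
have uw : u * w = (normc w)%:C%C by rewrite /u mulfVK.
have -> : normc w = complex.Re (u * w) by rewrite uw.
rewrite -csumZ//; apply: rsum_le => // s.
by rewrite (le_trans (Re_le _))// normcM nu mul1r.
Qed.

Lemma csumm_fiber S T (phi : S -> T) (f : S -> R[i]) t : csumm f ->
  csumm (fun s => if phi s == t then f s else 0).
Proof. by apply: summ_le => s; case: ifP => // _; rewrite normc0 normc_ge0. Qed.

Lemma csum_fiber_le S T (phi : S -> T) (f : S -> R[i]) t : csumm f ->
  normc (csum (fun s => if phi s == t then f s else 0)) <=
  psum (fun s => if phi s == t then normc (f s) else 0).
Proof.
move=> fs; rewrite (le_trans (csum_le (csumm_fiber phi t fs)))//.
apply: psum_le => [s|s|]; first exact: normc_ge0.
  by case: ifP; rewrite ?normc0.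
by apply: summ_fiber => // s; exact: normc_ge0.
Qed.

Lemma csumm_csum_fiber S T (phi : S -> T) (f : S -> R[i]) : csumm f ->
  csumm (fun t => csum (fun s => if phi s == t then f s else 0)).
Proof.
move=> fs; apply: summ_le (summ_psum_fiber phi _ fs) => [t|s]; last exact: normc_ge0.
exact: csum_fiber_le.
Qed.

Lemma psum_csum_fiber S T (phi : S -> T) (f : S -> R[i]) : csumm f ->
  psum (fun t => normc (csum (fun s => if phi s == t then f s else 0))) <=
  psum (fun s => normc (f s)).
Proof.
move=> fs; rewrite -(psum_fiber phi _ fs) => [|s]; last exact: normc_ge0.
apply: psum_le => [t|t|]; [exact: normc_ge0|exact: csum_fiber_le|].
by apply: summ_psum_fiber => // s; exact: normc_ge0.
Qed.

Lemma csum_fiber S T (phi : S -> T) (f : S -> R[i]) : csumm f ->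
  csum (fun t => csum (fun s => if phi s == t then f s else 0)) = csum f.
Proof.
move=> fs; rewrite /csum/=; congr (_ +i* _)%C.
  rewrite -(rsum_fiber phi (csumm_Re fs)); congr rsum; apply/funext => t.
  by congr rsum; apply/funext => s; case: ifP.
rewrite -(rsum_fiber phi (csumm_Im fs)); congr rsum; apply/funext => t.
by congr rsum; apply/funext => s; case: ifP.
Qed.

Lemma csum_single S (s0 : S) c : csum (fun s => if s == s0 then c else 0) = c :> R[i].
Proof.
case: c => a b; rewrite /csum; congr (_ +i* _)%C.
  by rewrite -[RHS](rsum_single s0 a); congr rsum; apply/funext => s; case: ifP.
by rewrite -[RHS](rsum_single s0 b); congr rsum; apply/funext => s; case: ifP.
Qed.

Lemma csum0 S : csum (fun _ : S => 0) = 0 :> R[i].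
Proof. by rewrite /csum /rsum oppr0 subrr. Qed.

Lemma csumm_prod S T (f : S -> R[i]) (g : T -> R[i]) : csumm f -> csumm g ->
  csumm (fun p : S * T => f p.1 * g p.2) /\
  psum (fun p : S * T => normc (f p.1 * g p.2)) <=
    psum (fun s => normc (f s)) * psum (fun t => normc (g t)).
Proof.
move=> fs gs.
have H : (\esum_(p in [set: S * T]) (normc (f p.1 * g p.2))%:E <=
    (psum (fun s => normc (f s)) * psum (fun t => normc (g t)))%:E)%E.
  rewrite (_ : setT = setT `*`` (fun=> setT)); last exact/seteqP.
  rewrite -(@esum_esum _ _ _ setT (fun=> setT) (fun s t => (normc (f s * g t))%:E)); last first.
    by move=> *; rewrite lee_fin normc_ge0.
  rewrite mulrC; apply: le_trans (esum_scale_le _ _ fs); last 2 first.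
  - by apply: psum_ge0 => s; exact: normc_ge0.
  - by move=> s; exact: normc_ge0.
  apply: le_esum => s _; rewrite mulrC.
  apply: le_trans (esum_scale_le (normc_ge0 (f s)) _ gs); last first.
    by move=> t; exact: normc_ge0.
  by apply: le_esum => t _; rewrite normcM.
have ps : csumm (fun p : S * T => f p.1 * g p.2) by apply: le_lt_trans H _; exact: ltry.
by split=> //; rewrite -lee_fin -psumE// => p; exact: normc_ge0.
Qed.

Lemma csum_prod S T (f : S -> R[i]) (g : T -> R[i]) : csumm f -> csumm g ->
  csum (fun p : S * T => f p.1 * g p.2) = csum f * csum g.
Proof.
move=> fs gs; have [ps _] := csumm_prod fs gs.
rewrite -(csum_fiber fst ps) mulrC -csumZ//; congr csum; apply/funext => s.
rewrite -(csum_fiber snd (csumm_fiber fst s ps)) mulrC -csumZ//.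
congr csum; apply/funext => t; rewrite -[RHS](csum_single (s, t)).
congr csum; apply/funext => -[s' t'] /=; rewrite xpair_eqE.
by case: (eqVneq t' t) => [->|_]; [case: (eqVneq s' s) => [->|_]|rewrite andbF].
Qed.
End ComplexSums.

Section Ell1.
Variable R : realType.
Implicit Types S T U : choiceType.

Section Ell1Space.
Variable S : choiceType.

Definition ell1_pred : {pred S -> R[i]^o} := fun f => `[< csumm f >].
Definition ell1_norm (f : S -> R[i]^o) : R := psum (fun s => normc (f s)).

Let ell1_closed : subsemimod_closed ell1_pred.
Proof.
split; first split.
- apply/asboolP; rewrite /csumm /summ esum1 ?ltry// => s _.
  by rewrite [_ s](_ : _ = 0)// normc0.
- by move=> f g /asboolP fs /asboolP gs; apply/asboolP; exact: csummD.
- by move=> c f /asboolP fs; apply/asboolP; exact: csummZ.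
Qed.

Let ell1_normD : {in ell1_pred &, forall f g, ell1_norm (f + g) <= ell1_norm f + ell1_norm g}.
Proof.
move=> f g /asboolP fs /asboolP gs.
rewrite /ell1_norm -psumD//; try by move=> s; exact: normc_ge0.
apply: psum_le => [s|s|]; [exact: normc_ge0|exact: normcD|].
by apply: summD => // s; exact: normc_ge0.
Qed.

Let ell1_normZ c : {in ell1_pred, forall f, ell1_norm (c *: f) <= normc c * ell1_norm f}.
Proof.
move=> f /asboolP fs; rewrite /ell1_norm -psumZ ?normc_ge0//; last first.
  by move=> s; exact: normc_ge0.
rewrite [X in psum X <= _](_ : _ = (fun s => normc c * normc (f s)))//.
by apply/funext => s; rewrite fctZE -normcM.
Qed.

Definition ell1 : snModType R := snspace (SnData ell1_closed ell1_normD ell1_normZ).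

Definition ell1_fun (f : ell1) : S -> R[i] := \val f.

Lemma ell1P (f : ell1) : csumm (ell1_fun f).
Proof. exact/asboolP/(valP f). Qed.

Definition mk_ell1 (f : S -> R[i]) (fs : csumm f) : ell1 :=
  exist _ (f : S -> R[i]^o) (introT (asboolP _) fs).

Lemma mk_ell1E f fs s : ell1_fun (@mk_ell1 f fs) s = f s. Proof. by []. Qed.

Lemma ell1_eq (f g : ell1) : (forall s, ell1_fun f s = ell1_fun g s) -> f = g.
Proof. by move=> fg; apply/val_inj/funext. Qed.

Lemma ell1D (f g : ell1) s : ell1_fun (f + g) s = ell1_fun f s + ell1_fun g s.
Proof. by []. Qed.
Lemma ell1Z c (f : ell1) s : ell1_fun (c *: f) s = c * ell1_fun f s.
Proof. by []. Qed.
Lemma ell1_normE (f : ell1) : `|f| = psum (fun s => normc (ell1_fun f s)).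
Proof. by []. Qed.
End Ell1Space.

Definition push S T (phi : S -> T) (f : ell1 S) : ell1 T :=
  mk_ell1 (csumm_csum_fiber phi (ell1P f)).

Lemma pushE S T (phi : S -> T) (f : ell1 S) t :
  ell1_fun (push phi f) t = csum (fun s => if phi s == t then ell1_fun f s else 0).
Proof. by []. Qed.

Lemma push_linear S T (phi : S -> T) : linear (push phi).
Proof.
move=> c f g; apply: ell1_eq => t; rewrite ell1D ell1Z !pushE.
have fs := csumm_fiber phi t (ell1P f); have gs := csumm_fiber phi t (ell1P g).
rewrite -csumZ// -csumD//; last exact: csummZ.
by congr csum; apply/funext => s; case: ifP => // _; rewrite mulr0 addr0.
Qed.

Lemma push_norm S T (phi : S -> T) f : `|push phi f| <= `|f|.
Proof. exact: psum_csum_fiber (ell1P f). Qed.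

Lemma eq_push S T (phi psi : S -> T) f : phi =1 psi -> push phi f = push psi f.
Proof. by move=> /funext ->. Qed.

Lemma push_comp S T U (phi : S -> T) (psi : T -> U) f :
  push psi (push phi f) = push (fun s => psi (phi s)) f.
Proof.
apply: ell1_eq => u; rewrite !pushE.
rewrite -[RHS](csum_fiber phi (csumm_fiber _ u (ell1P f))).
congr csum; apply/funext => t; rewrite pushE.
case: ifP => ptu.
  by congr csum; apply/funext => s; case: eqP => // ->; rewrite ptu.
rewrite -[LHS](csum0 R S); congr csum; apply/funext => s.
by case: eqP => // ->; rewrite ptu.
Qed.

Lemma push_bij S T (phi : S -> T) (phi' : T -> S) f t :
  cancel phi phi' -> cancel phi' phi -> ell1_fun (push phi f) t = ell1_fun f (phi' t).
Proof.
move=> h1 h2; rewrite pushE -[RHS](csum_single (phi' t)); congr csum.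
by apply/funext => s; rewrite -(can_eq h2) h1; case: eqVneq => // ->.
Qed.

Lemma push_id S (f : ell1 S) : push id f = f.
Proof. by apply: ell1_eq => s; rewrite (@push_bij _ _ id id). Qed.

Definition ell1_tensor S T (f : ell1 S) (g : ell1 T) : ell1 (S * T)%type :=
  mk_ell1 (csumm_prod (ell1P f) (ell1P g)).1.

Lemma ell1_tensorE S T (f : ell1 S) (g : ell1 T) p :
  ell1_fun (ell1_tensor f g) p = ell1_fun f p.1 * ell1_fun g p.2.
Proof. by []. Qed.

Lemma ell1_tensor_norm S T (f : ell1 S) (g : ell1 T) : `|ell1_tensor f g| <= `|f| * `|g|.
Proof. exact: (csumm_prod (ell1P f) (ell1P g)).2. Qed.

Lemma push_tensor S T S' T' (phi : S -> S') (psi : T -> T') f g :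
  ell1_tensor (push phi f) (push psi g) =
  push (fun p => (phi p.1, psi p.2)) (ell1_tensor f g).
Proof.
apply: ell1_eq => -[s' t']; rewrite ell1_tensorE !pushE /= -csum_prod.
- congr csum; apply/funext => -[s t] /=; rewrite xpair_eqE ell1_tensorE.
  by case: eqP => _; case: eqP => _; rewrite /= ?mulr0 ?mul0r.
- exact: csumm_fiber (ell1P f).
- exact: csumm_fiber (ell1P g).
Qed.

Lemma ell1_tensorA S T U (f : ell1 S) (g : ell1 T) (h : ell1 U) :
  ell1_tensor f (ell1_tensor g h) =
  push (fun p => (p.1.1, (p.1.2, p.2))) (ell1_tensor (ell1_tensor f g) h).
Proof.
apply: ell1_eq => -[s [t u]].
rewrite (@push_bij _ _ _ (fun q => ((q.1, q.2.1), q.2.2))); last 2 first.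
- by move=> [[]].
- by move=> [? []].
by rewrite !ell1_tensorE mulrA.
Qed.

Lemma ell1_tensorC S T (f : ell1 S) (g : ell1 T) :
  ell1_tensor f g = push (fun p => (p.2, p.1)) (ell1_tensor g f).
Proof.
apply: ell1_eq => -[s t].
rewrite (@push_bij _ _ _ (fun q => (q.2, q.1))); last 2 first.
- by move=> [].
- by move=> [].
by rewrite !ell1_tensorE mulrC.
Qed.

Lemma ell1_tensor_linearl S T (g : ell1 T) : linear (fun f : ell1 S => ell1_tensor f g).
Proof.
by move=> c f f'; apply: ell1_eq => p; rewrite ell1D ell1Z !ell1_tensorE ell1D ell1Z mulrDl mulrA.
Qed.

Lemma ell1_tensor_linearr S T (f : ell1 S) : linear (@ell1_tensor S T f).
Proof.
move=> c g g'; apply: ell1_eq => p.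
by rewrite ell1D ell1Z !ell1_tensorE ell1D ell1Z mulrDr mulrCA.
Qed.

Section Convolution.
Variable G : nmodType.

Definition conv (f g : ell1 G) : ell1 G :=
  push (fun p => p.1 + p.2) (ell1_tensor f g).

Lemma convE (f g : ell1 G) u : ell1_fun (conv f g) u =
  csum (fun p : G * G => if p.1 + p.2 == u then ell1_fun f p.1 * ell1_fun g p.2 else 0).
Proof. by []. Qed.

Lemma convC : commutative conv.
Proof.
move=> f g; rewrite /conv (ell1_tensorC f g) (push_comp _ _ (ell1_tensor g f)).
by apply: eq_push => p; rewrite addrC.
Qed.

Lemma convA : associative conv.
Proof.
move=> f g h; rewrite /conv -{1}[f]push_id -{2}[h]push_id !push_tensor !push_comp.
rewrite ell1_tensorA push_comp.
by apply: eq_push => p; rewrite addrA.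
Qed.

Lemma conv_norm f g : `|conv f g| <= `|f| * `|g|.
Proof. exact: le_trans (push_norm _ _) (ell1_tensor_norm _ _). Qed.

Lemma conv_bilinear : bounded_bilinear conv.
Proof.
split=> [g c f f'|f c g g'|].
- by rewrite /conv ell1_tensor_linearl push_linear.
- by rewrite /conv ell1_tensor_linearr push_linear.
- by exists 1 => f g; rewrite mul1r conv_norm.
Qed.

Definition ell1_alg : normedAlg R := NormedAlg convA conv_bilinear conv_norm.
End Convolution.

Lemma push_conv (G H : nmodType) (phi : G -> H) (f g : ell1 G) :
  {morph phi : x y / x + y} ->
  push phi (conv f g) = conv (push phi f) (push phi g).
Proof.
move=> phiD; rewrite /conv push_comp push_tensor push_comp.
by apply: eq_push => p; rewrite phiD.
Qed.
End Ell1.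

Section QuotientModule.
Variable R : realType.

Definition ellN : normedAlg R := ell1_alg R nat.

(* Extension by zero: see [inclE] and [inclN] below. *)
Definition incl : ellN -> ell1_alg R int := push Posz.

Let incl_linear : linear incl. Proof. exact: push_linear. Qed.
Let incl_mul x y : incl (na_mul x y) = na_mul (incl x) (incl y).
Proof. by apply: push_conv => m n; rewrite PoszD. Qed.
Let incl_bounded : exists c, forall x, `|incl x| <= c * `|x|.
Proof. by exists 1 => x; rewrite mul1r; exact: push_norm. Qed.

Definition ellZ_bimod : bimod ellN := pullback_bimod incl_linear incl_mul incl_bounded.

Lemma inclE f (n : nat) : ell1_fun (incl f) n%:Z = ell1_fun f n.
Proof.
rewrite /incl pushE -[RHS](csum_single n); congr csum; apply/funext => m.
by rewrite -[m%:Z == n%:Z]/(m == n); case: eqP => // ->.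
Qed.

Lemma inclN f (n : nat) : ell1_fun (incl f) (Negz n) = 0.
Proof. by rewrite /incl pushE csum0. Qed.

Let range_closed : subsemimod_closed (fun x : ellZ_bimod => `[< exists f, x = incl f >]).
Proof.
split; first split.
- by apply/asboolP; exists 0; rewrite (linear_fun0 incl_linear).
- move=> x y /asboolP[f ->] /asboolP[g ->]; apply/asboolP; exists (f + g).
  by rewrite (linear_funD _ _ incl_linear).
- move=> c x /asboolP[f ->]; apply/asboolP; exists (c *: f).
  by rewrite (linear_funZ _ _ incl_linear).
Qed.

Definition ellN_sub : lsubspace ellZ_bimod := LSubspace range_closed.

Let ellN_lact b x : ellN_sub x -> ellN_sub (lact b x).
Proof. by move=> [f ->]; exists (na_mul b f); rewrite incl_mul. Qed.
Let ellN_ract b x : ellN_sub x -> ellN_sub (ract x b).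
Proof. by move=> [f ->]; exists (na_mul f b); rewrite incl_mul. Qed.

Definition Qbimod : bimod ellN := quotient_bimod ellN_lact ellN_ract.

Lemma Qbimod_symmetric b (q : Qbimod) : lact b q = ract q b.
Proof.
have [x <-] := qproj_surj q.
have /= -> := quotient_lactE ellN_lact ellN_ract b x.
have /= -> := quotient_ractE ellN_lact ellN_ract b x.
by congr qproj; exact: convC.
Qed.
End QuotientModule.

Section DirectSum.
Variables (R : realType) (V : snModType R) (k : nat).

Definition dsum := {ffun 'I_k -> V}.
HB.instance Definition _ := GRing.Lmodule.on dsum.

Definition dsum_norm (x : dsum) : R := \sum_i `|x i|.

Let dsum_normD x y : dsum_norm (x + y) <= dsum_norm x + dsum_norm y.
Proof.
by rewrite -big_split; apply: ler_sum => i _; rewrite ffunE; exact: ler_normD.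
Qed.
Let dsum_normZ c x : dsum_norm (c *: x) <= normc c * dsum_norm x.
Proof. by rewrite mulr_sumr; apply: ler_sum => i _; rewrite ffunE snormZ. Qed.

HB.instance Definition _ := Lmodule_isSNMod.Build R dsum dsum_normD dsum_normZ.
End DirectSum.

Definition bounded_map (R : realType) (V W : snModType R) (f : V -> W) : Prop :=
  exists c, forall x, `|f x| <= c * `|x|.

Definition sn_iso (R : realType) (V W : snModType R) : Prop :=
  exists (f : {linear V -> W}) (g : {linear W -> V}),
    [/\ bounded_map f, bounded_map g, cancel f g & cancel g f].

Definition is_banach (R : realType) (V : snModType R) : Prop :=
  (forall x : V, `|x| = 0 -> x = 0) /\
  (forall u : nat -> V, is_cauchy u ->
    exists l, (fun n => `|u n - l|) @ \oo --> (0 : R)).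

Definition infinite_dim (R : realType) (V : snModType R) : Prop :=
  ~ exists n (b : 'I_n -> V), forall x : V,
      exists c : 'I_n -> R[i], x = \sum_i c i *: b i.

Definition multi (k : nat) : nmodType := {ffun 'I_k -> nat}.
Definition ellNk (R : realType) (k : nat) : normedAlg R := ell1_alg R (multi k).

(* Main.v *)
Require Import Defs.
From HB Require Import structures.
From mathcomp Require Import all_boot all_order all_algebra.
From mathcomp Require Import fingroup perm complex.
From mathcomp Require Import all_classical all_reals.
From mathcomp Require Import ereal esum topology normedtype sequences.
From mathcomp Require Import finmap ring lra.

(** Let P = N^k and G = Z^k, and embed ell1 P in ell1 G, on which the translations z^v by points
    v of G are invertible isometries.

    Every bounded 2-cocycle psi on ell1 P is symmetric ([cocycle_symmetric]). Indeed its
    antisymmetric part alpha is a derivation in the first variable, so that alpha(n p, q) is n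
    times a translate of alpha(p, q); this is bounded in n only if alpha = 0. As the Harrison
    cochains are the symmetric ones in degree 2 and all of them in degree 1, the two cohomology
    spaces agree ([hochH_harH_iso]).

    In ell1 G a symmetric cocycle becomes a coboundary: c(p, q) = z^(-p-q) psi(p, q) is a
    cocycle for the trivial action, and the method by which Hyers solved the stability problem
    for additive maps gives f(p) = sum_i 2^(-i-1) c(2^i p, 2^i p) with c(p, q) = f(p) + f(q) -
    f(p + q) ([hyers]). So psi is the coboundary of phi(p) = z^p f(p), bounded, with values in
    ell1 G, and unique because a bounded additive map vanishes ([primitive_exists],
    [primitive_unique]). Hence psi is a coboundary over ell1 P exactly when phi takes values in
    ell1 P, and the class of psi amounts to the bounded derivation that phi induces modulo ell1
    P ([coboundary_primitive], [primitive_negpartD]).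

    Such a derivation is determined by its values at the unit vectors e_i. Its value at n e_i is
    n z^((n-1) e_i) phi(e_i); since this stays bounded, the coefficients of phi(e_i) at points
    that no multiple of e_i translates into P vanish ([primitive_coord0]). The remaining ones,
    at points whose only negative coordinate is the i-th, form an element x of ell1 (N *
    N^(k-1)) for which (n + 1) |s^n x| is bounded, where s is the truncated shift of the first
    factor; these elements form the space [tails]. Conversely any k tails are the values at the
    unit vectors of a derivation into ell1 G modulo ell1 P, and this derivation is bounded
    ([free_derivation_term]). This identifies the second cohomology with a k-fold sum of [tails]
    ([harH_tails_iso]).

    On the other side, the tensor product of Q with ell1 (N^(k-1)) is ell1 (N * N^(k-1)), with z
    acting as s ([ptensor_ell1]). A bounded derivation D of ell1 N into it satisfies D(z^(n+1))
    = (n + 1) z^n D(z), so D is determined by D(z), which can be any tail ([derivations_iso]).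
    Finally [tails] is complete, being defined by a supremum of seminorms on a Banach space, and
    it contains all point masses, which are independent. *)

Set Implicit Arguments.
Unset Strict Implicit.
Unset Printing Implicit Defensive.
Import Order.TTheory GRing.Theory Num.Theory.
Import ComplexField.Normc.
Import numFieldNormedType.Exports.
Local Open Scope ring_scope.
Local Open Scope classical_set_scope.

(** * Bounded linear maps *)

Section BoundedMaps.
Variable R : realType.
Implicit Types U V W : snModType R.

Definition blin V W (f : V -> W) : Prop := linear f /\ bounded_map f.

Definition hausdorff V : Prop := forall x : V, `|x| = 0 -> x = 0.

Lemma blin_bound V W (f : V -> W) : blin f ->
  exists2 c, 0 <= c & forall x, `|f x| <= c * `|x|.
Proof.
move=> [_ [c fc]]; exists (Num.max c 0); first by rewrite le_max lexx orbT.
by move=> x; rewrite (le_trans (fc x))// ler_wpM2r// le_max lexx.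
Qed.

Lemma blin_id V : blin (@id V).
Proof. by split=> //; exists 1 => x; rewrite mul1r. Qed.

Lemma blin_comp U V W (f : U -> V) (g : V -> W) :
  blin f -> blin g -> blin (fun x => g (f x)).
Proof.
move=> fb gb; have [c c0 fc] := blin_bound fb; have [d d0 gd] := blin_bound gb.
split; first by move=> k x y; rewrite fb.1 gb.1.
by exists (d * c) => x; rewrite (le_trans (gd _))// -mulrA ler_wpM2l.
Qed.

Lemma blinD V W (f g : V -> W) : blin f -> blin g -> blin (fun x => f x + g x).
Proof.
move=> fb gb; have [c c0 fc] := blin_bound fb; have [d d0 gd] := blin_bound gb.
split; first by move=> k x y; rewrite fb.1 gb.1 scalerDr addrACA.
by exists (c + d) => x; rewrite (le_trans (ler_normD _ _))// mulrDl lerD.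
Qed.

Lemma blinZ V W (f : V -> W) k : blin f -> blin (fun x => k *: f x).
Proof.
move=> fb; have [c c0 fc] := blin_bound fb.
split; first by move=> l x y; rewrite fb.1 scalerDr !scalerA mulrC.
by exists (normc k * c) => x; rewrite snormZ -mulrA ler_wpM2l// normc_ge0.
Qed.

Lemma blinN V W (f : V -> W) : blin f -> blin (fun x => - f x).
Proof.
move=> /(blinZ (-1)); congr blin; apply/funext => x; exact: scaleN1r.
Qed.

Lemma blinB V W (f g : V -> W) : blin f -> blin g -> blin (fun x => f x - g x).
Proof. by move=> fb gb; apply: blinD => //; exact: blinN. Qed.

Lemma bilinear_blinl U V W (f : U -> V -> W) y :
  bounded_bilinear f -> blin (fun x => f x y).
Proof.
move=> [lf _ [c fc]]; split; first exact: lf.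
by exists (c * `|y|) => x; rewrite mulrAC.
Qed.

Lemma bilinear_blinr U V W (f : U -> V -> W) x : bounded_bilinear f -> blin (f x).
Proof. by move=> [_ rf [c fc]]; split; [exact: rf|exists (c * `|x|)]. Qed.

Lemma archi_le0 (x c : R) : (forall n : nat, n%:R * x <= c) -> x <= 0.
Proof.
move=> h; rewrite leNgt; apply/negP => x0.
have c0 : 0 <= c by have := h 0%N; rewrite mul0r.
have := archi_boundP (divr_ge0 c0 (ltW x0)).
by rewrite ltr_pdivrMr// ltNge h.
Qed.

Lemma normc_nat n : normc (n%:R : R[i]) = n%:R.
Proof.
by rewrite -[LHS]/(normc (1 *+ n : Rcomplex R)) normcMn normc1.
Qed.

Lemma snormMn V (x : V) n : `|x *+ n| = n%:R * `|x|.
Proof. by rewrite -scaler_nat snormZ normc_nat. Qed.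

End BoundedMaps.

(** * Point masses in ell1 and their density *)

Section Ell1Tools.
Variable R : realType.
Implicit Types S T U : choiceType.

Lemma ell1_norm_le S (x : ell1 R S) c :
  (forall r : seq S, uniq r -> \sum_(s <- r) normc (ell1_fun x s) <= c) -> `|x| <= c.
Proof.
move=> h; rewrite -lee_fin ell1_normE -psumE; last 2 first.
- by move=> s; exact: normc_ge0.
- exact: ell1P.
apply: ge_ereal_sup => _ [A [finA _] <-].
by rewrite fsbig_finite//= sumEFin lee_fin h.
Qed.

Lemma psum_ge_sum S (f : S -> R) (r : seq S) : (forall s, 0 <= f s) -> summ f -> uniq r ->
  \sum_(s <- r) f s <= psum f.
Proof.
move=> f0 fs ur; rewrite -lee_fin -psumE//.
apply: esum_ge; exists [set` r]; first by split.
by rewrite -sumEFin fsbig_seq.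
Qed.

Lemma ell1_sum_le S (x : ell1 R S) (r : seq S) : uniq r ->
  \sum_(s <- r) normc (ell1_fun x s) <= `|x|.
Proof. by apply: psum_ge_sum; [move=> s; exact: normc_ge0|exact: ell1P]. Qed.

Lemma ell1_sum_gt S (x : ell1 R S) e : 0 < e ->
  exists2 r : seq S, uniq r & `|x| < \sum_(s <- r) normc (ell1_fun x s) + e.
Proof.
move=> e0; apply: contrapT => h.
have : `|x| <= `|x| - e; last by rewrite lerBrDr gerDl leNgt e0.
apply: ell1_norm_le => r ur; rewrite lerBrDr leNgt; apply/negP => xr.
by apply: h; exists r.
Qed.

Lemma ell1_coord_le S (x : ell1 R S) s : normc (ell1_fun x s) <= `|x|.
Proof. by have := @ell1_sum_le _ x [:: s] isT; rewrite big_seq1. Qed.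

Lemma ell1_dom S (x y : ell1 R S) :
  (forall s, normc (ell1_fun x s) <= normc (ell1_fun y s)) -> `|x| <= `|y|.
Proof.
move=> xy; apply: psum_le => // [s|]; first exact: normc_ge0.
exact: ell1P.
Qed.

Lemma ell1_hausdorff S : hausdorff (ell1 R S).
Proof.
move=> x x0; apply: ell1_eq => s; apply: eq0_normc; apply/eqP.
by rewrite eq_le normc_ge0 andbT -x0 ell1_coord_le.
Qed.

Lemma delta_summ S (s : S) : csumm (fun t => if t == s then 1 else 0 : R[i]).
Proof.
rewrite /csumm /summ [X in (X < _)%E](_ : _ = 1%:E)%E ?ltry//.
rewrite -(esum_single s (@ler01 R)); apply: eq_esum => t _.
by case: ifP => _; rewrite ?normc1 ?normc0.
Qed.

Definition delta S (s : S) : ell1 R S := mk_ell1 (delta_summ s).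

Lemma deltaE S (s t : S) : ell1_fun (delta s) t = if t == s then 1 else 0.
Proof. by []. Qed.

Lemma delta_norm S (s : S) : `|delta s| = 1.
Proof.
rewrite ell1_normE /psum [X in fine X](_ : _ = 1%:E)%E//.
rewrite -(esum_single s (@ler01 R)); apply: eq_esum => t _.
by rewrite deltaE; case: ifP => _; rewrite ?normc1 ?normc0.
Qed.

Lemma ell1_sumE S I (r : seq I) (F : I -> ell1 R S) s :
  ell1_fun (\sum_(i <- r) F i) s = \sum_(i <- r) ell1_fun (F i) s.
Proof. by elim: r => [|i r IH]; rewrite ?big_nil// !big_cons ell1D IH. Qed.

Lemma ell1B S (x y : ell1 R S) s : ell1_fun (x - y) s = ell1_fun x s - ell1_fun y s.
Proof. by []. Qed.

Lemma ell1N S (x : ell1 R S) s : ell1_fun (- x) s = - ell1_fun x s.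
Proof. by []. Qed.

Lemma ell1Mn S (x : ell1 R S) n s : ell1_fun (x *+ n) s = ell1_fun x s *+ n.
Proof. by elim: n => [|n IH]; rewrite ?mulr0n// !mulrS ell1D IH. Qed.

Lemma ell10 S s : ell1_fun (0 : ell1 R S) s = 0.
Proof. by []. Qed.

Definition trunc S (r : seq S) (x : ell1 R S) : ell1 R S :=
  \sum_(s <- r) ell1_fun x s *: delta s.

Lemma truncE S (r : seq S) (x : ell1 R S) s : uniq r ->
  ell1_fun (trunc r x) s = if s \in r then ell1_fun x s else 0.
Proof.
move=> ur; rewrite ell1_sumE (eq_bigr (fun t => if t == s then ell1_fun x s else 0)); last first.
  move=> t _; rewrite ell1Z deltaE eq_sym.
  by case: eqVneq => [->|]; rewrite ?mulr1 ?mulr0.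
rewrite -big_mkcond/=; case: ifPn => sr.
  by rewrite -big_filter filter_pred1_uniq// big_seq1.
by rewrite big_seq_cond big1// => t /andP[tr /eqP ts]; rewrite -ts tr in sr.
Qed.

Lemma trunc_mono S (r q : seq S) (x : ell1 R S) : uniq r -> uniq q -> {subset r <= q} ->
  `|x - trunc q x| <= `|x - trunc r x|.
Proof.
move=> ur uq rq; apply: ell1_dom => s; rewrite !ell1B !truncE//.
case: (boolP (s \in r)) => [/rq ->//|_].
by case: ifP => _; rewrite ?subrr ?normc0 ?normc_ge0.
Qed.

Lemma ell1_approx S (x : ell1 R S) e : 0 < e ->
  exists2 r : seq S, uniq r & `|x - trunc r x| < e.
Proof.
move=> e0; have e20 : 0 < e / 2 by rewrite divr_gt0.
have [r ur xr] := ell1_sum_gt x e20; exists r => //.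
apply: (@le_lt_trans _ _ (e / 2)); last by rewrite ltr_pdivrMr// ltr_pMr// ltr1n.
apply: ell1_norm_le => q uq; rewrite -(lerD2l (\sum_(s <- r) normc (ell1_fun x s))).
(* The mass of x on r and its mass on q off r add up to at most its norm. *)
apply: le_trans (ltW xr); apply: le_trans (@ell1_sum_le _ x (r ++ [seq s <- q | s \notin r]) _).
  rewrite big_cat/= lerD2l big_filter [leRHS]big_mkcond/=; apply: ler_sum => s _.
  by rewrite ell1B truncE//; case: (s \in r); rewrite ?subrr ?normc0 ?subr0.
rewrite cat_uniq ur filter_uniq// andbT/=; apply/hasPn => s.
by rewrite mem_filter => /andP[].
Qed.

Lemma linear_funN (V W : snModType R) (f : V -> W) x : linear f -> f (- x) = - f x.
Proof. by move=> lf; rewrite -scaleN1r (linear_funZ _ _ lf) scaleN1r. Qed.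

Lemma linear_funMn (V W : snModType R) (f : V -> W) x n : linear f -> f (x *+ n) = f x *+ n.
Proof.
move=> lf; elim: n => [|n IH]; first by rewrite !mulr0n (linear_fun0 lf).
by rewrite !mulrS (linear_funD _ _ lf) IH.
Qed.

Lemma blin_sum (V W : snModType R) (f : V -> W) I (r : seq I) (F : I -> V) : linear f ->
  f (\sum_(i <- r) F i) = \sum_(i <- r) f (F i).
Proof.
move=> lf; elim: r => [|i r IH]; first by rewrite !big_nil (linear_fun0 lf).
by rewrite !big_cons (linear_funD _ _ lf) IH.
Qed.

(** A bounded linear map is determined by the point masses, as their span is dense. *)
Lemma blin_delta0 S (V : snModType R) (f : ell1 R S -> V) : hausdorff V -> blin f ->
  (forall s, f (delta s) = 0) -> forall x, f x = 0.
Proof.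
move=> hV fb f0 x; apply: hV; apply/eqP; rewrite eq_le normr_ge0 andbT.
have [c c0 fc] := blin_bound fb; apply/ler_addgt0Pr => e e0; rewrite add0r.
have c1 : 0 < c + 1 by rewrite ltr_pwDr.
have [r _ xr] := ell1_approx x (divr_gt0 e0 c1).
have fr : f (trunc r x) = 0.
  rewrite (blin_sum _ _ fb.1) big1// => s _.
  by rewrite (linear_funZ _ _ fb.1) f0 scaler0.
rewrite -[f x]subr0 -fr -(linear_funB _ _ fb.1) (le_trans (fc _))//.
rewrite (le_trans (ler_wpM2l c0 (ltW xr)))// mulrCA ger_pMr//.
by rewrite ler_pdivrMr// mul1r lerDl.
Qed.

Lemma blin_ext S (V : snModType R) (f g : ell1 R S -> V) : hausdorff V ->
  blin f -> blin g -> (forall s, f (delta s) = g (delta s)) -> f =1 g.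
Proof.
move=> hV fb gb fg x; apply/eqP; rewrite -subr_eq0; apply/eqP.
apply: (@blin_delta0 _ _ (fun x => f x - g x)) => //; first exact: blinB.
by move=> s; rewrite fg subrr.
Qed.

(** Weaker than bounded bilinearity, but sufficient to argue by density one variable at a time;
    coboundaries satisfy it without any estimate on their joint norm. *)
Definition separately_blin (E F V : snModType R) (f : E -> F -> V) : Prop :=
  (forall y, blin (fun x => f x y)) /\ forall x, blin (f x).

Lemma bilinear_separately (E F V : snModType R) (f : E -> F -> V) :
  bounded_bilinear f -> separately_blin f.
Proof. by move=> fb; split=> [y|x]; [exact: bilinear_blinl|exact: bilinear_blinr]. Qed.

Lemma bilin_ext S T (V : snModType R) (f g : ell1 R S -> ell1 R T -> V) : hausdorff V ->
  separately_blin f -> separately_blin g ->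
  (forall s t, f (delta s) (delta t) = g (delta s) (delta t)) ->
  forall x y, f x y = g x y.
Proof.
move=> hV [fl fr] [gl gr] fg x y.
apply: (@blin_ext _ _ (f^~ y) (g^~ y)) => // s.
exact: (@blin_ext _ _ (f (delta s)) (g (delta s))).
Qed.

Lemma summ_inj S T (phi : S -> T) (f : T -> R) : injective phi -> (forall t, 0 <= f t) ->
  summ f -> summ (fun s => f (phi s)).
Proof.
move=> phiI f0; apply: le_lt_trans; apply: ge_ereal_sup => _ [A [finA _] <-].
rewrite fsbig_finite//= -(big_map phi predT (fun t => (f t)%:E))/=.
apply: esum_ge; exists [set` [seq phi i | i <- fset_set A]] => //.
by rewrite fsbig_seq// map_inj_uniq.
Qed.

Lemma csumm_pull S T (phi : S -> T) (x : ell1 R T) : injective phi ->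
  csumm (fun s => ell1_fun x (phi s)).
Proof.
by move=> phiI; apply: (summ_inj phiI) (ell1P x) => t; exact: normc_ge0.
Qed.

Definition pull S T (phi : S -> T) (phiI : injective phi) (x : ell1 R T) : ell1 R S :=
  mk_ell1 (csumm_pull x phiI).

Lemma pullE S T (phi : S -> T) (phiI : injective phi) x s :
  ell1_fun (pull phiI x) s = ell1_fun x (phi s).
Proof. by []. Qed.

Lemma pull_norm S T (phi : S -> T) (phiI : injective phi) x : `|pull phiI x| <= `|x|.
Proof.
apply: ell1_norm_le => r ur.
rewrite -(big_map phi predT (fun t => normc (ell1_fun x t))) ell1_sum_le//.
by rewrite map_inj_uniq.
Qed.

Lemma pull_blin S T (phi : S -> T) (phiI : injective phi) : blin (pull phiI).
Proof.
split; last by exists 1 => x; rewrite mul1r pull_norm.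
by move=> c x y; apply: ell1_eq => s; rewrite pullE !ell1D !ell1Z !pullE.
Qed.

Lemma push_blin S T (phi : S -> T) : blin (@push R S T phi).
Proof.
split; first exact: push_linear.
by exists 1 => x; rewrite mul1r push_norm.
Qed.

Lemma push_delta S T (phi : S -> T) s : push phi (delta s) = delta (phi s).
Proof.
apply: ell1_eq => t; rewrite pushE deltaE eq_sym.
rewrite -(csum_single s (if phi s == t then 1 else 0)).
congr csum; apply/funext => u; rewrite deltaE.
by case: (eqVneq u s) => [->//|_]; rewrite if_same.
Qed.

Lemma delta_tensor S T (s : S) (t : T) :
  ell1_tensor (delta s) (delta t) = delta (s, t).
Proof.
apply: ell1_eq => -[u v]; rewrite ell1_tensorE !deltaE xpair_eqE/=.
by case: (u == s); case: (v == t); rewrite ?mulr1 ?mulr0.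
Qed.

Lemma delta_conv (G : nmodType) (a b : G) : conv (delta a) (delta b) = delta (a + b).
Proof. by rewrite /conv delta_tensor push_delta. Qed.

End Ell1Tools.

(** * Linear maps with prescribed values on point masses *)

Section KernelOperators.
Variable R : realType.
Implicit Types S T U : choiceType.

Lemma push_inj S T (phi : S -> T) (x : ell1 R S) s : injective phi ->
  ell1_fun (push phi x) (phi s) = ell1_fun x s.
Proof.
move=> phiI; rewrite pushE -[RHS](csum_single s); congr csum.
by apply/funext => t; rewrite (inj_eq phiI); case: eqVneq => // ->.
Qed.

Lemma push_out S T (phi : S -> T) (x : ell1 R S) t : (forall s, phi s != t) ->
  ell1_fun (push phi x) t = 0.
Proof.
move=> h; rewrite pushE -[RHS](csum0 R S); congr csum.
by apply/funext => s; rewrite (negbTE (h s)).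
Qed.

Lemma summ_bound S (f : S -> R) c : (forall s, 0 <= f s) ->
  (forall r : seq S, uniq r -> \sum_(s <- r) f s <= c) -> summ f.
Proof.
move=> f0 fc; apply: (@le_lt_trans _ _ c%:E); last exact: ltry.
apply: ge_ereal_sup => _ [A [finA _] <-].
by rewrite fsbig_finite//= sumEFin lee_fin fc.
Qed.

(** The default value 0, for families that are not summable, makes [kernel_op] a total function
    of the family. *)
Definition ell1_of S (F : S -> R[i]) : ell1 R S :=
  if pselect (csumm F) is left Fs then mk_ell1 Fs else 0.

Lemma ell1_ofE S (F : S -> R[i]) s : csumm F -> ell1_fun (ell1_of F) s = F s.
Proof. by rewrite /ell1_of; case: pselect. Qed.

Definition bounded_family S T (u : S -> ell1 R T) : Prop :=
  exists c, forall s, `|u s| <= c.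

Definition kernel S T (u : S -> ell1 R T) (x : ell1 R S) (p : S * T) : R[i] :=
  ell1_fun x p.1 * ell1_fun (u p.1) p.2.

Lemma kernel_bound S T (u : S -> ell1 R T) c (x : ell1 R S) : (forall s, `|u s| <= c) ->
  0 <= c -> (\esum_(p in [set: S * T]) (normc (kernel u x p))%:E <= (c * `|x|)%:E)%E.
Proof.
move=> uc c0; rewrite (_ : setT = setT `*`` (fun=> setT)); last exact/seteqP.
rewrite -(@esum_esum _ _ _ setT (fun=> setT)
  (fun s t => (normc (kernel u x (s, t)))%:E)); last first.
  by move=> *; rewrite lee_fin normc_ge0.
apply: le_trans (esum_scale_le c0 _ (ell1P x)); last by move=> s; exact: normc_ge0.
apply: le_esum => s _.
apply: (@le_trans _ _ (normc (ell1_fun x s) * `|u s|)%:E).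
  apply: le_trans (esum_scale_le (normc_ge0 (ell1_fun x s)) _ (ell1P (u s))); last first.
    by move=> t; exact: normc_ge0.
  by apply: le_esum => t _; rewrite /kernel/= normcM.
by rewrite lee_fin mulrC ler_wpM2r ?normc_ge0.
Qed.

Lemma kernel_summ S T (u : S -> ell1 R T) (x : ell1 R S) : bounded_family u ->
  csumm (kernel u x).
Proof.
move=> [c uc]; rewrite /csumm /summ.
apply: le_lt_trans (@kernel_bound _ _ u (Num.max c 0) x _ _) (ltry _).
  by move=> s; rewrite le_max uc.
by rewrite le_max lexx orbT.
Qed.

(** The sum over s of the coefficient of [x] at s times [u s]. Written as the image of a
    summable family on [S * T] under the second projection, it requires no limit of vectors. *)
Definition kernel_op S T (u : S -> ell1 R T) (x : ell1 R S) : ell1 R T :=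
  push snd (ell1_of (kernel u x)).

Lemma kernel_op_norm S T (u : S -> ell1 R T) c x : 0 <= c -> (forall s, `|u s| <= c) ->
  `|kernel_op u x| <= c * `|x|.
Proof.
move=> c0 uc; apply: le_trans (push_norm _ _) _.
have us : bounded_family u by exists c.
rewrite -lee_fin ell1_normE -psumE; last 2 first.
- by move=> s; exact: normc_ge0.
- exact: ell1P.
apply: le_trans (kernel_bound x uc c0); apply: le_esum => p _.
by rewrite ell1_ofE//; exact: kernel_summ.
Qed.

Lemma kernel_op_linear S T (u : S -> ell1 R T) : bounded_family u -> linear (kernel_op u).
Proof.
move=> us c x y; rewrite /kernel_op -push_linear; congr push; apply: ell1_eq => p.
rewrite ell1D ell1Z !ell1_ofE; try exact: kernel_summ.
by rewrite /kernel ell1D ell1Z mulrDl mulrA.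
Qed.

Lemma kernel_op_blin S T (u : S -> ell1 R T) : bounded_family u -> blin (kernel_op u).
Proof.
move=> us; split; first exact: kernel_op_linear.
have [c uc] := us; exists (Num.max c 0) => x; apply: kernel_op_norm.
  by rewrite le_max lexx orbT.
by move=> s; rewrite le_max uc.
Qed.

Lemma kernel_op_delta S T (u : S -> ell1 R T) s : bounded_family u -> kernel_op u (delta R s) = u s.
Proof.
move=> us; apply: ell1_eq => t; rewrite pushE -(csum_single (s, t) (ell1_fun (u s) t)).
congr csum; apply/funext => -[s' t']; rewrite ell1_ofE; last exact: kernel_summ.
rewrite /kernel/= deltaE xpair_eqE.
case: (eqVneq t' t) => [->|_]; last by rewrite andbF.
by case: (eqVneq s' s) => [->|_]; rewrite ?mul1r ?mul0r.
Qed.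

Lemma kernel_op_push S T U (phi : S -> T) (u : T -> ell1 R U) x : bounded_family u ->
  kernel_op u (push phi x) = kernel_op (fun s => u (phi s)) x.
Proof.
move=> us; have us' : bounded_family (fun s => u (phi s)).
  by have [c uc] := us; exists c.
apply: (@blin_ext _ _ _ (fun x => kernel_op u (push phi x)) (kernel_op (fun s => u (phi s)))).
- exact: ell1_hausdorff.
- by apply: blin_comp; [exact: push_blin|exact: kernel_op_blin].
- exact: kernel_op_blin.
- by move=> s; rewrite push_delta !kernel_op_delta.
Qed.

End KernelOperators.

(** * Geometric sums and completeness of ell1 *)

Section GeometricSeries.
Variable R : realType.
Implicit Types S T : choiceType.

Definition geo_coef (n : nat) : R := 2^-1 ^+ n.+1.

Lemma geo_coef_ge0 n : 0 <= geo_coef n.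
Proof. by rewrite exprn_ge0// invr_ge0. Qed.

Lemma geo_coef_sum n : \sum_(0 <= i < n) geo_coef i = 1 - 2^-1 ^+ n.
Proof.
elim: n => [|n IH]; first by rewrite big_geq// expr0 subrr.
by rewrite big_nat_recr//= IH /geo_coef exprS; lra.
Qed.

Lemma geo_coef_bound (r : seq nat) : uniq r -> \sum_(i <- r) geo_coef i <= 1.
Proof.
move=> ur; pose n := (\max_(i <- r) i).+1.
apply: (@le_trans _ _ (\sum_(0 <= i < n) geo_coef i)); last first.
  by rewrite geo_coef_sum gerBl exprn_ge0// invr_ge0.
have -> : \sum_(i <- r) geo_coef i = \sum_(i <- [seq i <- index_iota 0 n | i \in r]) geo_coef i.
  apply: perm_big; apply: uniq_perm => //; first by rewrite filter_uniq// iota_uniq.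
  move=> i; rewrite mem_filter mem_index_iota leq0n/=.
  by case ir : (i \in r) => //=; rewrite ltnS (@leq_bigmax_seq _ r predT id).
rewrite big_filter big_mkcond/=; apply: ler_sum => i _.
by case: ifP => // _; exact: geo_coef_ge0.
Qed.

Lemma normc_real (x : R) : normc x%:C%C = `|x|.
Proof. by rewrite /normc/= expr0n addr0 sqrtr_sqr. Qed.

Lemma geo_summ : csumm (fun n => (geo_coef n)%:C%C).
Proof.
apply: (@summ_bound _ _ _ 1) => [n|r ur]; first exact: normc_ge0.
rewrite (eq_bigr geo_coef); first exact: geo_coef_bound.
by move=> i _; rewrite normc_real ger0_norm// geo_coef_ge0.
Qed.

Definition geo : ell1 R nat := mk_ell1 geo_summ.

Lemma geo_norm : `|geo| <= 1.
Proof.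
apply: ell1_norm_le => r ur; rewrite (eq_bigr geo_coef); first exact: geo_coef_bound.
by move=> i _; rewrite mk_ell1E normc_real ger0_norm// geo_coef_ge0.
Qed.

Lemma geoE : geo = 2^-1 *: (delta R 0%N + push S geo).
Proof.
apply: ell1_eq => -[|n]; rewrite ell1Z ell1D deltaE mk_ell1E.
  rewrite push_out// addr0 mulr1 /geo_coef expr1.
  by rewrite (rmorphV (real_complex R)) ?unitfE// rmorph_nat.
rewrite push_inj; last exact: succn_inj.
rewrite mk_ell1E add0r /geo_coef exprS (rmorphM (real_complex R)).
by rewrite (rmorphV (real_complex R)) ?unitfE// rmorph_nat.
Qed.

(** The sum over n of 2^-(n+1) times [u n]. *)
Definition geosum T (u : nat -> ell1 R T) : ell1 R T := kernel_op u geo.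

Lemma geosumE T (u : nat -> ell1 R T) : bounded_family u ->
  geosum u = 2^-1 *: (u 0%N + geosum (fun n => u n.+1)).
Proof.
move=> us; rewrite {1}/geosum geoE.
rewrite (linear_funZ _ _ (kernel_op_linear us)) (linear_funD _ _ (kernel_op_linear us)).
by rewrite kernel_op_delta// kernel_op_push.
Qed.

Lemma geosum_norm T (u : nat -> ell1 R T) c : (forall n, `|u n| <= c) -> `|geosum u| <= c.
Proof.
move=> uc; have c0 : 0 <= c by exact: le_trans (uc 0%N).
apply: le_trans (kernel_op_norm geo c0 uc) _.
by rewrite -[leRHS]mulr1 ler_wpM2l// geo_norm.
Qed.

Lemma half_lt (e : R) : 0 < e -> exists n, 2^-1 ^+ n < e.
Proof.
move=> e0; have := archi_boundP (ltW (eqbRL (invr_gt0 e) e0)).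
set n := Num.bound _ => en; exists n.
rewrite exprVn invf_plt ?posrE ?exprn_gt0//.
apply: (lt_trans en); rewrite -natrX ltr_nat; exact: ltn_expl.
Qed.

(** Along a subsequence with increments at most 2^-(j+1), the rescaled increments [v] are
    bounded and the sequence telescopes, so its limit is the first term plus [geosum v]. *)
Lemma ell1_complete T (x : nat -> ell1 R T) : is_cauchy x ->
  exists l, forall e, 0 < e -> exists N, forall n, (N <= n)%N -> `|x n - l| < e.
Proof.
move=> cx.
have /choice[N xN] : forall j, exists N, forall m n, (N <= m)%N -> (N <= n)%N ->
    `|x m - x n| < 2^-1 ^+ j.+1.
  by move=> j; apply: cx; rewrite exprn_gt0// invr_gt0.
pose M j := (\max_(i < j.+1) N i)%N.
have MN j : (N j <= M j)%N by exact: (@leq_bigmax _ (fun i : 'I_j.+1 => N i) ord_max).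
have MS j : (M j <= M j.+1)%N by rewrite /M [leqRHS]big_ord_recr leq_maxl.
pose v j := 2 ^+ j.+1 *: (x (M j.+1) - x (M j)).
have v1 j : `|v j| <= 1.
  rewrite snormZ -natrX normc_nat natrX mulrC -ler_pdivlMr ?exprn_gt0//.
  by rewrite mul1r -exprVn ltW// xN//; exact: leq_trans (MN j) (MS j).
have vb n : bounded_family (fun j => v (n + j)%N) by exists 1 => j; exact: v1.
have geov n : x (M 0%N) + geosum v = x (M n) + 2^-1 ^+ n *: geosum (fun j => v (n + j)%N).
  elim: n => [|n ->]; first by rewrite expr0 scale1r.
  rewrite geosumE// addn0 !scalerDr {1}/v addrA; congr (_ + _).
    by rewrite !scalerA -exprSr -exprMn mulVf// expr1n scale1r addrC subrK.
  rewrite scalerA -exprSr; congr (_ *: geosum _).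
  by apply/funext => j; rewrite addnS addSn.
exists (x (M 0%N) + geosum v) => e e0.
have [j je] := half_lt (divr_gt0 e0 (ltr0Sn R 1)).
exists (M j) => n Mn; rewrite (geov j) opprD addrA (le_lt_trans (ler_normB _ _))//.
rewrite (splitr e) ltr_leD//.
  apply: lt_trans je; apply: lt_le_trans (xN j _ _ _ _) _ => //.
    exact: leq_trans (MN j) Mn.
  by rewrite exprS ger_pMl ?exprn_gt0 ?invr_gt0// invf_le1// ler1n.
rewrite snormZ; apply: le_trans (ltW je).
rewrite (_ : 2^-1 ^+ j = (2^-1 ^+ j)%:C%C)%C; last first.
  by rewrite (rmorphXn (real_complex R)) (rmorphV (real_complex R)) ?unitfE// rmorph_nat.
rewrite normc_real ger0_norm ?exprn_ge0 ?invr_ge0//.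
by rewrite ger_pMr ?exprn_gt0 ?invr_gt0// geosum_norm.
Qed.

End GeometricSeries.

(** * Bounded symmetric cocycles for the trivial action *)

Section Hyers.
Variables (R : realType) (P : nmodType) (T : choiceType).
Implicit Types (c : P -> P -> ell1 R T) (f : P -> ell1 R T).

(** f (n p) = n f p stays bounded as n grows. *)
Lemma bounded_additive0 f : (exists C, forall p, `|f p| <= C) ->
  {morph f : p q / p + q} -> forall p, f p = 0.
Proof.
move=> [C fC] fD p; have f0 : f 0 = 0.
  by have := fD 0 0; rewrite addr0 -[LHS]addr0 => /addrI /esym.
have fM n : f (p *+ n) = f p *+ n by elim: n => [|n IH]; rewrite ?mulr0n// !mulrS fD IH.
apply: ell1_hausdorff; apply/eqP; rewrite eq_le normr_ge0 andbT.
apply: (@archi_le0 _ _ C) => n; rewrite -snormMn -fM; exact: fC.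
Qed.

Definition symmetric_cocycle c : Prop :=
  (forall p q, c p q = c q p) /\
  (forall p q r, c p q + c (p + q) r = c q r + c p (q + r)).

Definition cob f p q : ell1 R T := f p + f q - f (p + q).

Lemma cob_cocycle f : symmetric_cocycle (cob f).
Proof.
split=> [p q|p q r]; first by rewrite /cob [f p + _]addrC [p + q]addrC.
rewrite /cob [f p + f (q + r)]addrC !addrA !subrK; congr (_ - _).
by rewrite [RHS]addrC addrA.
Qed.

Lemma symmetric_cocycleB c c' : symmetric_cocycle c -> symmetric_cocycle c' ->
  symmetric_cocycle (fun p q => c p q - c' p q).
Proof.
move=> [cC cA] [dC dA]; split=> [p q|p q r]; first by rewrite cC dC.
by rewrite addrACA -opprD cA dA [RHS]addrACA -opprD.
Qed.

(** The defect of additivity of the list p, p, q, q does not depend on the order of summation: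
    the left side sums p + p and q + q first, the right side sums p + q twice. *)
Lemma cocycle_doubling c p q : symmetric_cocycle c ->
  c p p + c q q + c (p + p) (q + q) = c p q + c p q + c (p + q) (p + q).
Proof.
move=> [cC cA].
have -> : c p p + c q q + c (p + p) (q + q) = c p p + (c (p + p) q + c (p + p + q) q).
  by rewrite cA addrA.
have -> : c p p + (c (p + p) q + c (p + p + q) q) = c p q + (c p (p + q) + c (p + p + q) q).
  by rewrite addrA cA addrA.
rewrite -[RHS]addrA; congr (_ + _); rewrite [c p (p + q)]cC [p + p + q]addrAC cA.
by [].
Qed.

(** By [cocycle_doubling], the value of such a cocycle doubles when both arguments do. *)
Lemma doubling_eq0 c C : symmetric_cocycle c -> (forall p q, `|c p q| <= C) ->
  (forall p, c p p = 0) -> forall p q, c p q = 0.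
Proof.
move=> cs cC c0; have c2 p q : c (p + p) (q + q) = c p q *+ 2.
  by have := cocycle_doubling p q cs; rewrite !c0 !add0r addr0 mulr2n.
have c2n n : forall p q, c (p *+ (2 ^ n)) (q *+ (2 ^ n)) = c p q *+ (2 ^ n).
  elim: n => // n IH p q; rewrite expnS mul2n -addnn !mulrnDr.
  by rewrite c2 IH -mulrnA muln2 -addnn mulrnDr.
move=> p q; apply: ell1_hausdorff; apply/eqP; rewrite eq_le normr_ge0 andbT.
apply: (@archi_le0 _ _ C) => n; apply: le_trans (cC (p *+ (2 ^ n)) (q *+ (2 ^ n))).
rewrite c2n snormMn ler_wpM2r// ler_nat ltnW//; exact: ltn_expl.
Qed.

(** With f p = sum_i 2^-(i+1) c (2^i p) (2^i p) one has 2 f p = c p p + f (2 p), so that the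
    cocycle c - cob f vanishes on the diagonal and [doubling_eq0] applies. *)
Lemma hyers c C : symmetric_cocycle c -> (forall p q, `|c p q| <= C) ->
  exists2 f, (forall p, `|f p| <= C) & forall p q, c p q = cob f p q.
Proof.
move=> cS cC.
pose u p i := c (p *+ (2 ^ i)) (p *+ (2 ^ i)).
have ub p : bounded_family (u p) by exists C => i; exact: cC.
pose f p := geosum (u p).
have fC p : `|f p| <= C by apply: geosum_norm => i; exact: cC.
exists f => // p q.
have f2 r : f r + f r = c r r + f (r + r).
  rewrite {1 2}/f geosumE// -mulr2n -scaler_nat scalerA mulfV// scale1r.
  congr (_ + geosum _); apply/funext => i; rewrite /u expnS mulrnA.
  by rewrite mulr2n.
pose e p q := c p q - cob f p q.
apply/eqP; rewrite -subr_eq0; apply/eqP; rewrite -/(e p q).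
apply: (@doubling_eq0 e (C + (C + C + C))).
- exact: symmetric_cocycleB cS (cob_cocycle f).
- move=> a b; rewrite /e (le_trans (ler_normB _ _))// lerD//.
  rewrite (le_trans (ler_normB _ _))// lerD// (le_trans (ler_normD _ _))// lerD//.
- by move=> a; rewrite /e /cob f2 addrK subrr.
Qed.

End Hyers.

(** * Isomorphisms of seminormed spaces *)

Section SeminormedIsomorphisms.
Variable R : realType.
Implicit Types U V W : snModType R.

Lemma sn_iso_intro V W (f : V -> W) (g : W -> V) : blin f -> bounded_map g ->
  cancel f g -> cancel g f -> sn_iso V W.
Proof.
move=> [lf bf] bg fK gK.
have lg : linear g by move=> c x y; rewrite -[LHS]fK -[RHS]fK gK lf !gK.
pose F : {linear V -> W} := HB.pack f (GRing.isLinear.Build R[i] V W *:%R f lf).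
pose G : {linear W -> V} := HB.pack g (GRing.isLinear.Build R[i] W V *:%R g lg).
by exists F, G; split.
Qed.

Lemma sn_iso_elim V W : sn_iso V W ->
  exists (f : V -> W) (g : W -> V), [/\ blin f, blin g, cancel f g & cancel g f].
Proof.
move=> [f [g [bf bg fK gK]]]; exists f, g; split=> //; split=> //.
- by move=> c x y; rewrite linearP.
- by move=> c x y; rewrite linearP.
Qed.

Lemma sn_iso_sym V W : sn_iso V W -> sn_iso W V.
Proof.
move=> /sn_iso_elim[f [g [bf bg fK gK]]].
by apply: (sn_iso_intro bg _ gK fK); exact: bf.2.
Qed.

Lemma sn_iso_trans U V W : sn_iso U V -> sn_iso V W -> sn_iso U W.
Proof.
move=> /sn_iso_elim[f [g [bf bg fK gK]]] /sn_iso_elim[f' [g' [bf' bg' fK' gK']]].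
apply: (sn_iso_intro (blin_comp bf bf') (blin_comp bg' bg).2).
- by move=> x; rewrite fK' fK.
- by move=> x; rewrite gK gK'.
Qed.

Definition complete V : Prop := forall u : nat -> V, is_cauchy u ->
  exists l, forall e, 0 < e -> exists N, forall n, (N <= n)%N -> `|u n - l| < e.

Lemma complete_is_banach V : hausdorff V -> complete V -> is_banach V.
Proof.
move=> hV cV; split=> // u /cV[l ul]; exists l.
apply/cvgrPdist_lt => e e0; have [N uN] := ul e e0.
by exists N => // n Nn; rewrite sub0r normrN ger0_norm// uN.
Qed.

Lemma blin_cauchy V W (f : V -> W) u : blin f -> is_cauchy u -> is_cauchy (fun n => f (u n)).
Proof.
move=> fb cu e e0; have [c c0 fc] := blin_bound fb.
have c1 : 0 < c + 1 by rewrite ltr_pwDr.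
have [N uN] := cu _ (divr_gt0 e0 c1); exists N => m n Nm Nn.
rewrite -(linear_funB _ _ fb.1) (le_lt_trans (fc _))//.
rewrite (@le_lt_trans _ _ ((c + 1) * `|u m - u n|))//; first by rewrite ler_wpM2r// lerDl.
by rewrite mulrC -ltr_pdivlMr// uN.
Qed.

Lemma sn_iso_hausdorff V W : sn_iso V W -> hausdorff V -> hausdorff W.
Proof.
move=> /sn_iso_elim[f [g [bf bg fK gK]]] hV x x0.
have [c c0 gc] := blin_bound bg.
have g0 : g x = 0.
  apply: hV; apply/eqP; rewrite eq_le normr_ge0 andbT.
  by rewrite (le_trans (gc x))// x0 mulr0.
by rewrite -[x]gK g0 (linear_fun0 bf.1).
Qed.

Lemma sn_iso_complete V W : sn_iso V W -> complete V -> complete W.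
Proof.
move=> /sn_iso_elim[f [g [bf bg fK gK]]] cV u cu.
have [l ul] := cV _ (blin_cauchy bg cu); exists (f l) => e e0.
have [c c0 fc] := blin_bound bf; have c1 : 0 < c + 1 by rewrite ltr_pwDr.
have [N uN] := ul _ (divr_gt0 e0 c1); exists N => n Nn.
rewrite -[u n]gK -(linear_funB _ _ bf.1) (le_lt_trans (fc _))//.
rewrite (@le_lt_trans _ _ ((c + 1) * `|g (u n) - l|))//; first by rewrite ler_wpM2r// lerDl.
by rewrite mulrC -ltr_pdivlMr// uN.
Qed.

Lemma sn_iso_infinite_dim V W : sn_iso V W -> infinite_dim V -> infinite_dim W.
Proof.
move=> /sn_iso_elim[f [g [bf bg fK gK]]] hV [n [b bP]]; apply: hV.
exists n, (fun i => g (b i)) => x; have [c xc] := bP (f x); exists c.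
rewrite -[x]fK xc (blin_sum _ _ bg.1); apply: eq_bigr => i _.
by rewrite (linear_funZ _ _ bg.1).
Qed.

Definition independent V (y : nat -> V) : Prop := forall n (c : 'I_n -> R[i]),
  \sum_i c i *: y i = 0 -> forall i, c i = 0.

(** If n vectors spanned V, the (n + 1) by n matrix of coordinates of the first n + 1 members of
    [y] would have a nonzero vector in its left kernel. *)
Lemma independent_infinite_dim V (y : nat -> V) : independent y -> infinite_dim V.
Proof.
move=> yI [n [b bP]].
have /choice[C yC] : forall j : 'I_n.+1, exists c : 'I_n -> R[i], y j = \sum_i c i *: b i.
  by move=> j; exact: bP.
pose A := \matrix_(j < n.+1, i < n) C j i.
have : kermx A != 0.
  rewrite -mxrank_eq0 mxrank_ker subn_eq0 -ltnNge.
  exact: leq_ltn_trans (rank_leq_col A) _.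
move=> /rowV0Pn[u /sub_kermxP uA]; apply/negP; rewrite negbK.
apply/eqP/rowP => j; rewrite mxE; apply: (yI n.+1 (fun j => u 0 j)).
under eq_bigr => i _ do rewrite yC scaler_sumr.
rewrite exchange_big/= big1// => i _.
under eq_bigr => l _ do rewrite scalerA.
rewrite -scaler_suml; have /matrixP/(_ 0 i) := uA.
rewrite !mxE => uAi; rewrite -[RHS](scale0r (b i)) -[in RHS]uAi; congr (_ *: _).
by apply: eq_bigr => l _; rewrite mxE.
Qed.

Lemma qsp_iso V V' (W : lsubspace V) (W' : lsubspace V') (f : V -> V') (g : V' -> V) :
  blin f -> blin g -> cancel f g -> cancel g f -> (forall x, W x <-> W' (f x)) ->
  sn_iso (qsp W) (qsp W').
Proof.
move=> bf bg fK gK fW.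
have fq x : qproj W' (f (qrepr (qproj W x))) = qproj W' (f x).
  apply/qprojP; rewrite -(linear_funB _ _ bf.1); apply/fW.
  by apply/qprojP; rewrite qreprK.
have gq x : qproj W (g (qrepr (qproj W' x))) = qproj W (g x).
  apply/qprojP; rewrite -(linear_funB _ _ bg.1); apply/fW; rewrite gK.
  by apply/qprojP; rewrite qreprK.
have [c c0 fc] := blin_bound bf; have [d d0 gd] := blin_bound bg.
apply: (@sn_iso_intro _ _ (fun q => qproj W' (f (qrepr q))) (fun q => qproj W (g (qrepr q)))).
- split.
    move=> k x y; have [x' <-] := qproj_surj x; have [y' <-] := qproj_surj y.
    by rewrite -qprojZ -qprojD !fq bf.1 qprojD qprojZ.
  exists c => q; apply: qnorm_lip => // x <-.
  by rewrite fq (le_trans (qnorm_le _ _)).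
- exists d => q; apply: qnorm_lip => // x <-.
  by rewrite gq (le_trans (qnorm_le _ _)).
- by move=> q; have [x <-] := qproj_surj q; rewrite fq gq fK.
- by move=> q; have [x <-] := qproj_surj q; rewrite gq fq gK.
Qed.

End SeminormedIsomorphisms.

(** * Finite direct sums *)

Section DirectSums.
Variables (R : realType) (k : nat).
Implicit Types V W : snModType R.

Lemma dsum_normE V (x : dsum V k) : `|x| = \sum_i `|x i|. Proof. by []. Qed.

Lemma dsum_coord V (x : dsum V k) i : `|x i| <= `|x|.
Proof. by rewrite dsum_normE (bigD1 i)//= lerDl sumr_ge0. Qed.

Lemma dsumD V (x y : dsum V k) i : (x + y) i = x i + y i.
Proof. exact: ffunE. Qed.
Lemma dsumB V (x y : dsum V k) i : (x - y) i = x i - y i.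
Proof. by rewrite dsumD; congr (_ + _); rewrite ffunE. Qed.
Lemma dsumZ V c (x : dsum V k) i : (c *: x) i = c *: x i.
Proof. exact: ffunE. Qed.

Lemma dsum_eq V (x y : dsum V k) : (forall i, x i = y i) -> x = y.
Proof. by move=> xy; apply/ffunP. Qed.

Lemma dsum_iso V W : sn_iso V W -> sn_iso (dsum V k) (dsum W k).
Proof.
move=> /sn_iso_elim[f [g [bf bg fK gK]]].
have [c c0 fc] := blin_bound bf; have [d d0 gd] := blin_bound bg.
apply: (@sn_iso_intro _ (dsum V k) (dsum W k) (fun x => [ffun i => f (x i)])
  (fun y => [ffun i => g (y i)])).
- split.
    move=> l x y; apply: dsum_eq => i.
    by rewrite dsumD dsumZ ffunE dsumD dsumZ bf.1 !ffunE.
  by exists c => x; rewrite !dsum_normE mulr_sumr ler_sum// => i _; rewrite ffunE.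
- by exists d => x; rewrite !dsum_normE mulr_sumr ler_sum// => i _; rewrite ffunE.
- by move=> x; apply: dsum_eq => i; rewrite !ffunE.
- by move=> x; apply: dsum_eq => i; rewrite !ffunE.
Qed.

Lemma dsum_hausdorff V : hausdorff V -> hausdorff (dsum V k).
Proof.
move=> hV x x0; apply: dsum_eq => i; rewrite [in RHS]ffunE; apply: hV.
by apply/eqP; rewrite eq_le normr_ge0 andbT -x0 dsum_coord.
Qed.

Lemma dsum_complete V : complete V -> complete (dsum V k).
Proof.
move=> cV u cu.
have /choice[l ul] : forall i, exists l, forall e, 0 < e -> exists N, forall n, (N <= n)%N ->
    `|u n i - l| < e.
  move=> i; apply: cV => e e0; have [N uN] := cu e e0; exists N => m n Nm Nn.
  by rewrite -dsumB (le_lt_trans (dsum_coord _ _))// uN.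
exists ([ffun i => l i] : dsum V k) => e e0.
have k1 : 0 < k.+1%:R :> R by rewrite ltr0n.
have /choice[N uN] : forall i, exists N, forall n, (N <= n)%N -> `|u n i - l i| < e / k.+1%:R.
  by move=> i; apply: ul; exact: divr_gt0.
exists (\max_i N i)%N => n Nn; rewrite dsum_normE.
apply: (@le_lt_trans _ _ (\sum_(i < k) (e / k.+1%:R))).
  apply: ler_sum => i _; rewrite dsumB ffunE ltW// uN//.
  by apply: leq_trans Nn; exact: (leq_bigmax i).
rewrite sumr_const card_ord -[_ *+ k]mulr_natr mulrAC ltr_pdivrMr// ltr_pM2l//.
by rewrite ltr_nat.
Qed.

Lemma dsum_independent V (i0 : 'I_k) (y : nat -> V) : independent y ->
  independent (fun j => [ffun i => if i == i0 then y j else 0] : dsum V k).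
Proof.
move=> yI n c cy; apply: yI.
have /esym h := congr1 (fun x : dsum V k => x i0) cy; rewrite [LHS]ffunE in h.
rewrite [RHS]h.
rewrite (big_morph (fun x : dsum V k => x i0) (fun x y => dsumD x y i0) (ffunE _ i0)).
by apply: eq_bigr => i _; rewrite dsumZ ffunE eqxx.
Qed.

End DirectSums.

(** * Vectors whose orbit under an operator decays like 1 / n *)

Section DecayingOrbits.
Variables (R : realType) (V : snModType R) (s : V -> V).
Hypothesis sb : blin s.

Lemma iter_blin n : blin (iter n s).
Proof. by elim: n => [|n IH]; [exact: blin_id|exact: blin_comp IH sb]. Qed.

Definition decay_bound (x : V) : set R := [set n.+1%:R * `|iter n s x| | n in [set: nat]].

Definition decay_norm (x : V) : R := sup (decay_bound x).

Definition decay_pred : {pred V} :=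
  fun x => `[< exists c, forall n : nat, n.+1%:R * `|iter n s x| <= c >].

Lemma decay_norm_ub x n : x \in decay_pred -> n.+1%:R * `|iter n s x| <= decay_norm x.
Proof.
move=> /asboolP[c xc]; apply: ub_le_sup; last by exists n.
by exists c => _ [m _ <-].
Qed.

Lemma decay_norm_le x c : (forall n : nat, n.+1%:R * `|iter n s x| <= c) -> decay_norm x <= c.
Proof.
by move=> xc; apply: ge_sup => [|_ [n _ <-]//]; exists (1 * `|x|), 0%N.
Qed.

Let decayD x y c d : (forall n : nat, n.+1%:R * `|iter n s x| <= c) ->
  (forall n : nat, n.+1%:R * `|iter n s y| <= d) ->
  forall n : nat, n.+1%:R * `|iter n s (x + y)| <= c + d.
Proof.
move=> xc yd n; rewrite (linear_funD _ _ (iter_blin n).1).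
by rewrite (le_trans (ler_wpM2l _ (ler_normD _ _)))// mulrDr lerD.
Qed.

Let decayZ k x c : (forall n : nat, n.+1%:R * `|iter n s x| <= c) ->
  forall n : nat, n.+1%:R * `|iter n s (k *: x)| <= normc k * c.
Proof.
move=> xc n; rewrite (linear_funZ _ _ (iter_blin n).1) snormZ mulrCA.
by rewrite ler_wpM2l// normc_ge0.
Qed.

Let decay_closed : subsemimod_closed decay_pred.
Proof.
split; first split.
- apply/asboolP; exists 0 => n.
  by rewrite (linear_fun0 (iter_blin n).1) normr0 mulr0.
- move=> x y /asboolP[c xc] /asboolP[d yd]; apply/asboolP; exists (c + d).
  exact: decayD.
- by move=> k x /asboolP[c xc]; apply/asboolP; exists (normc k * c); exact: decayZ.
Qed.

Let decay_normD : {in decay_pred &, forall x y,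
  decay_norm (x + y) <= decay_norm x + decay_norm y}.
Proof.
move=> x y xP yP; apply: decay_norm_le; apply: decayD => n; exact: decay_norm_ub.
Qed.

Let decay_normZ c : {in decay_pred, forall x, decay_norm (c *: x) <= normc c * decay_norm x}.
Proof. by move=> x xP; apply: decay_norm_le; apply: decayZ => n; exact: decay_norm_ub. Qed.

(** When z acts on V by s, these are the possible values D(z) of bounded derivations D, for
    which D(z^(n+1)) = (n + 1) z^n D(z). *)
Definition decay_space : snModType R := snspace (SnData decay_closed decay_normD decay_normZ).

Definition decay_val (x : decay_space) : V := \val x.

Lemma decay_valP (x : decay_space) n : n.+1%:R * `|iter n s (decay_val x)| <= `|x|.
Proof. exact: decay_norm_ub (valP x). Qed.

Lemma decay_le (x : decay_space) c :
  (forall n : nat, n.+1%:R * `|iter n s (decay_val x)| <= c) -> `|x| <= c.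
Proof. exact: decay_norm_le. Qed.

Lemma decay_val_inj : injective decay_val. Proof. exact: val_inj. Qed.

Lemma decay_val_linear : linear decay_val. Proof. by []. Qed.

Lemma decay_val_norm x : `|decay_val x| <= `|x|.
Proof. by have := decay_valP x 0; rewrite mul1r. Qed.

Lemma mk_decayP x : (exists c, forall n : nat, n.+1%:R * `|iter n s x| <= c) ->
  x \in decay_pred.
Proof. by move=> h; apply/asboolP. Qed.

Definition mk_decay x (h : exists c, forall n : nat, n.+1%:R * `|iter n s x| <= c) :
  decay_space := exist _ x (mk_decayP h).

Lemma mk_decayK x h : decay_val (@mk_decay x h) = x. Proof. by []. Qed.

Lemma decay_hausdorff : hausdorff V -> hausdorff decay_space.
Proof.
move=> hV x x0; apply: decay_val_inj; rewrite (linear_fun0 decay_val_linear).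
by apply: hV; apply/eqP; rewrite eq_le normr_ge0 andbT -x0 decay_val_norm.
Qed.

(** A Cauchy sequence converges in V, whose norm is the smaller one; the bounds on [u n - u p]
    for fixed n pass to the limit in p, one power of [s] at a time. *)
Lemma decay_complete : complete V -> complete decay_space.
Proof.
move=> cV u cu.
have vB x y : decay_val (x - y) = decay_val x - decay_val y by [].
have [l ul] : exists l, forall e, 0 < e -> exists N, forall n, (N <= n)%N ->
    `|decay_val (u n) - l| < e.
  apply: cV => e e0; have [N uN] := cu e e0; exists N => m n Nm Nn.
  by rewrite -vB (le_lt_trans (decay_val_norm _))// uN.
have key e : 0 < e -> exists N, forall n, (N <= n)%N ->
    forall m, m.+1%:R * `|iter m s (decay_val (u n) - l)| <= e.
  move=> e0; have [N uN] := cu e e0; exists N => n Nn m.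
  apply/ler_addgt0Pr => d d0; have [c c0 sc] := blin_bound (iter_blin m).
  have c1 : 0 < m.+1%:R * (c + 1) by rewrite mulr_gt0// ltr_pwDr.
  have [M uM] := ul _ (divr_gt0 d0 c1).
  set p := maxn N M; have Np : (N <= p)%N by rewrite leq_maxl.
  have Mp : (M <= p)%N by rewrite leq_maxr.
  have -> : decay_val (u n) - l = decay_val (u n - u p) + (decay_val (u p) - l).
    by rewrite vB addrA subrK.
  rewrite (linear_funD _ _ (iter_blin m).1).
  rewrite (le_trans (ler_wpM2l _ (ler_normD _ _)))// mulrDr lerD//.
    by rewrite (le_trans (decay_valP _ _))// ltW// uN.
  rewrite (le_trans (ler_wpM2l _ (sc _)))//.
  apply: (@le_trans _ _ (m.+1%:R * (c + 1) * `|decay_val (u p) - l|)).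
    by rewrite -mulrA ler_wpM2l// ler_wpM2r// lerDl.
  by rewrite mulrC -ler_pdivlMr// ltW// uM.
have lP : exists c, forall n : nat, n.+1%:R * `|iter n s l| <= c.
  have [N uN] := key 1 ltr01; exists (`|u N| + 1) => n.
  rewrite -[l](subKr (decay_val (u N))) (linear_funB _ _ (iter_blin n).1).
  rewrite (le_trans (ler_wpM2l _ (ler_normB _ _)))// mulrDr lerD//.
    exact: decay_valP.
  exact: uN.
exists (mk_decay lP) => e e0; have [N uN] := key _ (divr_gt0 e0 (ltr0Sn R 1)).
exists N => n Nn; apply: (@le_lt_trans _ _ (e / 2)).
  by apply: decay_le => m; rewrite vB mk_decayK uN.
by rewrite ltr_pdivrMr// ltr_pMr// ltr1n.
Qed.

End DecayingOrbits.

(** * Cochains and coboundaries in degrees 1 and 2 *)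

Section Subspaces.
Variables (R : realType) (V : snModType R) (W : lsubspace V).

Lemma subsp_val_inj : injective (@subsp_val R V W). Proof. exact: val_inj. Qed.

Lemma subsp_normE (x : subsp W) : `|x| = `|subsp_val x|. Proof. by []. Qed.
End Subspaces.

Definition mk_cocycle (R : realType) (B : normedAlg R) (M : bimod B)
    (P : forall n, lsubspace (cochain B M n)) n (phi : cochain B M n)
    (h : P n phi /\ hdelta (cfun phi) = 0) : cocycles P n :=
  exist _ phi (introT (asboolP _) h).

Lemma mk_cocycleK (R : realType) (B : normedAlg R) (M : bimod B)
    (P : forall n, lsubspace (cochain B M n)) n (phi : cochain B M n)
    (h : P n phi /\ hdelta (cfun phi) = 0) : subsp_val (mk_cocycle h) = phi.
Proof. by []. Qed.

Section LowDegreeCochains.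
Variables (R : realType) (B M : snModType R).

Definition arg1 (a : B) : 'I_1 -> B := fun=> a.
Definition arg2 (a b : B) : 'I_2 -> B := fun i => if val i == 0%N then a else b.
Definition arg3 (a b c : B) : 'I_3 -> B :=
  fun i => if val i == 0%N then a else if val i == 1%N then b else c.

Lemma arg1P (a : 'I_1 -> B) : a = arg1 (a ord0).
Proof. by apply/funext => i; rewrite (ord1 i). Qed.

Lemma arg2P (a : 'I_2 -> B) : a = arg2 (a ord0) (a ord_max).
Proof. by apply/funext => -[[|[|//]] i]; congr a; apply: val_inj. Qed.

Lemma arg3P (a : 'I_3 -> B) : a = arg3 (a ord0) (a (lift ord0 ord0)) (a ord_max).
Proof. by apply/funext => -[[|[|[|//]]] i]; congr a; apply: val_inj. Qed.

Definition ev1 (phi : cochain B M 1) (a : B) : M := cfun phi (arg1 a).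
Definition ev2 (phi : cochain B M 2) (a b : B) : M := cfun phi (arg2 a b).

Lemma cochain_bound n (phi : cochain B M n) a : `|cfun phi a| <= `|phi| * \prod_i `|a i|.
Proof. by have [_ h] := mnormP (valP phi); exact: h. Qed.

Lemma ev1_bound phi a : `|ev1 phi a| <= `|phi| * `|a|.
Proof. by have := cochain_bound phi (arg1 a); rewrite big_ord1. Qed.

Lemma ev2_bound phi a b : `|ev2 phi a b| <= `|phi| * `|a| * `|b|.
Proof.
by have := cochain_bound phi (arg2 a b); rewrite big_ord_recl big_ord1 mulrA.
Qed.

Lemma ev2_linear c (phi psi : cochain B M 2) a b :
  ev2 (c *: phi + psi) a b = c *: ev2 phi a b + ev2 psi a b.
Proof. by rewrite /ev2 cfunD cfunZ fctDE fctZE. Qed.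

Lemma ev1_blin phi : blin (ev1 phi).
Proof.
split; last by exists `|phi| => a; exact: ev1_bound.
have /asboolP[h _] := valP phi => c x y.
have := h (arg1 0) ord0 c x y.
by congr (_ = _ *: _ + _); congr (cfun phi); apply/funext => i; rewrite (ord1 i).
Qed.

Lemma ev2_bilinear phi : bounded_bilinear (ev2 phi).
Proof.
have /asboolP[h _] := valP phi.
split=> [b c x y|a c x y|]; last by exists `|phi| => a b; exact: ev2_bound.
- have := h (arg2 0 b) ord0 c x y.
  by congr (_ = _ *: _ + _); congr (cfun phi); apply/funext => -[[|[|//]] i].
- have := h (arg2 a 0) ord_max c x y.
  by congr (_ = _ *: _ + _); congr (cfun phi); apply/funext => -[[|[|//]] i].
Qed.

Lemma cochain1_ext (phi psi : cochain B M 1) : (forall a, ev1 phi a = ev1 psi a) -> phi = psi.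
Proof. by move=> h; apply: val_inj; apply/funext => a; rewrite (arg1P a); exact: h. Qed.

Lemma mk_cochain1P (f : B -> M) : blin f ->
  (fun a : 'I_1 -> B => f (a ord0)) \in @bounded_multilinear R B M 1.
Proof.
move=> fb; apply/asboolP; split=> [a i c x y|]; first by rewrite !(ord1 i) fb.1.
have [c c0 fc] := blin_bound fb; exists c; split=> // a.
by rewrite big_ord1.
Qed.

Definition mk_cochain1 (f : B -> M) (fb : blin f) : cochain B M 1 :=
  exist _ (fun a : 'I_1 -> B => f (a ord0)) (mk_cochain1P fb).

Lemma mk_cochain1E f fb a : ev1 (@mk_cochain1 f fb) a = f a. Proof. by []. Qed.

Lemma mk_cochain1_le f fb c : 0 <= c -> (forall a, `|f a| <= c * `|a|) ->
  `|@mk_cochain1 f fb| <= c.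
Proof. by move=> c0 fc; apply: mnorm_le; split=> // a; rewrite big_ord1; exact: fc. Qed.

Lemma mk_cochain2P (f : B -> B -> M) : bounded_bilinear f ->
  (fun a : 'I_2 -> B => f (a ord0) (a ord_max)) \in @bounded_multilinear R B M 2.
Proof.
move=> fb; have [fl fr _] := fb; apply/asboolP; split=> [a i c x y|].
  by case: i => -[|[|//]] i /=; [rewrite fl|rewrite fr].
have [c c0 fc] := bilinear_bound fb; exists c; split=> // a.
by rewrite big_ord_recl big_ord1 mulrA (_ : lift _ _ = ord_max)//; exact: val_inj.
Qed.

Definition mk_cochain2 (f : B -> B -> M) (fb : bounded_bilinear f) : cochain B M 2 :=
  exist _ (fun a : 'I_2 -> B => f (a ord0) (a ord_max)) (mk_cochain2P fb).

Lemma mk_cochain2E f fb a b : ev2 (@mk_cochain2 f fb) a b = f a b. Proof. by []. Qed.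

Lemma mk_cochain2_le f fb c : 0 <= c -> (forall a b, `|f a b| <= c * `|a| * `|b|) ->
  `|@mk_cochain2 f fb| <= c.
Proof.
move=> c0 fc; apply: mnorm_le; split=> // a.
rewrite big_ord_recl big_ord1 mulrA (_ : lift _ _ = ord_max); last exact: val_inj.
exact: fc.
Qed.

End LowDegreeCochains.

Section LowDegreeCoboundaries.
Variables (R : realType) (B : normedAlg R) (M : bimod B).

Definition delta1 (f : B -> M) (a b : B) : M :=
  lact a (f b) - f (na_mul a b) + ract (f a) b.

Definition delta2 (f : B -> B -> M) (a b c : B) : M :=
  lact a (f b c) - f (na_mul a b) c + f a (na_mul b c) - ract (f a b) c.

Lemma hdelta1E (phi : cochain B M 1) a b :
  hdelta (cfun phi) (arg2 a b) = delta1 (ev1 phi) a b.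
Proof.
rewrite /hdelta big_ord1 expr1 expr2 mulN1r opprK scale1r scaleN1r /delta1 /ev1.
rewrite (_ : (fun i => arg2 a b (lift ord0 i)) = arg1 b); last first.
  by apply/funext => i; rewrite (ord1 i).
rewrite (_ : hmerge ord0 (arg2 a b) = arg1 (na_mul a b)); last first.
  by apply/funext => i; rewrite (ord1 i).
rewrite (_ : (fun i => arg2 a b (lift ord_max i)) = arg1 a) //.
by apply/funext => i; rewrite (ord1 i).
Qed.

Lemma hdelta1_eq0 (phi : cochain B M 1) :
  hdelta (cfun phi) = 0 <-> forall a b, delta1 (ev1 phi) a b = 0.
Proof.
split=> [h a b|h]; first by rewrite -hdelta1E h.
by apply/funext => a; rewrite (arg2P a) hdelta1E h.
Qed.

Lemma hdelta2E (phi : cochain B M 2) a b c :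
  hdelta (cfun phi) (arg3 a b c) = delta2 (ev2 phi) a b c.
Proof.
rewrite /hdelta big_ord_recl big_ord1 expr1 /= !exprS expr0 mulr1 !mulN1r opprK.
rewrite scale1r !scaleN1r /delta2 /ev2 addrA.
rewrite (_ : (fun i => arg3 a b c (lift ord0 i)) = arg2 b c); last first.
  by apply/funext => -[[|[|//]] i].
rewrite (_ : hmerge ord0 (arg3 a b c) = arg2 (na_mul a b) c); last first.
  by apply/funext => -[[|[|//]] i].
rewrite (_ : hmerge (lift ord0 ord0) (arg3 a b c) = arg2 a (na_mul b c)); last first.
  by apply/funext => -[[|[|//]] i].
rewrite (_ : (fun i => arg3 a b c (lift ord_max i)) = arg2 a b) //.
by apply/funext => -[[|[|//]] i].
Qed.

Lemma hdelta2_eq0 (phi : cochain B M 2) :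
  hdelta (cfun phi) = 0 <-> forall a b c, delta2 (ev2 phi) a b c = 0.
Proof.
split=> [h a b c|h]; first by rewrite -hdelta2E h.
by apply/funext => a; rewrite (arg3P a) hdelta2E h.
Qed.

Lemma hdelta1_coboundary (phi : cochain B M 2) (psi : cochain B M 1) :
  cfun phi = hdelta (cfun psi) <-> forall a b, ev2 phi a b = delta1 (ev1 psi) a b.
Proof.
split=> [h a b|h]; first by rewrite /ev2 h hdelta1E.
by apply/funext => a; rewrite (arg2P a) hdelta1E -h.
Qed.

Lemma harrison1 (phi : cochain B M 1) : harrison_complex M 1 phi.
Proof. by exists phi. Qed.

(** For n = 2 and p = 1 the shuffle condition is empty, so the sum runs over both permutations. *)
Lemma shuffle2 (psi : ('I_2 -> B) -> M) a b :
  shuffle psi (arg2 a b) = psi (arg2 a b) - psi (arg2 b a).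
Proof.
rewrite /shuffle big_nat1 (eq_bigl predT); last first.
  move=> s; apply/forallP => i; apply/forallP => j; apply/implyP => /andP[ij].
  by case: i j ij => -[|[|//]] i [[|[|//]] j].
pose t : 'S_2 := tperm ord0 ord_max.
have tn1 : t != 1%g.
  by apply/eqP => /permP/(_ ord0); rewrite tpermL perm1.
rewrite (bigD1 1%g)//= (bigD1 t)//= big1; last first.
  move=> s /andP[s1 st]; exfalso.
  (* Two points have only two permutations. *)
  have u3 : uniq [:: s; t; 1%g] by rewrite /= !inE negb_or st s1 tn1.
  by have := max_card (mem [:: s; t; 1%g]); rewrite (card_uniqP u3) card_Sn.
rewrite addr0 odd_perm1 expr0 scale1r odd_tperm -val_eqE/= expr1 scaleN1r.
congr (psi _ - psi _); apply/funext => i; first by rewrite invg1 perm1.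
rewrite tpermV; case: i => -[|[|//]] i.
  by rewrite (_ : Ordinal i = ord0) ?tpermL//; exact: val_inj.
by rewrite (_ : Ordinal i = ord_max) ?tpermR//; exact: val_inj.
Qed.

(** Since mu_1 = 0 and mu_2 = 2, the projection e_2(1) = (2 - s_2) / 2 is the symmetrization. *)
Lemma harrison2 (phi : cochain B M 2) :
  harrison_complex M 2 phi <-> forall a b, ev2 phi a b = ev2 phi b a.
Proof.
have muE : harr_mu R 1 - harr_mu R 2 = - 2 :> R[i].
  rewrite /harr_mu expr1 expr2 subrr sub0r; congr (- _).
  by rewrite -[X in _ - X]mulr1 -mulrBr (_ : 2 - 1 = 1 :> R[i]) ?mulr1// addrK.
have mu2 : harr_mu R 2 = 2 :> R[i].
  by rewrite -[LHS]opprK -[in RHS](opprK 2) -muE /harr_mu expr1 subrr sub0r opprK.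
have projE (psi : cochain B M 2) a b :
    harrison_proj (cfun psi) (arg2 a b) = 2^-1 *: (ev2 psi a b + ev2 psi b a).
  rewrite /harrison_proj/= muE mu2 fctZE !fctDE shuffle2 invrN scaleNr -scalerN.
  congr (_ *: _); rewrite [(- _) _]/(- _) fctZE opprD opprB opprK addrC.
  by rewrite -/(ev2 psi a b) -/(ev2 psi b a) scaler_nat mulr2n addrA addrAC addrK.
split=> [[psi h] a b|h].
  by rewrite /ev2 h !projE addrC.
exists phi; apply/funext => a; rewrite (arg2P a) projE (h (a ord_max)).
by rewrite -mulr2n -(scaler_nat 2 (ev2 _ _ _)) scalerA mulVf// scale1r.
Qed.

End LowDegreeCoboundaries.

(** * Isomorphisms out of quotients, convolution by point masses *)

Section MoreTools.
Variable R : realType.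

(** Preimages are chosen one at a time; the map they induce into the quotient is nevertheless
    inverse to a linear map, hence linear. *)
Lemma qsp_factor (V Y : snModType R) (W : lsubspace V) (F : V -> Y) C : blin F ->
  (forall x, W x <-> F x = 0) -> (forall y, exists2 x, F x = y & `|x| <= C * `|y|) ->
  exists (f : qsp W -> Y) (g : Y -> qsp W),
    [/\ blin f, bounded_map g, cancel f g, cancel g f & forall x, f (qproj W x) = F x].
Proof.
move=> bF WF Fs; have [c c0 Fc] := blin_bound bF.
have Fq x : F (qrepr (qproj W x)) = F x.
  apply/eqP; rewrite -subr_eq0 -(linear_funB _ _ bF.1); apply/eqP/WF.
  by apply/qprojP; rewrite qreprK.
have /choice[G GP] : forall y, exists x, F x = y /\ `|x| <= C * `|y|.
  by move=> y; have [x xy xC] := Fs y; exists x.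
exists (fun q => F (qrepr q)), (fun y => qproj W (G y)); split=> //.
- split.
    move=> k x y; have [x' <-] := qproj_surj x; have [y' <-] := qproj_surj y.
    by rewrite -qprojZ -qprojD !Fq bF.1.
  by exists c => q; apply: qnorm_lip => // x <-; rewrite Fq.
- by exists C => y; rewrite (le_trans (qnorm_le _ _))// (GP y).2.
- move=> q; have [x <-] := qproj_surj q; rewrite Fq; apply/qprojP/WF.
  by rewrite (linear_funB _ _ bF.1) (GP _).1 subrr.
- by move=> y; rewrite Fq (GP _).1.
Qed.

Lemma qsp_iso_surj (V Y : snModType R) (W : lsubspace V) (F : V -> Y) C : blin F ->
  (forall x, W x <-> F x = 0) -> (forall y, exists2 x, F x = y & `|x| <= C * `|y|) ->
  sn_iso (qsp W) Y.
Proof.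
move=> bF WF Fs; have [f [g [bf bg fK gK _]]] := qsp_factor bF WF Fs.
exact: sn_iso_intro bf bg fK gK.
Qed.

Lemma sn_iso_surj (V Y : snModType R) (F : V -> Y) C : blin F ->
  (forall x, F x = 0 -> x = 0) -> (forall y, exists2 x, F x = y & `|x| <= C * `|y|) ->
  sn_iso V Y.
Proof.
move=> bF F0 Fs.
have FI x y : F x = F y -> x = y.
  move=> Fxy; apply/eqP; rewrite -subr_eq0; apply/eqP/F0.
  by rewrite (linear_funB _ _ bF.1) Fxy subrr.
have /choice[G GP] : forall y, exists x, F x = y /\ `|x| <= C * `|y|.
  by move=> y; have [x xy xC] := Fs y; exists x.
apply: (sn_iso_intro bF) => [|x|y].
- by exists C => y; exact: (GP y).2.
- by apply: FI; exact: (GP _).1.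
- exact: (GP _).1.
Qed.

Lemma bilinear_comp2 (E F G H : snModType R) (f : E -> F -> G) (g : G -> H) :
  bounded_bilinear f -> blin g -> bounded_bilinear (fun x y => g (f x y)).
Proof.
move=> fb gb; have [fl fr _] := fb; have [c c0 fc] := bilinear_bound fb.
have [d d0 gd] := blin_bound gb; split=> [y k a b|x k a b|].
- by rewrite fl gb.1.
- by rewrite fr gb.1.
- by exists (d * c) => x y; rewrite (le_trans (gd _))// -!mulrA ler_wpM2l// mulrA.
Qed.

Lemma tensor_bilinear (S T : choiceType) : bounded_bilinear (@ell1_tensor R S T).
Proof.
split; first exact: ell1_tensor_linearl; first exact: ell1_tensor_linearr.
by exists 1 => x y; rewrite mul1r ell1_tensor_norm.
Qed.

Lemma conv_delta (G : nmodType) (g : G) (x : ell1 R G) : conv (delta R g) x = push (+%R g) x.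
Proof.
apply: (@blin_ext _ _ _ (conv (delta R g)) (push (+%R g))).
- exact: ell1_hausdorff.
- exact: bilinear_blinr (conv_bilinear R G).
- exact: push_blin.
- by move=> h; rewrite delta_conv push_delta.
Qed.

Lemma push_inj_norm (S T : choiceType) (phi : S -> T) (x : ell1 R S) :
  injective phi -> `|push phi x| = `|x|.
Proof.
move=> phiI; apply/eqP; rewrite eq_le push_norm/=.
apply: le_trans (pull_norm phiI (push phi x)); rewrite le_eqVlt; apply/orP; left.
by apply/eqP; congr (`|_|); apply: ell1_eq => s; rewrite pullE push_inj.
Qed.

Lemma hausdorff_eq0 (V : snModType R) (x : V) C : hausdorff V ->
  (forall n : nat, n.+1%:R * `|x| <= C) -> x = 0.
Proof.
move=> hV h; apply: hV; apply/eqP; rewrite eq_le normr_ge0 andbT.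
apply: (@archi_le0 _ _ C) => n; apply: le_trans (h n).
by rewrite ler_wpM2r// ler_nat.
Qed.

End MoreTools.

(** * Symmetry of 2-cocycles *)

Section CoefficientIdentities.
Variable F : comNzRingType.

(** The coboundary of a coboundary: each letter is a term that occurs twice, with opposite
    signs. *)
Lemma ring_coboundary (A B C D E H : F) :
  (A - B + C) - (A - D + E) + (B - D + H) - (C - E + H) = 0.
Proof. by ring. Qed.

(** The cocycle identities at (p, q, r), (r, p, q) and (p, r, q), taken with signs +, + and -,
    express that the antisymmetric part is a derivation in the first variable. *)
Lemma ring_antisymmetry (pqr rpq qrp prq qpr apq bpq a b : F) :
  pqr - apq + a - rpq = 0 -> rpq - b + bpq - qrp = 0 -> prq - b + a - qpr = 0 ->
  apq - bpq = (pqr - prq) + (qpr - qrp).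
Proof.
move=> h1 h2 h3; apply/eqP; rewrite -subr_eq0.
rewrite (_ : _ - _ = - (pqr - apq + a - rpq) - (rpq - b + bpq - qrp) + (prq - b + a - qpr)).
  by rewrite h1 h2 h3 !oppr0 !addr0.
by ring.
Qed.

End CoefficientIdentities.

Section SymmetryOfCocycles.
Variables (R : realType) (P : nmodType).
Hypothesis P_cancel : forall p : P, injective (+%R p).
Let B := ell1_alg R P.
Let M := regular_bimod B.
Local Notation d := (@delta R P).

Lemma lact_delta p (x : M) : lact (d p : B) x = push (+%R p) x.
Proof. exact: conv_delta. Qed.

Lemma ract_delta p (x : M) : ract x (d p : B) = push (+%R p) x.
Proof. by rewrite -lact_delta; exact: convC. Qed.

Lemma mul_delta p q : na_mul (d p : B) (d q : B) = d (p + q).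
Proof. exact: delta_conv. Qed.

Lemma delta2_delta (f : B -> B -> M) p q r : delta2 f (d p) (d q) (d r) =
  push (+%R p) (f (d q) (d r)) - f (d (p + q)) (d r) + f (d p) (d (q + r)) -
  push (+%R r) (f (d p) (d q)).
Proof. by rewrite /delta2 lact_delta ract_delta !mul_delta. Qed.

Variable phi : cochain B M 2.
Hypothesis phi_cocycle : hdelta (cfun phi) = 0.

Let psi p q : ell1 R P := ev2 phi (d p) (d q).
Let alpha p q := psi p q - psi q p.

Lemma cocycle_deltaE p q r :
  push (+%R p) (psi q r) - psi (p + q) r + psi p (q + r) - push (+%R r) (psi p q) = 0
  :> ell1 R P.
Proof. by rewrite -[LHS](delta2_delta (ev2 phi)); apply: (hdelta2_eq0 phi).1. Qed.

Let alphaD p q r : alpha (p + q) r = push (+%R p) (alpha q r) + push (+%R q) (alpha p r).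
Proof.
rewrite /alpha !(linear_funB _ _ (push_linear _)); apply: ell1_eq => t.
have /(congr1 (fun x => ell1_fun x t)) := cocycle_deltaE p q r.
have /(congr1 (fun x => ell1_fun x t)) := cocycle_deltaE r p q.
have /(congr1 (fun x => ell1_fun x t)) := cocycle_deltaE p r q.
rewrite [r + p]addrC [r + q]addrC !(ell1D, ell1N, ell10) => h3 h2 h1.
exact: ring_antisymmetry h1 h2 h3.
Qed.

Let alphaM p q n : alpha (p *+ n.+1) q = push (+%R (p *+ n)) (alpha p q) *+ n.+1.
Proof.
elim: n => [|n IH].
  by rewrite mulr0n !mulr1n -[LHS]push_id; apply: eq_push => x; rewrite add0r.
rewrite mulrS alphaD IH [RHS]mulrSr; congr (_ + _).
rewrite -scaler_nat (linear_funZ _ _ (push_linear _)) push_comp scaler_nat.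
by congr (_ *+ _); apply: eq_push => x; rewrite mulrS addrA.
Qed.

(** The antisymmetric part [alpha] is a derivation in the first variable, so that [alpha] at n p
    is n times a translate of [alpha] at p. Translations being isometric, this is bounded in n
    only if [alpha] vanishes. *)
Lemma cocycle_symmetric a b : ev2 phi a b = ev2 phi b a.
Proof.
apply: (bilin_ext (f := ev2 phi) (g := fun a b => ev2 phi b a)).
- exact: ell1_hausdorff.
- exact: bilinear_separately (ev2_bilinear phi).
- exact: bilinear_separately (bilinear_flip (ev2_bilinear phi)).
move=> p q; apply/eqP; rewrite -subr_eq0; apply/eqP.
apply: (@hausdorff_eq0 _ _ _ (`|phi| + `|phi|)) => [|n]; first exact: ell1_hausdorff.
rewrite -[X in _ * `|X|]/(alpha p q) -(push_inj_norm (alpha p q) (@P_cancel (p *+ n))).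
rewrite -snormMn -alphaM (le_trans (ler_normB _ _))// lerD//.
- by rewrite (le_trans (ev2_bound _ _ _))// !delta_norm !mulr1.
- by rewrite (le_trans (ev2_bound _ _ _))// !delta_norm !mulr1.
Qed.

End SymmetryOfCocycles.

Section HochschildIsHarrison.
Variables (R : realType) (P : nmodType).
Hypothesis P_cancel : forall p : P, injective (+%R p).
Let M := regular_bimod (ell1_alg R P).

Lemma hochH_harH_iso : sn_iso (hochH M 2) (harH M 2).
Proof.
have tohar (z : hochZ M 2) :
    harrison_complex M 2 (subsp_val z) /\ hdelta (cfun (subsp_val z)) = 0.
  have [_ dz] := subsp_valP z; split=> //.
  by apply/harrison2 => a b; exact: cocycle_symmetric.
have tohoch (z : cocycles (harrison_complex M) 2) :
    whole_complex M 2 (subsp_val z) /\ hdelta (cfun (subsp_val z)) = 0.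
  by have [_ dz] := subsp_valP z.
rewrite /hochH /harH /cohomology.
apply: (@qsp_iso _ _ _ _ _ (fun z => mk_cocycle (tohar z))
  (fun z => mk_cocycle (tohoch z))).
- split.
    move=> c x y; apply: subsp_val_inj; rewrite [RHS]subsp_valD [X in _ = X + _]subsp_valZ.
    by rewrite !mk_cocycleK subsp_valD subsp_valZ.
  by exists 1 => z; rewrite mul1r.
- split.
    move=> c x y; apply: subsp_val_inj; rewrite [RHS]subsp_valD [X in _ = X + _]subsp_valZ.
    by rewrite !mk_cocycleK subsp_valD subsp_valZ.
  by exists 1 => z; rewrite mul1r.
- by move=> z; apply: subsp_val_inj.
- by move=> z; apply: subsp_val_inj.
- move=> z; split=> -[psi _ h]; exists psi => //; exact: harrison1.
Qed.

End HochschildIsHarrison.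

(** * Cocycle identities tested on point masses *)

Section DensityForCoboundaries.
Variables (R : realType) (G : nmodType).
Let B := ell1_alg R G.
Variable M : bimod B.
Hypothesis hM : hausdorff M.
Local Notation d := (@delta R G).

Lemma mul_blinl (b : B) : blin (fun a : B => na_mul a b).
Proof. exact: bilinear_blinl (@na_mul_bilinear R B). Qed.

Lemma mul_blinr (a : B) : blin (fun b : B => na_mul a b).
Proof. exact: bilinear_blinr (@na_mul_bilinear R B). Qed.

Lemma lact_blinl (x : M) : blin (fun a : B => lact a x).
Proof. exact: bilinear_blinl (@lact_bilinear R B M). Qed.

Lemma lact_blinr (a : B) : blin (fun x : M => lact a x).
Proof. exact: bilinear_blinr (@lact_bilinear R B M). Qed.

Lemma ract_blinl (b : B) : blin (fun x : M => ract x b).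
Proof. exact: bilinear_blinl (@ract_bilinear R B M). Qed.

Lemma ract_blinr (x : M) : blin (fun b : B => ract x b).
Proof. exact: bilinear_blinr (@ract_bilinear R B M). Qed.

Lemma delta1_blinl (f : B -> M) b : blin f -> blin (fun a => delta1 f a b).
Proof.
move=> fb; apply: blinD; first apply: blinB.
- exact: lact_blinl.
- exact: blin_comp (mul_blinl b) fb.
- exact: blin_comp fb (ract_blinl b).
Qed.

Lemma delta1_blinr (f : B -> M) a : blin f -> blin (delta1 f a).
Proof.
move=> fb; apply: blinD; first apply: blinB.
- exact: blin_comp fb (lact_blinr a).
- exact: blin_comp (mul_blinr a) fb.
- exact: ract_blinr.
Qed.

Lemma delta1_separately (f : B -> M) : blin f -> separately_blin (delta1 f).
Proof. by move=> fb; split=> ?; [exact: delta1_blinl|exact: delta1_blinr]. Qed.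

Lemma delta1_ext0 (f : B -> M) : blin f -> (forall p q, delta1 f (d p) (d q) = 0) ->
  forall a b, delta1 f a b = 0.
Proof.
move=> fb f0 a b.
apply: (@blin_delta0 _ _ _ (fun a => delta1 f a b)) => //; first exact: delta1_blinl.
move=> p; apply: (@blin_delta0 _ _ _ (delta1 f (d p))) => //; exact: delta1_blinr.
Qed.

Lemma delta2_ext0 (f : B -> B -> M) : bounded_bilinear f ->
  (forall p q r, delta2 f (d p) (d q) (d r) = 0) -> forall a b c, delta2 f a b c = 0.
Proof.
move=> fb f0 a b c.
have fl y : blin (fun x => f x y) by exact: bilinear_blinl fb.
have fr x : blin (f x) by exact: bilinear_blinr fb.
apply: (@blin_delta0 _ _ _ (fun a => delta2 f a b c)) => //.
  apply: blinB; first apply: blinD; first apply: blinB.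
  - exact: lact_blinl.
  - exact: blin_comp (mul_blinl b) (fl c).
  - exact: fl.
  - exact: blin_comp (fl b) (ract_blinl c).
move=> p; apply: (@blin_delta0 _ _ _ (fun b => delta2 f (d p) b c)) => //.
  apply: blinB; first apply: blinD; first apply: blinB.
  - exact: blin_comp (fl c) (lact_blinr _).
  - exact: blin_comp (mul_blinr _) (fl c).
  - exact: blin_comp (mul_blinl c) (fr _).
  - exact: blin_comp (fr _) (ract_blinl c).
move=> q; apply: (@blin_delta0 _ _ _ (fun c => delta2 f (d p) (d q) c)) => //.
apply: blinB; first apply: blinD; first apply: blinB.
- exact: blin_comp (fr _) (lact_blinr _).
- exact: fr.
- exact: blin_comp (mul_blinr _) (fr _).
- exact: ract_blinr.
Qed.

End DensityForCoboundaries.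

Definition lattice (k : nat) : zmodType := {ffun 'I_k -> int}.

(** * The lattice Z^k and the positive cone *)

Section Lattice.
Variables (R : realType) (k : nat).
Notation P := (multi k).
Notation G := (lattice k).
Implicit Types (p q : P) (u v : G) (x y : ell1 R G).

Definition toG p : G := [ffun i => Posz (p i)].

Lemma toGE p i : toG p i = Posz (p i). Proof. exact: ffunE. Qed.

Lemma latD u v i : (u + v) i = u i + v i. Proof. exact: ffunE. Qed.
Lemma multiD p q i : (p + q) i = (p i + q i)%N. Proof. exact: ffunE. Qed.

Lemma toG_inj : injective toG.
Proof. by move=> p q /ffunP pq; apply/ffunP => i; have := pq i; rewrite !toGE => -[]. Qed.

Lemma toGD p q : toG (p + q) = toG p + toG q.
Proof. by apply/ffunP => i; rewrite latD !toGE multiD PoszD. Qed.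

Lemma toG0 : toG 0 = 0.
Proof. by apply/ffunP => i; rewrite toGE !ffunE. Qed.

Lemma multi_cancel p : injective (+%R p).
Proof.
move=> q r /ffunP h; apply/ffunP => i; have := h i.
by rewrite !multiD => /addnI.
Qed.

Definition unitv (i : 'I_k) : P := [ffun j => (j == i) : nat].

Lemma unitvE i j : unitv i j = (j == i). Proof. exact: ffunE. Qed.

Lemma multi_ind (C : P -> Prop) : C 0 -> (forall i, C (unitv i)) ->
  (forall p q, C p -> C q -> C (p + q)) -> forall p, C p.
Proof.
move=> C0 C1 CD p; rewrite (_ : p = \sum_i unitv i *+ p i).
  elim/big_ind: _ => // i _; elim: (p i) => [|n IH]; first by rewrite mulr0n.
  by rewrite mulrS; exact: CD.
apply/ffunP => j; rewrite (big_morph (fun q : P => q j) (fun q r => multiD q r j) (ffunE _ j)).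
rewrite (bigD1 j)//= big1 => [|i ij].
  have uM n : (unitv j *+ n) j = n.
    by elim: n => [|n IH]; rewrite ?mulr0n ?ffunE// mulrS multiD IH unitvE eqxx.
  by rewrite uM addn0.
elim: (p i) => [|n IH]; first by rewrite mulr0n ffunE.
by rewrite mulrS multiD IH unitvE eq_sym (negbTE ij).
Qed.

Definition translate v x : ell1 R G := push (+%R v) x.

Lemma translateE v x u : ell1_fun (translate v x) u = ell1_fun x (u - v).
Proof.
rewrite /translate (@push_bij _ _ _ _ (fun u => u - v))// => w; first by rewrite addrC addKr.
by rewrite addrC subrK.
Qed.

Lemma translate_blin v : blin (translate v). Proof. exact: push_blin. Qed.

Lemma translate_norm v x : `|translate v x| = `|x|.
Proof. by apply: push_inj_norm; exact: addrI. Qed.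

Lemma translateD u v x : translate u (translate v x) = translate (u + v) x.
Proof. by rewrite /translate push_comp; apply: eq_push => w; rewrite addrA. Qed.

Lemma translate0 x : translate 0 x = x.
Proof. by rewrite -[RHS]push_id; apply: eq_push => w; rewrite add0r. Qed.

Definition embP : ell1 R P -> ell1 R G := push toG.
Definition resP : ell1 R G -> ell1 R P := pull toG_inj.

Lemma embP_blin : blin embP. Proof. exact: push_blin. Qed.
Lemma resP_blin : blin resP. Proof. exact: pull_blin. Qed.

Lemma embPK : cancel embP resP.
Proof. by move=> x; apply: ell1_eq => p; rewrite pullE push_inj//; exact: toG_inj. Qed.

Lemma embP_push p (z : ell1 R P) : embP (push (+%R p) z) = translate (toG p) (embP z).
Proof. by rewrite /embP /translate !push_comp; apply: eq_push => q; rewrite toGD. Qed.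

(** The part of [x] off the cone P: the canonical representative of its class modulo ell1 P. *)
Definition negpart x : ell1 R G := x - embP (resP x).

Lemma negpart_blin : blin negpart.
Proof. by apply: blinB; [exact: blin_id|exact: blin_comp resP_blin embP_blin]. Qed.

Lemma negpart_embP z : negpart (embP z) = 0.
Proof. by rewrite /negpart embPK subrr. Qed.

Lemma negpart_eq0 x : negpart x = 0 -> x = embP (resP x).
Proof. by move=> /eqP; rewrite subr_eq0 => /eqP. Qed.

Lemma negpart_toG x p : ell1_fun (negpart x) (toG p) = 0.
Proof.
rewrite ell1B /embP push_inj; last exact: toG_inj.
by rewrite pullE subrr.
Qed.

Lemma negpart_out x u i : u i < 0 -> ell1_fun (negpart x) u = ell1_fun x u.
Proof.
move=> ui; rewrite ell1B push_out ?subr0// => p; apply/eqP => pu.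
by rewrite -pu toGE in ui.
Qed.

Lemma lattice_cases u : (exists p, u = toG p) \/ exists i, u i < 0.
Proof.
case: (pselect (exists i, u i < 0)) => [|h]; first by right.
left; exists [ffun i => `|u i|%N]; apply/ffunP => i; rewrite toGE ffunE gez0_abs//.
by rewrite leNgt; apply/negP => ui; apply: h; exists i.
Qed.

Lemma negpart_norm x : `|negpart x| <= `|x|.
Proof.
apply: ell1_dom => u; have [[p ->]|[i ui]] := lattice_cases u.
  by rewrite negpart_toG normc0 normc_ge0.
by rewrite (negpart_out _ ui).
Qed.

Lemma negpart_idem x : negpart (negpart x) = negpart x.
Proof.
rewrite -[X in negpart X = _]/(x - embP (resP x)) (linear_funB _ _ negpart_blin.1).
by rewrite negpart_embP subr0.
Qed.

(** Translation by a point of P maps ell1 P to itself. *)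
Lemma negpart_translate p x :
  negpart (translate (toG p) (negpart x)) = negpart (translate (toG p) x).
Proof.
rewrite -[X in negpart (translate _ X) = _]/(x - embP (resP x)).
rewrite (linear_funB _ _ (translate_blin _).1) -embP_push.
by rewrite (linear_funB _ _ negpart_blin.1) negpart_embP subr0.
Qed.

Lemma negpart_translate_norm p x : `|negpart (translate (toG p) x)| <= `|negpart x|.
Proof. by rewrite -negpart_translate (le_trans (negpart_norm _))// translate_norm. Qed.

End Lattice.

(** * Primitives of cocycles in ell1 of the lattice *)

Section Primitives.
Variables (R : realType) (k : nat).
Notation P := (multi k).
Notation G := (lattice k).
Let B := ellNk R k.
Let M := regular_bimod B.
Local Notation d := (@delta R P).
Implicit Types (f g : P -> ell1 R G) (phi : cochain B M 2).

(** The coboundary of [f], as a cochain with values in the bimodule ell1 G, evaluated at point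
    masses. *)
Definition twisted_cob f p q : ell1 R G :=
  translate (toG p) (f q) - f (p + q) + translate (toG q) (f p).

Definition primitive phi f : Prop :=
  (exists C, forall p, `|f p| <= C) /\
  forall p q, embP (ev2 phi (d p) (d q)) = twisted_cob f p q.

Lemma ev2_delta_norm phi p q : `|ev2 phi (d p) (d q)| <= `|phi|.
Proof. by rewrite (le_trans (ev2_bound _ _ _))// !delta_norm !mulr1. Qed.

(** Translating by -(p + q) turns the cocycle into one for the trivial action, to which [hyers]
    applies; this is where the negative exponents of ell1 G are needed. *)
Lemma primitive_exists phi : hdelta (cfun phi) = 0 ->
  exists2 f, primitive phi f & forall p, `|f p| <= `|phi|.
Proof.
move=> dphi; pose c p q := translate (- toG (p + q)) (embP (ev2 phi (d p) (d q))).
have cC p q : `|c p q| <= `|phi|.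
  by rewrite translate_norm (le_trans (push_norm _ _))// ev2_delta_norm.
have cs : symmetric_cocycle c.
  split=> [p q|p q r].
    rewrite /c [p + q]addrC; congr (translate _ (embP _)).
    by apply: cocycle_symmetric dphi _ _ => p'; exact: multi_cancel.
  have := congr1 (fun x => translate (- toG (p + q + r)) (embP x)) (cocycle_deltaE dphi p q r).
  rewrite /= (linear_fun0 (embP_blin _ _).1) (linear_fun0 (translate_blin _ _).1).
  rewrite !(linear_funD _ _ (embP_blin _ _).1) !(linear_funN _ (embP_blin _ _).1).
  rewrite !(linear_funD _ _ (translate_blin _ _).1) !(linear_funN _ (translate_blin _ _).1).
  rewrite !embP_push !translateD /c.
  rewrite (_ : - toG (p + q + r) + toG p = - toG (q + r)); last first.
    by rewrite -addrA toGD opprD addrAC addNr add0r.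
  rewrite (_ : - toG (p + q + r) + toG r = - toG (p + q)); last first.
    by rewrite toGD opprD -addrA addNr addr0.
  rewrite [p + (q + r)]addrA => /eqP; rewrite subr_eq0 => /eqP <-.
  by rewrite [LHS]addrAC subrK.
have [f fC cf] := hyers cs cC.
exists (fun p => translate (toG p) (f p)) => [|p]; last by rewrite translate_norm.
split=> [|p q]; first by exists `|phi| => p; rewrite translate_norm.
have := cf p q; rewrite /c => /(congr1 (translate (toG (p + q)))).
rewrite translateD addrN translate0 => ->; rewrite /cob /twisted_cob.
rewrite (linear_funB _ _ (translate_blin _ _).1) (linear_funD _ _ (translate_blin _ _).1).
rewrite !translateD toGD.
by rewrite [toG q + toG p]addrC [RHS]addrAC; congr (_ - _); exact: addrC.
Qed.

Lemma twisted_cob_linear c f g p q :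
  twisted_cob (fun r => c *: f r + g r) p q = c *: twisted_cob f p q + twisted_cob g p q.
Proof.
rewrite /twisted_cob !(translate_blin _ _).1 opprD [X in X + _ = _]addrACA [LHS]addrACA.
by rewrite scalerDr scalerBr.
Qed.

Lemma twisted_cob_cocycle f p q r :
  translate (toG p) (twisted_cob f q r) - twisted_cob f (p + q) r + twisted_cob f p (q + r)
  - translate (toG r) (twisted_cob f p q) = 0.
Proof.
rewrite /twisted_cob !(linear_funD _ _ (translate_blin _ _).1).
rewrite !(linear_funN _ (translate_blin _ _).1).
rewrite !translateD -!toGD [p + (q + r)]addrA [r + p]addrC [r + q]addrC.
apply: ell1_eq => t; rewrite !(ell1D, ell1N, ell10); exact: ring_coboundary.
Qed.

(** The difference, translated back by -p, is additive and bounded, hence zero by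
    [bounded_additive0]. *)
Lemma primitive_unique phi f g : primitive phi f -> primitive phi g -> forall p, f p = g p.
Proof.
move=> [[C fC] fP] [[D gD] gP] p.
pose h r := translate (- toG r) (f r - g r).
apply/eqP; rewrite -subr_eq0; apply/eqP.
rewrite -[LHS]translate0 -(addrN (toG p)) -translateD -/(h p).
rewrite (bounded_additive0 (f := h)) ?(linear_fun0 (translate_blin _ _).1)//.
  exists (C + D) => r; rewrite translate_norm (le_trans (ler_normB _ _))//.
  by rewrite lerD.
move=> q r.
have fg : twisted_cob (fun s => -1 *: g s + f s) q r = 0.
  by rewrite twisted_cob_linear -fP -gP scaleN1r addNr.
have hE s : h s = translate (- toG s) (-1 *: g s + f s) by rewrite /h scaleN1r addrC.
have := congr1 (translate (- toG (q + r))) fg; rewrite (linear_fun0 (translate_blin _ _).1).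
rewrite /twisted_cob (linear_funD _ _ (translate_blin _ _).1).
rewrite (linear_funB _ _ (translate_blin _ _).1).
have e1 : - toG (q + r) + toG q = - toG r by rewrite toGD opprD addrAC addNr add0r.
have e2 : - toG (q + r) + toG r = - toG q by rewrite toGD opprD -addrA addNr addr0.
rewrite !translateD e1 e2 -!hE => /eqP; rewrite addrAC subr_eq0 => /eqP <-.
by rewrite addrC.
Qed.

Lemma primitive_linear c phi psi f g : primitive phi f -> primitive psi g ->
  primitive (c *: phi + psi) (fun p => c *: f p + g p).
Proof.
move=> [[C fC] fP] [[D gD] gP]; split=> [|p q].
  exists (normc c * C + D) => p; rewrite (le_trans (ler_normD _ _))// snormZ lerD//.
  by rewrite ler_wpM2l// normc_ge0.
have -> : ev2 (c *: phi + psi) (d p) (d q) =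
  c *: (ev2 phi (d p) (d q) : ell1 R P) + ev2 psi (d p) (d q) by exact: ev2_linear.
by rewrite (embP_blin _ _).1 fP gP twisted_cob_linear.
Qed.

(** If the cocycle is the coboundary of [chi] over ell1 P, then [chi] is its primitive, by
    uniqueness. Conversely a primitive with values in ell1 P extends linearly to a 1-cochain. *)
Lemma coboundary_primitive phi f : primitive phi f ->
  is_coboundary (harrison_complex M) phi <-> forall p, negpart (f p) = 0.
Proof.
move=> fprim; have [[C fC] fP] := fprim; split=> [[chi _ /hdelta1_coboundary chiE] p|f0].
  have cprim : primitive phi (fun p => embP (ev1 chi (d p))).
    split.
      exists `|chi| => q; rewrite (le_trans (push_norm _ _))// (le_trans (ev1_bound _ _))//.
      by rewrite delta_norm mulr1.
    move=> q r; rewrite chiE /delta1 lact_delta ract_delta mul_delta.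
    rewrite (linear_funD _ _ (embP_blin _ _).1) (linear_funB _ _ (embP_blin _ _).1).
    by rewrite !embP_push.
  by rewrite (primitive_unique fprim cprim) negpart_embP.
have ub : bounded_family (fun p => resP (f p)).
  by exists C => p; rewrite (le_trans (pull_norm _ _)).
have kb : blin (kernel_op (fun p => resP (f p)) : B -> M) by exact: kernel_op_blin.
exists (mk_cochain1 kb); first exact: harrison1.
apply/hdelta1_coboundary => a b.
apply: (bilin_ext (f := ev2 phi) (g := delta1 (ev1 (mk_cochain1 kb)))).
- exact: ell1_hausdorff.
- exact: bilinear_separately (ev2_bilinear phi).
- exact: delta1_separately (ev1_blin _).
move=> p q; apply: (can_inj (@embPK R k)).
rewrite fP /delta1 lact_delta ract_delta mul_delta !mk_cochain1E.
rewrite (linear_funD _ _ (embP_blin _ _).1) (linear_funB _ _ (embP_blin _ _).1).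
by rewrite !embP_push !kernel_op_delta// -!negpart_eq0.
Qed.

(** Modulo ell1 P, where the cocycle takes its values, its primitive is a derivation. *)
Lemma primitive_negpartD phi f p q : primitive phi f ->
  negpart (f (p + q)) = negpart (translate (toG p) (f q)) + negpart (translate (toG q) (f p)).
Proof.
move=> [_ fP]; have := negpart_embP (ev2 phi (d p) (d q)).
rewrite fP /twisted_cob (linear_funD _ _ (negpart_blin _ _).1).
rewrite (linear_funB _ _ (negpart_blin _ _).1) addrAC => /eqP.
by rewrite subr_eq0 => /eqP <-.
Qed.

Lemma primitive_negpartM phi f p n : primitive phi f ->
  negpart (f (p *+ n.+1)) = negpart (translate (toG (p *+ n)) (f p)) *+ n.+1.
Proof.
move=> fprim; elim: n => [|n IH]; first by rewrite mulr0n toG0 translate0 !mulr1n.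
rewrite mulrS (primitive_negpartD _ _ fprim) [RHS]mulrSr; congr (_ + _).
rewrite -negpart_translate IH (linear_funMn _ _ (translate_blin _ _).1).
by rewrite (linear_funMn _ _ (negpart_blin _ _).1) negpart_translate translateD -toGD -mulrS.
Qed.

End Primitives.

(** * Tails: the coefficients with one negative coordinate *)

Section Tails.
Variables (R : realType) (T : choiceType).

Definition tsucc (x : nat * T) : nat * T := (x.1.+1, x.2).

Lemma tsucc_inj : injective tsucc.
Proof. by move=> [m t] [n u] [-> ->]. Qed.

(** The action of z on the tensor product of Q with ell1 T, the pair (m, t) standing for the
    class of z^(-1-m) tensored with t; the layer m = 0 is sent to z^0, which is zero in Q. *)
Definition tshift : ell1 R (nat * T)%type -> ell1 R (nat * T)%type := pull tsucc_inj.

Lemma tshift_blin : blin tshift. Proof. exact: pull_blin. Qed.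

Lemma tshift_delta0 t : tshift (delta R (0%N, t)) = 0.
Proof. by apply: ell1_eq => -[m u]; rewrite pullE deltaE xpair_eqE ell10. Qed.

Lemma tshift_deltaS m t : tshift (delta R (m.+1, t)) = delta R (m, t).
Proof. by apply: ell1_eq => -[n u]; rewrite pullE !deltaE !xpair_eqE. Qed.

Definition tails : snModType R := decay_space tshift_blin.

End Tails.

Section Restriction.
Variables (R : realType) (k : nat).
Notation P := (multi k.+1).
Notation G := (lattice k.+1).
Notation T := (multi k).
Notation V := (ell1 R (nat * T)%type).
Implicit Types (i : 'I_k.+1) (x : nat * T).

(** These points, with the i-th as their only negative coordinate, are those off P that the
    multiples of e_i bring into P. *)
Definition tail_point i x : G :=
  [ffun j => if unlift i j is Some l then Posz (x.2 l) else Negz x.1].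

Lemma tail_point_self i x : tail_point i x i = Negz x.1.
Proof. by rewrite ffunE unlift_none. Qed.

Lemma tail_point_lift i x l : tail_point i x (lift i l) = Posz (x.2 l).
Proof. by rewrite ffunE liftK. Qed.

Lemma tail_point_inj i : injective (tail_point i).
Proof.
move=> [m t] [n u] /ffunP h; congr pair.
  by have := h i; rewrite !tail_point_self => -[].
by apply/ffunP => l; have := h (lift i l); rewrite !tail_point_lift => -[].
Qed.

Lemma tail_point_ext i (u v : G) : u i = v i -> (forall l, u (lift i l) = v (lift i l)) -> u = v.
Proof.
move=> h hl; apply/ffunP => j; case: (unliftP i j) => [l ->|->//]; exact: hl.
Qed.

Lemma toG_unitv_self i : toG (unitv i) i = 1.
Proof. by rewrite toGE unitvE eqxx. Qed.

Lemma toG_unitv_lift i l : toG (unitv i) (lift i l) = 0.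
Proof. by rewrite toGE unitvE eq_sym (negbTE (neq_lift i l)). Qed.

Lemma tail_point_tsucc i x : toG (unitv i) + tail_point i (tsucc x) = tail_point i x.
Proof.
apply: (@tail_point_ext i) => [|l]; rewrite latD.
  by rewrite !tail_point_self toG_unitv_self !NegzE intS opprD addrA subrr add0r.
by rewrite !tail_point_lift toG_unitv_lift add0r.
Qed.

Lemma tail_point_boundary i t : exists p : P, toG (unitv i) + tail_point i (0%N, t) = toG p.
Proof.
exists [ffun j => if unlift i j is Some l then t l else 0%N].
apply: (@tail_point_ext i) => [|l]; rewrite latD.
  by rewrite tail_point_self toG_unitv_self toGE ffunE unlift_none.
by rewrite tail_point_lift toG_unitv_lift add0r toGE ffunE liftK.
Qed.

Lemma tail_point_cases i (u : G) : u i < 0 ->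
  (exists x, u = tail_point i x) \/ exists2 j, j != i & u j < 0.
Proof.
move=> ui; case: (pselect (exists2 j, j != i & u j < 0)) => [|h]; first by right.
left; exists (`|u i|%N.-1, [ffun l => `|u (lift i l)|%N]).
apply: (@tail_point_ext i) => [|l].
  by rewrite tail_point_self /=; case: (u i) ui.
rewrite tail_point_lift ffunE gez0_abs// leNgt; apply/negP => ul.
by apply: h; exists (lift i l) => //; rewrite eq_sym neq_lift.
Qed.

Definition tail_restr i : ell1 R G -> V := pull (@tail_point_inj i).
Definition tail_ext i : V -> ell1 R G := push (tail_point i).

Lemma tail_restr_blin i : blin (tail_restr i). Proof. exact: pull_blin. Qed.
Lemma tail_ext_blin i : blin (tail_ext i). Proof. exact: push_blin. Qed.

Lemma tail_extK i : cancel (tail_ext i) (tail_restr i).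
Proof. by move=> y; apply: ell1_eq => x; rewrite pullE push_inj//; exact: tail_point_inj. Qed.

Lemma tail_restr_negpart i y : tail_restr i (negpart y) = tail_restr i y.
Proof.
by apply: ell1_eq => x; rewrite !pullE (@negpart_out _ _ _ _ i)// tail_point_self.
Qed.

Lemma tail_restr_translate1 i y :
  tail_restr i (translate (toG (unitv i)) y) = tshift (tail_restr i y).
Proof.
apply: ell1_eq => x; rewrite !pullE translateE -(tail_point_tsucc i x).
by rewrite [_ + tail_point _ _]addrC addrK.
Qed.

Lemma tail_restr_translate i n y :
  tail_restr i (translate (toG (unitv i *+ n)) y) = iter n (@tshift R T) (tail_restr i y).
Proof.
elim: n => [|n IH]; first by rewrite mulr0n toG0 translate0.
by rewrite mulrS toGD -translateD tail_restr_translate1 IH.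
Qed.

(** The translation carries the layer m = 0 into P, where [negpart] kills it. *)
Lemma negpart_tail_ext1 i (y : V) :
  negpart (translate (toG (unitv i)) (tail_ext i y)) = tail_ext i (tshift y).
Proof.
apply: (@blin_ext _ _ _ (fun y => negpart (translate (toG (unitv i)) (tail_ext i y)))
  (fun y => tail_ext i (tshift y))).
- exact: ell1_hausdorff.
- exact: blin_comp (blin_comp (tail_ext_blin i) (translate_blin _ _)) (negpart_blin _ _).
- exact: blin_comp (tshift_blin R _) (tail_ext_blin i).
move=> [[|m] t]; rewrite /tail_ext /translate !push_delta.
  rewrite tshift_delta0 (linear_fun0 (push_linear _)).
  by have [p ->] := tail_point_boundary i t; rewrite -push_delta negpart_embP.
rewrite tshift_deltaS push_delta (tail_point_tsucc i (m, t)) /negpart.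
rewrite (_ : resP _ = 0) ?(linear_fun0 (embP_blin _ _).1) ?subr0//.
apply: ell1_eq => p; rewrite pullE deltaE ell10; case: eqP => // /(congr1 (fun u : G => u i)).
by rewrite toGE tail_point_self.
Qed.

Lemma negpart_tail_ext i n (y : V) :
  negpart (translate (toG (unitv i *+ n)) (tail_ext i y)) = tail_ext i (iter n (@tshift R T) y).
Proof.
elim: n => [|n IH].
  rewrite mulr0n toG0 translate0 /negpart (_ : resP _ = 0).
    by rewrite (linear_fun0 (embP_blin _ _).1) subr0.
  apply: ell1_eq => p; rewrite pullE ell10 push_out// => x.
  by apply/eqP => /(congr1 (fun u : G => u i)); rewrite toGE tail_point_self.
by rewrite mulrS toGD -translateD -negpart_translate IH negpart_tail_ext1.
Qed.

End Restriction.

(** * Second cohomology as a sum of spaces of tails *)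

Section HarrisonCohomology.
Variables (R : realType) (k : nat).
Notation P := (multi k.+1).
Notation G := (lattice k.+1).
Notation T := (multi k).
Let B := ellNk R k.+1.
Let M := regular_bimod B.
Let Z := cocycles (harrison_complex M) 2.
Let Y := tails R T.
Local Notation d := (@delta R P).
Implicit Types (f g : P -> ell1 R G) (phi : cochain B M 2).

Lemma primitive_tail phi f i n : primitive phi f ->
  iter n (@tshift R T) (tail_restr i (f (unitv i))) *+ n.+1 = tail_restr i (f (unitv i *+ n.+1)).
Proof.
move=> fprim; rewrite -[RHS]tail_restr_negpart (primitive_negpartM _ _ fprim) -tail_restr_translate.
by rewrite (linear_funMn _ _ (tail_restr_blin _ _).1) tail_restr_negpart.
Qed.

Lemma primitive_tail_bound phi f i C : primitive phi f -> (forall p, `|f p| <= C) ->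
  forall n : nat, n.+1%:R * `|iter n (@tshift R T) (tail_restr i (f (unitv i)))| <= C.
Proof.
move=> fprim fC n; rewrite -snormMn (primitive_tail _ _ fprim).
by rewrite (le_trans (pull_norm _ _)).
Qed.

(** Adding multiples of e_i to [u] leaves its negative j-th coordinate unchanged, so the point
    stays off P, and n + 1 times the coefficient at [u] is a coefficient of the primitive at (n
    + 1) e_i. These are bounded independently of n. *)
Lemma primitive_coord0 phi f i j (u : G) : primitive phi f -> j != i -> u j < 0 ->
  ell1_fun (f (unitv i)) u = 0.
Proof.
move=> fprim ji uj; have [[C fC] _] := fprim; apply: eq0_normc; apply/eqP.
rewrite eq_le normc_ge0 andbT; apply: (@archi_le0 _ _ C) => -[|n].
  by rewrite mul0r (le_trans _ (fC 0)).
pose v := toG (unitv i *+ n) + u.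
have vj : v j < 0.
  rewrite latD toGE (_ : (unitv i *+ n) j = 0%N) ?add0r//.
  by elim: n {v} => [|n IH]; rewrite ?mulr0n ?ffunE// mulrS multiD IH unitvE (negbTE ji).
have fv : ell1_fun (f (unitv i *+ n.+1)) v = ell1_fun (f (unitv i)) u *+ n.+1.
  rewrite -(negpart_out _ vj) (primitive_negpartM _ _ fprim).
  rewrite -(linear_funMn _ _ (negpart_blin _ _).1) (negpart_out _ vj).
  by rewrite ell1Mn translateE /v [_ + u]addrC addrK.
rewrite -normc_nat -normcM mulr_natl -fv.
exact: le_trans (ell1_coord_le _ _) (fC _).
Qed.

(** By [primitive_coord0] the negative part at e_i has no coefficients but those kept by
    [tail_restr]; and the unit vectors generate P. *)
Lemma primitive_negpart0 phi f : primitive phi f -> (forall i, tail_restr i (f (unitv i)) = 0) ->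
  forall p, negpart (f p) = 0.
Proof.
move=> fprim f0; apply: multi_ind => [|i|p q fp fq].
- have := primitive_negpartD 0 0 fprim; rewrite !toG0 !translate0 addr0.
  by move=> /eqP; rewrite -subr_eq0 opprD addrA subrr sub0r oppr_eq0 => /eqP.
- apply: ell1_eq => u; rewrite ell10.
  have [[p ->]|[j uj]] := lattice_cases u; first exact: negpart_toG.
  rewrite (negpart_out _ uj).
  have [ji|ji] := eqVneq j i; last exact: primitive_coord0 fprim ji uj.
  rewrite {}ji in uj; have [[x ->]|[l li ul]] := tail_point_cases uj.
    by rewrite -[LHS](pullE (@tail_point_inj k i)) -/(tail_restr i _) f0.
  exact: primitive_coord0 fprim li ul.
- rewrite (primitive_negpartD _ _ fprim) -negpart_translate fq -[X in _ + X]negpart_translate fp.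
  by rewrite !(linear_fun0 (translate_blin _ _).1) (linear_fun0 (negpart_blin _ _).1) addr0.
Qed.

Lemma cocycle_primitive (z : Z) :
  exists f, primitive (subsp_val z) f /\ forall p, `|f p| <= `|z|.
Proof.
by have [_ /primitive_exists[f fprim fC]] := subsp_valP z; exists f.
Qed.

Definition primitive_of (z : Z) : P -> ell1 R G := sval (cid (cocycle_primitive z)).

Lemma primitive_ofP z : primitive (subsp_val z) (primitive_of z).
Proof. by rewrite /primitive_of; case: cid => f []. Qed.

Lemma primitive_of_norm z p : `|primitive_of z p| <= `|z|.
Proof. by rewrite /primitive_of; case: cid => f []. Qed.

Lemma primitive_of_tailP z i : exists c, forall n : nat,
  n.+1%:R * `|iter n (@tshift R T) (tail_restr i (primitive_of z (unitv i)))| <= c.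
Proof. by exists `|z|; apply: primitive_tail_bound (primitive_ofP z) (primitive_of_norm z). Qed.

(** The class of the cocycle, as the values at the unit vectors of the derivation modulo ell1 P
    induced by its primitive. *)
Definition tail_map (z : Z) : dsum Y k.+1 :=
  [ffun i => mk_decay (tshift_blin R T) (primitive_of_tailP z i)].

Lemma tail_mapE z i : decay_val (tail_map z i) = tail_restr i (primitive_of z (unitv i)).
Proof. by rewrite ffunE. Qed.

Lemma tail_map_blin : blin tail_map.
Proof.
split.
  move=> c x y; apply: dsum_eq => i; apply: decay_val_inj.
  rewrite dsumD dsumZ decay_val_linear !tail_mapE -(tail_restr_blin R i).1; congr tail_restr.
  apply: (@primitive_unique _ _ _ _
    (fun p => c *: primitive_of x p + primitive_of y p) (primitive_ofP _)).
  by rewrite subsp_valD subsp_valZ; apply: primitive_linear; exact: primitive_ofP.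
exists k.+1%:R => z; rewrite dsum_normE mulr_natl -[k.+1 in leRHS]card_ord -sumr_const.
apply: ler_sum => i _; apply: decay_le; rewrite tail_mapE.
by apply: primitive_tail_bound (primitive_ofP z) (primitive_of_norm z).
Qed.

Lemma tail_map0 z : is_coboundary (harrison_complex M) (subsp_val z) <-> tail_map z = 0.
Proof.
split=> [/(coboundary_primitive (primitive_ofP z)) z0|z0].
  apply: dsum_eq => i; rewrite [RHS]ffunE; apply: decay_val_inj.
  rewrite tail_mapE -tail_restr_negpart z0 (linear_fun0 (tail_restr_blin _ _).1).
  by rewrite (linear_fun0 (@decay_val_linear _ _ _ _)).
apply/(coboundary_primitive (primitive_ofP z)); apply: primitive_negpart0 (primitive_ofP z) _ => i.
by rewrite -tail_mapE z0 ffunE (linear_fun0 (@decay_val_linear _ _ _ _)).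
Qed.

Section Surjectivity.
Variable y : dsum Y k.+1.
Let w i : ell1 R G := tail_ext i (decay_val (y i)).

(** The derivation into ell1 G with value [w i] at e_i. It is not bounded in general, but its
    negative part is, by [free_derivation_term]. *)
Definition free_derivation (p : P) : ell1 R G :=
  \sum_i translate (toG p - toG (unitv i)) (w i) *+ p i.

Lemma translate_free_derivation p q :
  translate (toG p) (free_derivation q) =
  \sum_i translate (toG (p + q) - toG (unitv i)) (w i) *+ q i.
Proof.
rewrite (blin_sum _ _ (translate_blin _ _).1); apply: eq_bigr => i _.
by rewrite (linear_funMn _ _ (translate_blin _ _).1) translateD toGD addrA.
Qed.

Lemma free_derivation_cob p q : twisted_cob free_derivation p q = 0.
Proof.
rewrite /twisted_cob addrAC translate_free_derivation translate_free_derivation [q + p]addrC.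
apply/eqP; rewrite subr_eq0; apply/eqP; rewrite -big_split; apply: eq_bigr => i _.
by rewrite /= -mulrnDr multiD addnC.
Qed.

Lemma free_derivation_unitv i : free_derivation (unitv i) = w i.
Proof.
rewrite /free_derivation (bigD1 i)//= big1 => [|j ji].
  by rewrite unitvE eqxx mulr1n subrr translate0 addr0.
by rewrite unitvE (negbTE ji) mulr0n.
Qed.

(** If p i = n + 1, then p - e_i = q + n e_i with [q] in P. Translation by n e_i shifts the tail
    n times, and n + 1 times the result is bounded by the norm of the tail; translation by [q]
    does not increase the norm of the negative part. *)
Lemma free_derivation_term p i :
  `|negpart (translate (toG p - toG (unitv i)) (w i) *+ p i)| <= `|y i|.
Proof.
case pi : (p i) => [|n].
  by rewrite mulr0n (linear_fun0 (negpart_blin _ _).1) normr0.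
pose q : P := [ffun j => if j == i then 0%N else p j].
have -> : toG p - toG (unitv i) = toG q + toG (unitv i *+ n).
  apply/eqP; rewrite subr_eq -addrA -!toGD -mulrSr; apply/eqP; congr toG.
  apply/ffunP => j; rewrite multiD ffunE.
  have uM m : (unitv i *+ m) j = (m * (j == i))%N.
    by elim: m => [|m IH]; rewrite ?mulr0n ?ffunE// mulrS multiD IH unitvE mulSn.
  by rewrite uM; case: eqVneq => [->|_]; rewrite ?pi ?muln1 ?muln0 ?addn0.
rewrite (linear_funMn _ _ (negpart_blin _ _).1) snormMn -translateD.
apply: le_trans (decay_valP (y i) n); rewrite ler_wpM2l//.
by rewrite (le_trans (negpart_translate_norm _ _))// negpart_tail_ext push_norm.
Qed.

Definition bounded_primitive (p : P) : ell1 R G := negpart (free_derivation p).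

Lemma bounded_primitive_norm p : `|bounded_primitive p| <= `|y|.
Proof.
rewrite /bounded_primitive (blin_sum _ _ (negpart_blin _ _).1).
apply: le_trans (ler_norm_sum _ _ _) _; rewrite dsum_normE.
by apply: ler_sum => i _; exact: free_derivation_term.
Qed.

Lemma negpart_cob p q : negpart (twisted_cob bounded_primitive p q) = 0.
Proof.
rewrite /twisted_cob /bounded_primitive (linear_funD _ _ (negpart_blin _ _).1).
rewrite (linear_funB _ _ (negpart_blin _ _).1).
rewrite (negpart_translate p (free_derivation q)) (negpart_translate q (free_derivation p)).
rewrite (negpart_idem (free_derivation (p + q))).
rewrite -(linear_funB _ _ (negpart_blin _ _).1) -(linear_funD _ _ (negpart_blin _ _).1).
rewrite -[X in negpart X]/(twisted_cob free_derivation p q) free_derivation_cob.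
exact: linear_fun0 (negpart_blin _ _).1.
Qed.

Let u (x : P * P) : ell1 R P := resP (twisted_cob bounded_primitive x.1 x.2).

Let u_norm x : `|u x| <= 3 * `|y|.
Proof.
rewrite (le_trans (pull_norm _ _))// (le_trans (ler_normD _ _))//.
rewrite (_ : 3 * `|y| = `|y| + `|y| + `|y|); last by ring.
have translate_le v p : `|translate v (bounded_primitive p)| <= `|y|.
  by rewrite translate_norm; exact: bounded_primitive_norm.
apply: lerD; last exact: translate_le.
apply: le_trans (ler_normB _ _) _; apply: lerD; first exact: translate_le.
exact: bounded_primitive_norm.
Qed.

Let u_bounded : bounded_family u. Proof. by exists (3 * `|y|) => x; exact: u_norm. Qed.

Let y3_ge0 : 0 <= 3 * `|y|. Proof. by rewrite mulr_ge0. Qed.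

Let cocycle_bilinear :
  bounded_bilinear ((fun a b => kernel_op u (ell1_tensor a b)) : B -> B -> M).
Proof. exact: bilinear_comp2 (tensor_bilinear R P P) (kernel_op_blin u_bounded). Qed.

Definition preimage_cochain : cochain B M 2 := mk_cochain2 cocycle_bilinear.

Lemma preimage_delta p q :
  ev2 preimage_cochain (d p) (d q) = resP (twisted_cob bounded_primitive p q).
Proof. by rewrite mk_cochain2E delta_tensor kernel_op_delta. Qed.

Lemma preimage_primitive : primitive preimage_cochain bounded_primitive.
Proof.
split; first by exists `|y| => p; exact: bounded_primitive_norm.
by move=> p q; rewrite preimage_delta -negpart_eq0// negpart_cob.
Qed.

Lemma preimage_cocycle : hdelta (cfun preimage_cochain) = 0.
Proof.
apply/hdelta2_eq0; apply: delta2_ext0.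
- exact: ell1_hausdorff.
- exact: ev2_bilinear.
move=> p q r; rewrite delta2_delta; apply: (can_inj (@embPK R k.+1)).
rewrite (linear_fun0 (embP_blin _ _).1).
rewrite (linear_funB _ _ (embP_blin _ _).1) (linear_funD _ _ (embP_blin _ _).1).
rewrite (linear_funB _ _ (embP_blin _ _).1) !embP_push !preimage_primitive.2.
exact: twisted_cob_cocycle.
Qed.

Lemma preimage_symmetric a b : ev2 preimage_cochain a b = ev2 preimage_cochain b a.
Proof. by apply: cocycle_symmetric preimage_cocycle _ _ => p; exact: multi_cancel. Qed.

Lemma preimage_norm : `|preimage_cochain| <= 3 * `|y|.
Proof.
apply: mk_cochain2_le => // a b.
rewrite (le_trans (kernel_op_norm _ y3_ge0 u_norm))// -mulrA ler_wpM2l//.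
exact: ell1_tensor_norm.
Qed.

Lemma preimageP : harrison_complex M 2 preimage_cochain /\ hdelta (cfun preimage_cochain) = 0.
Proof.
by split; [apply/harrison2; exact: preimage_symmetric|exact: preimage_cocycle].
Qed.

Lemma tail_map_surj : exists2 z : Z, tail_map z = y & `|z| <= 3 * `|y|.
Proof.
pose z : Z := mk_cocycle preimageP.
have zprim : primitive preimage_cochain (primitive_of z).
  by rewrite -(mk_cocycleK preimageP); exact: primitive_ofP.
exists z; last by rewrite subsp_normE mk_cocycleK; exact: preimage_norm.
apply: dsum_eq => i; apply: decay_val_inj; rewrite tail_mapE.
rewrite (primitive_unique zprim preimage_primitive).
by rewrite /bounded_primitive tail_restr_negpart free_derivation_unitv tail_extK.
Qed.

End Surjectivity.

Lemma harH_tails_iso : sn_iso (harH M 2) (dsum Y k.+1).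
Proof.
apply: (@qsp_iso_surj _ _ _ _ tail_map 3 tail_map_blin).
- by move=> z; rewrite -tail_map0; split.
- exact: tail_map_surj.
Qed.

End HarrisonCohomology.

(** * Completions of densely embedded spaces *)

Section DenseEmbeddings.
Variables (R : realType) (M V : snModType R) (J : M -> V) (K : R).
Hypotheses (Jb : blin J) (K_ge0 : 0 <= K) (J_below : forall x, `|x| <= K * `|J x|).
Hypothesis J_dense : forall v e, 0 < e -> exists x, `|J x - v| < e.
Hypotheses (hV : hausdorff V) (cV : complete V).

Definition limit_of (u : nat -> V) (l : V) : Prop :=
  forall e, 0 < e -> exists N, forall n, (N <= n)%N -> `|u n - l| < e.

Lemma limit_unique u l l' : limit_of u l -> limit_of u l' -> l = l'.
Proof.
move=> ul ul'; apply/eqP; rewrite -subr_eq0; apply/eqP/hV/eqP.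
rewrite eq_le normr_ge0 andbT; apply/ler_addgt0Pr => e e0; rewrite add0r.
have e20 : 0 < e / 2 by rewrite divr_gt0.
have [N uN] := ul _ e20; have [N' uN'] := ul' _ e20; pose n := maxn N N'.
have -> : l - l' = (u n - l') - (u n - l) by rewrite opprB [RHS]addrC addrA subrK.
rewrite (le_trans (ler_normB _ _))// (splitr e) lerD// ltW//.
  by rewrite uN'// leq_maxr.
by rewrite uN// leq_maxl.
Qed.

Lemma limit_blin u l (f : V -> V) : blin f -> limit_of u l -> limit_of (fun n => f (u n)) (f l).
Proof.
move=> fb ul e e0; have [c c0 fc] := blin_bound fb.
have c1 : 0 < c + 1 by rewrite ltr_pwDr.
have [N uN] := ul _ (divr_gt0 e0 c1); exists N => n Nn.
rewrite -(linear_funB _ _ fb.1) (le_lt_trans (fc _))//.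
rewrite (@le_lt_trans _ _ ((c + 1) * `|u n - l|))//; first by rewrite ler_wpM2r// lerDl.
by rewrite mulrC -ltr_pdivlMr// uN.
Qed.

Lemma limit_linear c u v l m : limit_of u l -> limit_of v m ->
  limit_of (fun n => c *: u n + v n) (c *: l + m).
Proof.
move=> ul vm e e0; have e20 : 0 < e / 2 by rewrite divr_gt0.
have [N uN] := limit_blin (blinZ c (blin_id V)) ul e20; have [N' vN] := vm _ e20.
exists (maxn N N') => n; rewrite geq_max => /andP[Nn N'n].
rewrite opprD addrACA (le_lt_trans (ler_normD _ _))// (splitr e) ltrD ?uN ?vN//.
Qed.

Lemma cauchy_limit (x : cauchy_seqs M) : exists l, limit_of (fun n => J (\val x n)) l.
Proof. exact: cV (blin_cauchy Jb (cauchy_seqsP x)). Qed.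

Definition limit_map (x : cauchy_seqs M) : V := sval (cid (cauchy_limit x)).

Lemma limit_mapP x : limit_of (fun n => J (\val x n)) (limit_map x).
Proof. exact: (svalP (cid (cauchy_limit x))). Qed.

Lemma limit_map_eq x l : limit_of (fun n => J (\val x n)) l -> limit_map x = l.
Proof. exact: limit_unique (limit_mapP x). Qed.

Lemma cauchy_norm_near (x : cauchy_seqs M) e : 0 < e ->
  exists N, forall n, (N <= n)%N -> `|\val x n| <= `|x| + e.
Proof.
move=> e0; have /cvgrPdist_lt/(_ e e0)[N _ xN] := cauchy_norm_cvg (cauchy_seqsP x).
exists N => n /xN; rewrite distrC => /ltW/(le_trans (ler_norm _)).
by rewrite lerBlDr addrC.
Qed.

Lemma limit_map_blin : blin limit_map.
Proof.
split.
  move=> c x y; apply: limit_map_eq => e e0.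
  have [N xyN] := limit_linear c (limit_mapP x) (limit_mapP y) e0; exists N => n Nn.
  by rewrite -[X in X - _](_ : c *: J (\val x n) + J (\val y n) = _) ?xyN// -Jb.1.
have [c c0 Jc] := blin_bound Jb; exists c => x; apply/ler_addgt0Pr => e e0.
have c1 : 0 < c + 1 by rewrite ltr_pwDr.
have e2 : 0 < e / (c + 1) by rewrite divr_gt0.
have [N xN] := cauchy_norm_near x e2; have [N' jN] := limit_mapP x e2.
pose n := maxn N N'.
rewrite -[limit_map x](subKr (J (\val x n))) (le_trans (ler_normB _ _))//.
have h1 : `|J (\val x n)| <= c * (`|x| + e / (c + 1)).
  by rewrite (le_trans (Jc _))// ler_wpM2l// xN// leq_maxl.
have h2 : `|J (\val x n) - limit_map x| <= e / (c + 1) by rewrite ltW// jN// leq_maxr.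
rewrite (le_trans (lerD h1 h2))// mulrDr -addrA lerD2l.
by rewrite -[X in _ + X]mul1r -mulrDl mulrCA mulfV ?mulr1// gt_eqF.
Qed.

Lemma limit_map_below x : `|x| <= K * `|limit_map x|.
Proof.
apply/ler_addgt0Pr => e e0; apply: (cauchy_norm_le (cauchy_seqsP x)).
have K1 : 0 < K + 1 by rewrite ltr_pwDr.
have [N jN] := limit_mapP x (divr_gt0 e0 K1); exists N => n Nn.
rewrite (le_trans (J_below _))//.
have h : `|J (\val x n)| <= `|limit_map x| + e / (K + 1).
  rewrite -[J (\val x n)](subrK (limit_map x)) addrC (le_trans (ler_normD _ _))// lerD2l.
  by rewrite ltW// jN.
rewrite (le_trans (ler_wpM2l K_ge0 h))// mulrDr lerD2l mulrCA ger_pMr//.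
by rewrite ler_pdivrMr// mul1r lerDl.
Qed.

Lemma limit_map_surj v : exists2 x, limit_map x = v & `|x| <= K * `|v|.
Proof.
have /choice[u uv] : forall n : nat, exists x, `|J x - v| < 2^-1 ^+ n.
  by move=> n; apply: J_dense; rewrite exprn_gt0// invr_gt0.
have ul : limit_of (fun n => J (u n)) v.
  move=> e e0; have [N Ne] := half_lt e0; exists N => n Nn.
  apply: lt_trans (uv n) (le_lt_trans _ Ne).
  by rewrite ler_wiXn2l ?invr_ge0// invf_le1// ler1n.
have cu : is_cauchy u.
  move=> e e0; have K1 : 0 < K + 1 by rewrite ltr_pwDr.
  have e20 : 0 < e / (K + 1) / 2 by rewrite !divr_gt0.
  have [N uN] := ul _ e20; exists N => m n Nm Nn.
  rewrite (le_lt_trans (J_below _))// (linear_funB _ _ Jb.1).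
  rewrite (@le_lt_trans _ _ ((K + 1) * `|J (u m) - J (u n)|))//.
    by rewrite ler_wpM2r// lerDl.
  rewrite mulrC -ltr_pdivlMr// (splitr (e / _)).
  rewrite -(subrK v (J (u m))) -addrA (le_lt_trans (ler_normD _ _))// ltrD ?uN//.
  by rewrite distrC uN.
have uE : limit_map (mk_cauchy cu) = v by exact: limit_map_eq.
by exists (mk_cauchy cu) => //; rewrite (le_trans (limit_map_below _))// uE.
Qed.

Lemma limit_map_null x : null_subspace (cauchy_seqs M) x <-> limit_map x = 0.
Proof.
split=> [x0|x0].
  apply/hV/eqP; rewrite eq_le normr_ge0 andbT.
  by have [c c0 jc] := blin_bound limit_map_blin; rewrite (le_trans (jc x))// x0 mulr0.
by apply/eqP; rewrite eq_le normr_ge0 andbT (le_trans (limit_map_below _))// x0 normr0 mulr0.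
Qed.

(** Sending the class of a Cauchy sequence to the limit of its image under [J] is injective
    because [J] is bounded below, and surjective because its range is dense. *)
Lemma completion_embedding : exists (f : completion M -> V) (g : V -> completion M),
  [/\ blin f, bounded_map g, cancel f g, cancel g f &
      forall x, f (qproj (null_subspace (cauchy_seqs M)) x) = limit_map x].
Proof. exact: qsp_factor limit_map_blin limit_map_null limit_map_surj. Qed.

End DenseEmbeddings.

(** * Projective tensor product with ell1 *)

Section BilinearForms.
Variables (R : realType) (E F : snModType R) (beta : bilform E F).

Lemma bfDl x y z : beta (x + y) z = beta x z + beta y z.
Proof. by have := bf_linl beta z 1 x y; rewrite !scale1r. Qed.

Lemma bf0l z : beta 0 z = 0.
Proof. by have := bfDl 0 0 z; rewrite addr0 -[LHS]addr0 => /addrI. Qed.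

Lemma bfZl k x z : beta (k *: x) z = k * beta x z.
Proof. by have := bf_linl beta z k x 0; rewrite bf0l !addr0. Qed.

Lemma bfDr x y z : beta x (y + z) = beta x y + beta x z.
Proof. by have := bf_linr beta x 1 y z; rewrite !scale1r. Qed.

Lemma bf0r x : beta x 0 = 0.
Proof. by have := bfDr x 0 0; rewrite addr0 -[LHS]addr0 => /addrI. Qed.

Lemma bfZr k x z : beta x (k *: z) = k * beta x z.
Proof. by have := bf_linr beta x k z 0; rewrite bf0r !addr0. Qed.

Lemma bf_suml I (r : seq I) (G : I -> E) z :
  beta (\sum_(i <- r) G i) z = \sum_(i <- r) beta (G i) z.
Proof. by elim: r => [|i r IH]; rewrite ?big_nil ?bf0l// !big_cons bfDl IH. Qed.

Lemma bf_sumr I (r : seq I) (G : I -> F) x :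
  beta x (\sum_(i <- r) G i) = \sum_(i <- r) beta x (G i).
Proof. by elim: r => [|i r IH]; rewrite ?big_nil ?bf0r// !big_cons bfDr IH. Qed.

End BilinearForms.

Section TensorWithEll1.
Variables (R : realType) (S T : choiceType) (E : snModType R).
Notation F := (ell1 R T).
Notation V := (ell1 R (S * T)%type).
Variables (c : E -> ell1 R S) (e : ell1 R S -> E).
Hypotheses (cb : blin c) (eb : blin e).
Hypotheses (c_norm : forall x, `|c x| <= `|x|) (e_norm : forall x, `|e x| <= `|x|).
Hypotheses (cK : cancel c e) (eK : cancel e c).

Lemma coef_linl (x : S * T) (y : F) :
  linear (fun q => ell1_fun (c q) x.1 * ell1_fun y x.2 : R[i]^o).
Proof. by move=> k q r; rewrite cb.1 ell1D ell1Z mulrDl -mulrA. Qed.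

Lemma coef_linr (x : S * T) (q : E) :
  linear (fun y : F => ell1_fun (c q) x.1 * ell1_fun y x.2 : R[i]^o).
Proof. by move=> k y z; rewrite ell1D ell1Z mulrDr mulrCA. Qed.

(** Elements of the algebraic tensor product are functionals on bilinear forms, so coefficients
    are best obtained by evaluation at these forms. *)
Definition coef_form (x : S * T) : bilform E F := Bilform (coef_linl x) (coef_linr x).

Definition tensor_coef (t : alg_tensor E F) : V := ell1_of (fun x => tensor_eval t (coef_form x)).

Lemma tensor_coefE s : tensor_coef (mk_tensor s) = \sum_(p <- s) ell1_tensor (c p.1) p.2.
Proof.
have h x : tensor_eval (mk_tensor s) (coef_form x) =
    ell1_fun (\sum_(p <- s) ell1_tensor (c p.1) p.2) x.
  by rewrite ell1_sumE.
apply: ell1_eq => x; rewrite ell1_ofE ?h//.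
rewrite (_ : (fun x => _) = ell1_fun (\sum_(p <- s) ell1_tensor (c p.1) p.2)); first exact: ell1P.
exact/funext.
Qed.

Lemma tensor_coef_coord t x : ell1_fun (tensor_coef t) x = tensor_eval t (coef_form x).
Proof.
by have [s ->] := mk_tensor_surj t; rewrite tensor_coefE ell1_sumE.
Qed.

Lemma tensor_coef_linear : linear tensor_coef.
Proof.
move=> k t u; apply: ell1_eq => x.
by rewrite ell1D ell1Z !tensor_coef_coord tensor_evalD tensor_evalZ.
Qed.

Lemma tensor_coef_norm t : `|tensor_coef t| <= `|t|.
Proof.
rewrite -[leRHS]mul1r; apply: tens_norm_lip => // [|s ts]; first exact: (valP t).
have -> : t = mk_tensor s by exact: val_inj.
rewrite tensor_coefE mul1r (le_trans (ler_norm_sum _ _ _))//; apply: ler_sum => p _.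
by rewrite (le_trans (ell1_tensor_norm _ _))// ler_wpM2r.
Qed.

Lemma tensor_coef_blin : blin tensor_coef.
Proof. by split; [exact: tensor_coef_linear|exists 1 => t; rewrite mul1r tensor_coef_norm]. Qed.

Lemma tensor_coef_dense v d : 0 < d -> exists t, `|tensor_coef t - v| < d.
Proof.
move=> /(ell1_approx v)[r _ vr].
exists (\sum_(x <- r) ell1_fun v x *: mk_tensor [:: (e (delta R x.1), delta R x.2)]).
rewrite (blin_sum _ _ tensor_coef_linear) distrC.
rewrite (_ : \sum_(x <- r) _ = trunc r v)//; apply: eq_bigr => -[s u] _.
by rewrite (linear_funZ _ _ tensor_coef_linear) tensor_coefE big_seq1 /= eK delta_tensor.
Qed.

Lemma pair_inj (s : S) : injective (pair s : T -> S * T).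
Proof. by move=> t u []. Qed.

Definition slice (s : S) (v : V) : F := pull (@pair_inj s) v.

Lemma sum_slices (r : seq S) (v : V) : uniq r -> \sum_(s <- r) `|slice s v| <= `|v|.
Proof.
move=> ur; pose w s := psum (fun x : S * T => if x.1 == s then normc (ell1_fun v x) else 0).
have n0 x : 0 <= normc (ell1_fun v x) by exact: normc_ge0.
rewrite ell1_normE -(psum_fiber fst n0 (ell1P v)).
have w0 s : 0 <= w s by apply: psum_ge0 => x; case: ifP.
apply: le_trans (psum_ge_sum w0 (summ_psum_fiber fst n0 (ell1P v)) ur).
apply: ler_sum => s _; apply: ell1_norm_le => q uq.
rewrite (eq_bigr (fun t => if (s, t).1 == s then normc (ell1_fun v (s, t)) else 0)); last first.
  by move=> t _; rewrite eqxx.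
rewrite -(big_map (pair s) predT (fun x => if x.1 == s then normc (ell1_fun v x) else 0)).
apply: psum_ge_sum.
- by move=> x; case: ifP.
- exact: summ_fiber (ell1P v).
- by rewrite map_inj_uniq// => t u [].
Qed.

(** Truncation to a larger set is a better approximation ([trunc_mono]), so the sets that suit
    the individual terms of [s] can be united. *)
Lemma common_trunc (s : seq (E * F)) d : 0 < d -> exists2 r : seq S, uniq r &
  \sum_(p <- s) `|c p.1 - trunc r (c p.1)| * `|p.2| < d.
Proof.
elim: s d => [|p s IH] d d0; first by exists [::] => //; rewrite big_nil.
have d20 : 0 < d / 2 by rewrite divr_gt0.
have [r ur rs] := IH _ d20.
have p1 : 0 < `|p.2| + 1 by rewrite ltr_pwDr.
have [q uq qp] := ell1_approx (c p.1) (divr_gt0 d20 p1).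
exists (undup (q ++ r)); first exact: undup_uniq.
rewrite big_cons (splitr d) ltr_leD//.
  apply: (@le_lt_trans _ _ (`|c p.1 - trunc q (c p.1)| * (`|p.2| + 1))).
    rewrite ler_pM ?lerDl// trunc_mono ?undup_uniq//.
    by move=> x xq; rewrite mem_undup mem_cat xq.
  by rewrite -ltr_pdivlMr.
apply: le_trans (ltW rs); apply: ler_sum => x _; rewrite ler_wpM2r// trunc_mono ?undup_uniq//.
by move=> y yr; rewrite mem_undup mem_cat yr orbT.
Qed.

Lemma tens_split (s : seq (E * F)) (f : E -> E) :
  mk_tensor s = mk_tensor [seq (f p.1, p.2) | p <- s] +
                mk_tensor [seq (p.1 - f p.1, p.2) | p <- s].
Proof.
apply: tensor_eq => beta; rewrite tensor_evalD /tensor_eval /= /tens !big_map.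
rewrite -big_split; apply: eq_bigr => p _ /=.
by rewrite -bfDl subrKC.
Qed.

Lemma tens_trunc (s : seq (E * F)) (r : seq S) :
  mk_tensor [seq (e (trunc r (c p.1)), p.2) | p <- s] =
  mk_tensor [seq (e (delta R x), slice x (tensor_coef (mk_tensor s))) | x <- r].
Proof.
apply: tensor_eq => beta; rewrite /tensor_eval /= /tens !big_map /=.
rewrite (eq_bigr (fun p =>
  \sum_(x <- r) ell1_fun (c p.1) x * beta (e (delta R x)) p.2)); last first.
  move=> p _; rewrite /trunc (blin_sum _ _ eb.1).
  rewrite bf_suml; apply: eq_bigr => x _.
  by rewrite (linear_funZ _ _ eb.1) bfZl.
rewrite exchange_big /=; apply: eq_bigr => x _.
have -> : slice x (tensor_coef (mk_tensor s)) = \sum_(p <- s) ell1_fun (c p.1) x *: p.2.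
  apply: ell1_eq => t; rewrite pullE tensor_coefE !ell1_sumE; apply: eq_bigr => p _.
  by rewrite ell1Z ell1_tensorE.
by rewrite bf_sumr; apply: eq_bigr => p _; rewrite bfZr.
Qed.

(** Up to an arbitrarily small projective norm, the first factors may be truncated to a common
    finite set. The tensor is then the sum, over x in this set, of the x-th basis vector
    tensored with the x-th slice of the coefficients, and the slices have total norm at most the
    ell1 norm. *)
Lemma tensor_coef_below t : `|t| <= 1 * `|tensor_coef t|.
Proof.
rewrite mul1r; apply/ler_addgt0Pr => d d0; have [s ->] := mk_tensor_surj t.
have [r ur rd] := common_trunc s d0.
rewrite {1}(tens_split s (fun q => e (trunc r (c q)))) (le_trans (ler_normD _ _))// lerD//.
  rewrite tens_trunc (le_trans (tens_norm_le _))// big_map /=.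
  apply: le_trans (sum_slices _ ur); apply: ler_sum => x _.
  rewrite -[leRHS]mul1r ler_wpM2r// (le_trans (e_norm _))// delta_norm//.
rewrite (le_trans (tens_norm_le _))// big_map /=; apply: le_trans (ltW rd).
apply: ler_sum => p _; rewrite ler_wpM2r//.
by rewrite -[X in X - e _]cK -(linear_funB _ _ eb.1).
Qed.

End TensorWithEll1.

(** * The module Q and its tensor products *)

Section QuotientCoefficients.
Variable R : realType.
Let Q := Qbimod R.

Lemma negz_inj : injective Negz. Proof. by move=> m n []. Qed.
Lemma posz_inj : injective Posz. Proof. by move=> m n []. Qed.

Definition negcoef : ell1 R int -> ell1 R nat := pull negz_inj.

Lemma negcoef_blin : blin negcoef. Proof. exact: pull_blin. Qed.

Lemma negcoef_incl f : negcoef (Defs.incl f) = 0.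
Proof. by apply: ell1_eq => n; rewrite pullE inclN ell10. Qed.

(** The coefficients at the negative powers of z, which are common to all representatives. *)
Definition qcoef (q : Q) : ell1 R nat := negcoef (qrepr (W := ellN_sub R) q).

Definition qlift (y : ell1 R nat) : Q := qproj (ellN_sub R) (push Negz y).

Lemma qcoefE x : qcoef (qproj (ellN_sub R) x) = negcoef x.
Proof.
apply/eqP; rewrite -subr_eq0 -(linear_funB _ _ negcoef_blin.1); apply/eqP.
have /qprojP[f fE] := qreprK (qproj (ellN_sub R) x).
by rewrite [X in negcoef X]fE negcoef_incl.
Qed.

Lemma qcoef_linear : linear qcoef.
Proof.
move=> c q r; have [x <-] := qproj_surj q; have [y <-] := qproj_surj r.
have -> : c *: (qproj (ellN_sub R) x : Q) + qproj (ellN_sub R) y =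
  qproj (ellN_sub R) (c *: x + y) by rewrite qprojD qprojZ.
by rewrite !qcoefE; exact: negcoef_blin.1.
Qed.

Lemma qcoef_norm q : `|qcoef q| <= `|q|.
Proof.
rewrite -[leRHS]mul1r; apply: qnorm_lip => // x <-.
by rewrite mul1r qcoefE; exact: pull_norm.
Qed.

Lemma qcoef_blin : blin qcoef.
Proof. by split; [exact: qcoef_linear|exists 1 => q; rewrite mul1r; exact: qcoef_norm]. Qed.

Lemma qlift_norm y : `|qlift y| <= `|y|.
Proof. by apply: le_trans (qnorm_le _ _) _; exact: push_norm. Qed.

Lemma qlift_blin : blin qlift.
Proof.
split; last by exists 1 => y; rewrite mul1r; exact: qlift_norm.
by move=> c x y; rewrite /qlift push_linear qprojD qprojZ.
Qed.

Lemma qliftK : cancel qlift qcoef.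
Proof.
move=> y; rewrite qcoefE; apply: ell1_eq => n.
by rewrite pullE push_inj//; exact: negz_inj.
Qed.

Lemma qcoefK : cancel qcoef qlift.
Proof.
move=> q; have [x <-] := qproj_surj q; rewrite qcoefE; apply/qprojP.
exists (- pull posz_inj x); apply: ell1_eq => -[n|n]; rewrite ell1B.
  by rewrite push_out// sub0r inclE ell1N pullE.
by rewrite push_inj ?inclN ?pullE ?subrr//; exact: negz_inj.
Qed.

Lemma qcoef_lact n q m :
  ell1_fun (qcoef (lact (delta R n : ellN R) q)) m = ell1_fun (qcoef q) (n + m)%N.
Proof.
have [x <-] := qproj_surj q.
have -> : lact (delta R n : ellN R) (qproj (ellN_sub R) x : Q) =
  qproj (ellN_sub R) (conv (Defs.incl (delta R n)) x) by exact: quotient_lactE.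
rewrite !qcoefE !pullE /Defs.incl push_delta conv_delta.
rewrite (@push_bij _ _ _ _ (fun t => t - n%:Z)); last 2 first.
- by move=> t; rewrite /= [n%:Z + t]addrC addrK.
- by move=> t; rewrite /= [n%:Z + _]addrC subrK.
by congr (ell1_fun x _); rewrite !NegzE -addnS PoszD opprD addrC.
Qed.

End QuotientCoefficients.

Section TensorModule.
Variables (R : realType) (T : choiceType).
Let F := ell1 R T.
Let Q := Qbimod R.
Let E := ptensor_bimod Q F.
Let A := alg_tensor_bimod Q F.
Let V := ell1 R (nat * T)%type.
Let J : alg_tensor Q F -> V := tensor_coef (@qcoef_blin R).

Lemma iter_tshift n (v : V) x :
  ell1_fun (iter n (@tshift R T) v) x = ell1_fun v ((n + x.1)%N, x.2).
Proof.
elim: n x => [|n IH] [m t] //; rewrite iterS pullE IH /=.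
by rewrite addnS.
Qed.

Lemma tensor_coef_lact n (t : A) : J (lact (delta R n : ellN R) t) = iter n (@tshift R T) (J t).
Proof.
have [s ->] := mk_tensor_surj t.
have -> : lact (delta R n : ellN R) (mk_tensor s : A) =
  mk_tensor [seq (lact (delta R n : ellN R) p.1, p.2) | p <- s] by exact: tensor_opE.
apply: ell1_eq => x; rewrite iter_tshift /J !tensor_coefE big_map !ell1_sumE.
apply: eq_bigr => p _ /=.
by rewrite !ell1_tensorE qcoef_lact.
Qed.

Lemma alg_tensor_symmetric b (t : A) : lact b t = ract t b.
Proof.
have [s ->] := mk_tensor_surj t.
have -> : lact b (mk_tensor s : A) = mk_tensor [seq (lact b p.1, p.2) | p <- s].
  exact: tensor_opE.
have -> : ract (mk_tensor s : A) b = mk_tensor [seq (ract p.1 b, p.2) | p <- s].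
  exact: tensor_opE.
by congr mk_tensor; apply: eq_map => p; rewrite Qbimod_symmetric.
Qed.

Lemma ptensor_symmetric b (e : E) : lact b e = ract e b.
Proof.
have [x <-] := qproj_surj e.
have -> : lact b (qproj (null_subspace (cauchy_seqs A)) x : E) =
  qproj (null_subspace (cauchy_seqs A)) (lact b (x : cauchy_bimod A)) by exact: quotient_lactE.
have -> : ract (qproj (null_subspace (cauchy_seqs A)) x : E) b =
  qproj (null_subspace (cauchy_seqs A)) (ract (x : cauchy_bimod A) b) by exact: quotient_ractE.
congr qproj; apply/val_inj/funext => n; exact: alg_tensor_symmetric.
Qed.

(** The coefficients at the negative powers of z identify Q with ell1 N isometrically, and the
    projective tensor product of two ell1 spaces is ell1 of the product. *)
Lemma ptensor_ell1 : exists (f : E -> V) (g : V -> E),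
  [/\ blin f, blin g, cancel f g, cancel g f &
      forall n e, f (lact (delta R n : ellN R) e) = iter n (@tshift R T) (f e)].
Proof.
have Jb : blin J by apply: tensor_coef_blin; exact: qcoef_norm.
have Jlow t : `|t| <= 1 * `|J t|.
  by apply: (tensor_coef_below _ (@qlift_blin R)); [exact: qlift_norm|exact: qcoefK].
have Jdense v d : 0 < d -> exists t, `|J t - v| < d.
  by apply: (tensor_coef_dense (e := @qlift R)); exact: qliftK.
have [f [g [fb gb fK gK fE]]] := completion_embedding Jb ler01 Jlow Jdense
  (@ell1_hausdorff R _) (@ell1_complete R _).
exists f, g; split=> //.
  by split=> // c x y; rewrite -[RHS]fK fb.1 !gK.
move=> n e; have [x <-] := qproj_surj e.
have -> : lact (delta R n : ellN R) (qproj (null_subspace (cauchy_seqs A)) x : E) =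
  qproj (null_subspace (cauchy_seqs A)) (lact (delta R n : ellN R) (x : cauchy_bimod A)).
  exact: quotient_lactE.
rewrite !fE; apply: limit_map_eq => [|d d0]; first exact: ell1_hausdorff.
have nb : blin (iter n (@tshift R T)) by apply: iter_blin; exact: tshift_blin.
have [N jN] := limit_blin nb (limit_mapP Jb (@ell1_complete R _) x) d0.
exists N => m Nm; rewrite -[X in X - _](_ : iter n (@tshift R T) (J (\val x m)) = _) ?jN//.
by rewrite -tensor_coef_lact.
Qed.

End TensorModule.

(** * Derivations as tails *)

Section Derivations.
Variables (R : realType) (T : choiceType) (E : bimod (ellN R)).
Let V := ell1 R (nat * T)%type.
Local Notation d n := (delta R n : ellN R).
Local Notation shift n := (iter n (@tshift R T)).
Variables (f : E -> V) (g : V -> E).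
Hypotheses (fb : blin f) (gb : blin g) (fK : cancel f g) (gK : cancel g f).
Hypothesis f_lact : forall n e, f (lact (d n) e) = shift n (f e).
Hypothesis E_sym : forall b (e : E), lact b e = ract e b.
Let Z := hochZ E 1.

Let shift_blin n : blin (shift n). Proof. by apply: iter_blin; exact: tshift_blin. Qed.

Let E_hausdorff : hausdorff E.
Proof.
have VE : sn_iso V E by exact: sn_iso_intro gb fb.2 gK fK.
by apply: sn_iso_hausdorff VE _; exact: ell1_hausdorff.
Qed.

Definition der (z : Z) (n : nat) : V := f (ev1 (subsp_val z) (d n)).

Lemma derD z m n : der z (m + n)%N = shift m (der z n) + shift n (der z m).
Proof.
have [_ /hdelta1_eq0 /(_ (d m) (d n))] := subsp_valP z.
rewrite /delta1 mul_delta -E_sym => /(congr1 f).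
rewrite (linear_fun0 fb.1) (linear_funD _ _ fb.1) (linear_funB _ _ fb.1) !f_lact.
by rewrite addrAC => /eqP; rewrite subr_eq0 => /eqP.
Qed.

Lemma der0 z : der z 0%N = 0.
Proof. by have := derD z 0 0; rewrite /= -[LHS]addr0 => /addrI/esym. Qed.

(** The Leibniz rule for D(z^(n+1)). *)
Lemma derS z n : der z n.+1 = shift n (der z 1%N) *+ n.+1.
Proof.
elim: n => [|n IH]; first by rewrite mulr1n.
rewrite -[n.+2]add1n derD IH [RHS]mulrSr; congr (_ + _).
by rewrite (linear_funMn _ _ (shift_blin 1).1).
Qed.

Lemma der_bound (C : R) z n : (forall e, `|f e| <= C * `|e|) -> 0 <= C -> `|der z n| <= C * `|z|.
Proof.
move=> fC C0; rewrite (le_trans (fC _))// ler_wpM2l// (le_trans (ev1_bound _ _))//.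
by rewrite delta_norm mulr1.
Qed.

Lemma der_tailP z : exists c, forall n : nat, n.+1%:R * `|shift n (der z 1%N)| <= c.
Proof.
have [c c0 fc] := blin_bound fb; exists (c * `|z|) => n.
by rewrite -snormMn -derS; exact: der_bound.
Qed.

Definition der_tail (z : Z) : tails R T := mk_decay (tshift_blin R T) (der_tailP z).

Lemma der_tailE z : decay_val (der_tail z) = der z 1%N. Proof. exact: mk_decayK. Qed.

Lemma der_tail_blin : blin der_tail.
Proof.
split.
  move=> c x y; apply: decay_val_inj; rewrite decay_val_linear !der_tailE /der.
  by rewrite -fb.1 subsp_valD subsp_valZ /ev1 cfunD cfunZ fctDE fctZE.
have [c c0 fc] := blin_bound fb; exists c => z; apply: decay_le => n.
by rewrite der_tailE -snormMn -derS; exact: der_bound.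
Qed.

Lemma der_tail_eq0 z : der_tail z = 0 -> z = 0.
Proof.
move=> z0; have dz0 : der z 1%N = 0.
  by rewrite -der_tailE z0 (linear_fun0 (@decay_val_linear _ _ _ _)).
apply: subsp_val_inj; rewrite subsp_val0; apply: cochain1_ext => a.
apply: (blin_ext (f := ev1 (subsp_val z)) (g := ev1 0)) => //; try exact: ev1_blin.
move=> n; rewrite -[LHS]fK -[f _]/(der z n).
have -> : der z n = 0.
  by case: n => [|n]; rewrite ?der0// derS dz0 (linear_fun0 (shift_blin n).1) mul0rn.
exact: linear_fun0 gb.1.
Qed.

Section Preimage.
Variable x : tails R T.

Let u (n : nat) : V := shift n.-1 (decay_val x) *+ n.

Let u_norm n : `|u n| <= `|x|.
Proof. by case: n => [|n]; rewrite ?normr0// /u snormMn; exact: decay_valP. Qed.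

Let u_bounded : bounded_family u. Proof. by exists `|x| => n; exact: u_norm. Qed.

Let shift_u m n : shift m (u n) = shift (m + n).-1 (decay_val x) *+ n.
Proof.
rewrite /u (linear_funMn _ _ (shift_blin _).1) -iterD.
by case: n => [|n]; rewrite ?mulr0n// addnS.
Qed.

Let uD m n : u (m + n)%N = shift m (u n) + shift n (u m).
Proof. by rewrite !shift_u [(n + m)%N]addnC -mulrnDr addnC /u addnC. Qed.

Let h (a : ellN R) : E := g (kernel_op u a).

Let hb : blin h. Proof. exact: blin_comp (kernel_op_blin u_bounded) gb. Qed.

Let h_cocycle : whole_complex E 1 (mk_cochain1 hb) /\ hdelta (cfun (mk_cochain1 hb)) = 0.
Proof.
split=> //; apply/hdelta1_eq0; apply: delta1_ext0.
- exact: E_hausdorff.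
- exact: ev1_blin.
move=> m n; rewrite /delta1 mul_delta -E_sym !mk_cochain1E -[LHS]fK.
rewrite (linear_funD _ _ fb.1) (linear_funB _ _ fb.1) !f_lact /h !gK !kernel_op_delta//.
by rewrite addrAC uD subrr (linear_fun0 gb.1).
Qed.

Lemma der_tail_surj (C : R) : 0 <= C -> (forall v, `|g v| <= C * `|v|) ->
  exists2 z, der_tail z = x & `|z| <= C * `|x|.
Proof.
move=> C0 gC; exists (mk_cocycle h_cocycle).
  apply: decay_val_inj; rewrite der_tailE /der mk_cocycleK mk_cochain1E /h gK kernel_op_delta//.
rewrite subsp_normE mk_cocycleK; apply: mk_cochain1_le => [|a]; first by rewrite mulr_ge0.
rewrite (le_trans (gC _))// -mulrA ler_wpM2l//.
by apply: kernel_op_norm => // n; exact: u_norm.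
Qed.

End Preimage.

Lemma derivations_iso : sn_iso (hochZ E 1) (tails R T).
Proof.
have [C C0 gC] := blin_bound gb.
apply: (sn_iso_surj der_tail_blin) => [|x]; first exact: der_tail_eq0.
exact: der_tail_surj C0 gC.
Qed.

End Derivations.

(** * The space of tails is an infinite-dimensional Banach space *)

Section TailsSpace.
Variables (R : realType) (T : choiceType).

Lemma tails_hausdorff : hausdorff (tails R T).
Proof. by apply: decay_hausdorff; exact: ell1_hausdorff. Qed.

Lemma tails_complete : complete (tails R T).
Proof. by apply: decay_complete; exact: ell1_complete. Qed.

Lemma delta_decay m (t : T) : exists c, forall n : nat,
  n.+1%:R * `|iter n (@tshift R T) (delta R (m, t))| <= c.
Proof.
exists m.+1%:R => n; have [nm|mn] := leqP n m.
  have -> : iter n (@tshift R T) (delta R (m, t)) = delta R ((m - n)%N, t).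
    elim: n nm => [|n IH] nm; first by rewrite subn0.
    by rewrite iterS IH ?(ltnW nm)// -(prednK (_ : 0 < m - n)%N) ?subn_gt0// tshift_deltaS subnS.
  by rewrite delta_norm mulr1 ler_nat.
have -> : iter n (@tshift R T) (delta R (m, t)) = 0.
  apply: ell1_eq => -[l u]; rewrite iter_tshift deltaE xpair_eqE ell10.
  by rewrite gtn_eqF// ltn_addr.
by rewrite normr0 mulr0.
Qed.

Lemma tails_independent (t : T) :
  independent (fun m => mk_decay (tshift_blin R T) (delta_decay m t)).
Proof.
move=> n c c0 i.
have := congr1 (fun x => ell1_fun (decay_val x) (nat_of_ord i, t)) c0.
rewrite /= (blin_sum _ _ (@decay_val_linear _ _ _ _)) (linear_fun0 (@decay_val_linear _ _ _ _)).
rewrite ell1_sumE ell10 (bigD1 i)//= big1 => [|j ji].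
  by rewrite addr0 (linear_funZ _ _ (@decay_val_linear _ _ _ _)) mk_decayK ell1Z deltaE eqxx mulr1.
rewrite (linear_funZ _ _ (@decay_val_linear _ _ _ _)) mk_decayK ell1Z deltaE xpair_eqE.
by rewrite -val_eqE/= eq_sym in ji; rewrite (negbTE ji) mulr0.
Qed.

End TailsSpace.

Theorem theorem7p2 (R : realType) (k : nat) (hk : (0 < k)%N) :
  let Ak := regular_bimod (ellNk R k) in
  let D := hochZ (ptensor_bimod (Qbimod R) (ellNk R k.-1)) 1 in
  [/\ sn_iso (hochH Ak 2) (harH Ak 2),
      sn_iso (harH Ak 2) (dsum D k),
      is_banach (hochH Ak 2)
    & infinite_dim (hochH Ak 2) ].
Proof.
case: k hk => // k _ Ak D.
have hochhar : sn_iso (hochH Ak 2) (harH Ak 2).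
  by apply: hochH_harH_iso => p; exact: multi_cancel.
have hartails : sn_iso (harH Ak 2) (dsum (tails R (multi k)) k.+1) by exact: harH_tails_iso.
have dertails : sn_iso D (tails R (multi k)).
  have [f [g [fb gb fK gK f_lact]]] := ptensor_ell1 R (multi k).
  apply: (derivations_iso fb gb fK gK f_lact) => b e; exact: ptensor_symmetric.
have tailshoch := sn_iso_sym (sn_iso_trans hochhar hartails).
split=> //.
- exact: sn_iso_trans hartails (dsum_iso _ (sn_iso_sym dertails)).
- apply: complete_is_banach.
    apply: sn_iso_hausdorff tailshoch _; apply: dsum_hausdorff; exact: tails_hausdorff.
  apply: sn_iso_complete tailshoch _; apply: dsum_complete; exact: tails_complete.
- apply: sn_iso_infinite_dim tailshoch _.
  have tI := @tails_independent R (multi k) 0.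
  exact: independent_infinite_dim (dsum_independent (i0 := ord0) tI).
Qed.
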